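(* Let $I$ be an infinite index set and $R$ the irreducible locally finite root system of type $BC_I$. Let $\mathfrak q=(\mathfrak a,*,\mathcal C,f)$ be a coordinate quadruple of type $BC$, $\mathfrak b=\mathfrak b(\mathfrak q)$, $\mathcal K$ a subspace of $\mathrm{HF}(\mathfrak b)$ satisfying the uniform property on $\mathfrak b$, and let $\mathcal L=\mathcal L(\mathfrak q,\mathcal K)=(\mathcal G\otimes\mathcal A)\oplus(\mathcal S\otimes\mathcal B)\oplus(\mathcal V\otimes\mathcal C)\oplus\langle\mathfrak b,\mathfrak b\rangle$, with $\langle\mathfrak b,\mathfrak b\rangle=\{\mathfrak b,\mathfrak b\}/\mathcal K$, be the corresponding $R$-graded Lie algebra. Set $$\mathfrak A:=\mathcal L(\mathfrak q,\{0\})=(\mathcal G\otimes\mathcal A)\oplus(\mathcal S\otimes\mathcal B)\oplus(\mathcal V\otimes\mathcal C)\oplus\{\mathfrak b,\mathfrak b\}$$ (the subspace $\{0\}$ also satisfies the uniform property on $\mathfrak b$). Then $\mathfrak A$ is the universal central extension of $\mathcal L$.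
   Context: All vector spaces and algebras are over a fixed field $\mathbb F$ of characteristic zero. **Coordinate quadruples of type $BC$.** A coordinate quadruple of type $BC$ is $\mathfrak q=(\mathfrak a,*,\mathcal C,f)$ where $\mathfrak a$ is a unital associative algebra, $*$ is an involution of $\mathfrak a$ (an antiautomorphism with $*^2=\mathrm{id}$), $\mathcal C$ is a unital associative left $\mathfrak a$-module and $f:\mathcal C\times\mathcal C\to\mathfrak a$ is a skew-hermitian form: bilinear over $\mathbb F$, $f(\alpha c,c')=\alpha f(c,c')$ and $f(c,c')^*=-f(c',c)$. Let $\mathcal A,\mathcal B$ be the spaces of $*$-fixed and $*$-skew-fixed elements of $\mathfrak a$. On $\mathfrak b=\mathfrak b(\mathfrak q):=\mathfrak a\oplus\mathcal C$ put $(\alpha_1+c_1)\cdot(\alpha_2+c_2)=\alpha_1\alpha_2+f(c_1,c_2)+\alpha_1c_2+\alpha_2^*c_1$, $\beta\circ\beta'=\beta\cdot\beta'+\beta'\cdot\beta$, $[\beta,\beta']=\beta\cdot\beta'-\beta'\cdot\beta$. For $c,c'\in\mathcal C$ put $c\diamond c'=\frac12(f(c,c')-f(c',c))\in\mathcal A$ and $c\heartsuit c'=\frac12(f(c,c')+f(c',c))\in\mathcal B$. Fix an integer $\ell>3$. Define linear maps $d_{\beta,\beta'}:\mathfrak b\to\mathfrak b$ (derivations) by: for $\alpha,\alpha'\in\mathfrak a$, $d_{\alpha,\alpha'}(\beta)=\frac1{4\ell}[[\alpha,\alpha']+[\alpha^*,\alpha'^*],\beta]$ if $\beta\in\mathfrak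 a$ and $d_{\alpha,\alpha'}(\beta)=\frac1{4\ell}([\alpha,\alpha']+[\alpha^*,\alpha'^*])\cdot\beta$ if $\beta\in\mathcal C$; for $c,c'\in\mathcal C$, $d_{c,c'}(\beta)=-\frac1{2\ell}[c\heartsuit c',\beta]$ if $\beta\in\mathfrak a$ and $d_{c,c'}(\beta)=-\frac1{2\ell}(c\heartsuit c')\cdot\beta-\frac12(f(\beta,c')\cdot c+f(\beta,c)\cdot c')$ if $\beta\in\mathcal C$; $d_{\alpha,c}=d_{c,\alpha}=0$; $d_{\alpha+c,\alpha'+c'}=d_{\alpha,\alpha'}+d_{c,c'}$. Let $K\subseteq\mathfrak b\otimes\mathfrak b$ be the span of $\alpha\otimes c$, $c\otimes\alpha$, $a\otimes b$, $\alpha\otimes\alpha'+\alpha'\otimes\alpha$, $c\otimes c'-c'\otimes c$, $(\alpha\cdot\alpha')\otimes\alpha''+(\alpha''\cdot\alpha)\otimes\alpha'+(\alpha'\cdot\alpha'')\otimes\alpha$, $f(c,c')\otimes\alpha+(\alpha^*\cdot c')\otimes c-(\alpha\cdot c)\otimes c'$ ($\alpha,\alpha',\alpha''\in\mathfrak a$, $a\in\mathcal A$, $b\in\mathcal B$, $c,c'\in\mathcal C$). Put $\{\mathfrak b,\mathfrak b\}=(\mathfrak b\otimes\mathfrak b)/K$ and $\{\beta,\beta'\}=\beta\otimes\beta'+K$; it is a Lie algebra with $[\{\beta_1,\beta_2\},\{\beta_1',\beta_2'\}]=\{d_{\beta_1,\beta_2}(\beta_1'),\beta_2'\}+\{\beta_1',d_{\beta_1,\beta_2}(\beta_2')\}$.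 Put $\mathrm{HF}(\mathfrak b)=\{\sum_i\{\beta_i,\beta_i'\}\mid\sum_i d_{\beta_i,\beta_i'}=0\}$. For $\beta_r=a_r+b_r+c_r$ ($a_r\in\mathcal A$, $b_r\in\mathcal B$, $c_r\in\mathcal C$, $r=1,2$) put $\beta^*_{\beta_1,\beta_2}=[a_1,a_2]+[b_1,b_2]-c_1\heartsuit c_2$, $\beta_1^*=c_1$, $\beta_2^*=c_2$. A subspace $\mathcal K$ of $\mathrm{HF}(\mathfrak b)$ satisfies the *uniform property on $\mathfrak b$* if $\sum_i\{\beta_i,\beta_i'\}\in\mathcal K$ implies $\sum_i\beta^*_{\beta_i,\beta_i'}=0$. **Matrices.** Let $I$ be an infinite set, $J=I\uplus\bar I$, $\mathcal V$ a vector space with basis $\{v_j\mid j\in J\}$, $e_{j,k}v_i=\delta_{k,i}v_j$, $\mathfrak{gl}(J)=\mathrm{span}\{e_{j,k}\mid j,k\in J\}$. Let $(\cdot,\cdot)$ be the bilinear form on $\mathcal V$ with $(v_j,v_{\bar k})=-(v_{\bar k},v_j)=2\delta_{j,k}$, $(v_j,v_k)=(v_{\bar j},v_{\bar k})=0$ ($j,k\in I$). Put $\mathcal G=\mathfrak{sp}(I)=\{\phi\in\mathfrak{gl}(J)\mid(\phi v,w)=-(v,\phi w)\ \forall v,w\}$, $\mathcal S=\{\phi\in\mathfrak{gl}(J)\mid \mathrm{tr}\,\phi=0,\ (\phi v,w)=(v,\phi w)\ \forall v,w\}$ and $\mathcal H=\mathrm{span}\{e_{i,i}-e_{\bar i,\bar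 i}\mid i\in I\}$. Fix $I_0\subseteq I$ with $|I_0|=\ell$ and let $\mathfrak I_0$ be the endomorphism of $\mathcal V$ with $\mathfrak I_0v_j=v_j$ for $j\in I_0\cup\bar I_0$ and $\mathfrak I_0v_j=0$ otherwise. For $e,e'\in\mathcal G\cup\mathcal S\cup\{\mathfrak I_0\}$ put $[e,e']=ee'-e'e$ and $e\circ e'=ee'+e'e-\frac{\mathrm{tr}(ee')}{\ell}\mathfrak I_0$. For $u,v\in\mathcal V$ let $u\circ v\in\mathcal G$ and $[u,v]\in\mathcal S$ be $(u\circ v)(w)=\frac12((v,w)u+(u,w)v)$ and $[u,v](w)=\frac12((v,w)u-(u,w)v)+\frac{(u,v)}{2\ell}\mathfrak I_0w$. **The Lie algebra $\mathcal L(\mathfrak q,\mathcal K)$.** For a subspace $\mathcal K\subseteq\mathrm{HF}(\mathfrak b)$ with the uniform property, $\mathcal L(\mathfrak q,\mathcal K)=(\mathcal G\otimes\mathcal A)\oplus(\mathcal S\otimes\mathcal B)\oplus(\mathcal V\otimes\mathcal C)\oplus(\{\mathfrak b,\mathfrak b\}/\mathcal K)$ with, writing $\langle\beta,\beta'\rangle=\{\beta,\beta'\}+\mathcal K$, the (antisymmetric) bracket - $[x\otimes a,y\otimes a']=[x,y]\otimes\frac12(a\circ a')+(x\circ y)\otimes\frac12[a,a']+\mathrm{tr}(xy)\langle a,a'\rangle$, - $[x\otimes a,s\otimes b]=(x\circ s)\otimes\frac12[a,b]+[x,s]\otimes\frac12(a\circ b)$, - $[s\otimes b,t\otimes b']=[s,t]\otimes\frac12(b\circ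 b')+(s\circ t)\otimes\frac12[b,b']+\mathrm{tr}(st)\langle b,b'\rangle$, - $[x\otimes a,u\otimes c]=xu\otimes a\cdot c$, $\ [s\otimes b,u\otimes c]=su\otimes b\cdot c$, - $[u\otimes c,v\otimes c']=(u\circ v)\otimes(c\diamond c')+[u,v]\otimes(c\heartsuit c')+(u,v)\langle c,c'\rangle$, - $[\langle\beta_1,\beta_2\rangle,x\otimes a]=-\frac1{4\ell}((x\circ\mathfrak I_0)\otimes[a,\beta^*_{\beta_1,\beta_2}]+[x,\mathfrak I_0]\otimes(a\circ\beta^*_{\beta_1,\beta_2}))$, - $[\langle\beta_1,\beta_2\rangle,s\otimes b]=-\frac1{4\ell}([s,\mathfrak I_0]\otimes(b\circ\beta^*_{\beta_1,\beta_2})+(s\circ\mathfrak I_0)\otimes[b,\beta^*_{\beta_1,\beta_2}]+2\,\mathrm{tr}(s\mathfrak I_0)\langle b,\beta^*_{\beta_1,\beta_2}\rangle)$, - $[\langle\beta_1,\beta_2\rangle,v\otimes c]=\frac1{2\ell}\mathfrak I_0v\otimes(\beta^*_{\beta_1,\beta_2}\cdot c)-\frac12v\otimes(f(c,\beta_2^* )\cdot\beta_1^*+f(c,\beta_1^* )\cdot\beta_2^* )$, - $[\langle\beta_1,\beta_2\rangle,\langle\beta_1',\beta_2'\rangle]=\langle d_{\beta_1,\beta_2}(\beta_1'),\beta_2'\rangle+\langle\beta_1',d_{\beta_1,\beta_2}(\beta_2')\rangle$, for $x,y\in\mathcal G$, $s,t\in\mathcal S$, $u,v\in\mathcal V$,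 $a,a'\in\mathcal A$, $b,b'\in\mathcal B$, $c,c'\in\mathcal C$, $\beta_r,\beta_r'\in\mathfrak b$. **Graded Lie algebras.** $R=\{0,\pm\epsilon_i,\pm2\epsilon_i,\pm\epsilon_i\pm\epsilon_j\mid i\ne j\in I\}$ is the root system of type $BC_I$. A Lie algebra $\mathcal M$ is $R$-graded with grading pair $(\mathfrak g,\mathfrak h)$ if $\mathfrak g$ is a locally finite split simple Lie subalgebra of $\mathcal M$ with splitting Cartan subalgebra $\mathfrak h$ and root system $R_{sdiv}=R\setminus\{\pm\epsilon_i\mid i\in I\}$ (type $C_I$), $\mathcal M=\bigoplus_{\alpha\in R}\mathcal M_\alpha$ is a weight space decomposition with respect to $\mathfrak h$ (adjoint action), and $\mathcal M_0=\sum_{\alpha\in R\setminus\{0\}}[\mathcal M_\alpha,\mathcal M_{-\alpha}]$. $\mathcal L(\mathfrak q,\mathcal K)$ is $R$-graded with grading pair $(\mathcal G\otimes 1,\mathcal H\otimes1)$. **Central extensions.** A central extension of $\mathcal L$ is a Lie algebra epimorphism onto $\mathcal L$ whose kernel lies in the center of its domain. A Lie algebra $\mathfrak A$ is the universal central extension of $\mathcal L$ if there is a central extension $\pi:\mathfrak A\to\mathcal L$ such that for every central extension $\varphi:\mathcal M\to\mathcal L$ there is a unique Lie algebra homomorphism $\psi:\mathfrak A\to\mathcal M$ with $\varphi\circ\psi=\pi$. *)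

(* Defs.v *)
From HB Require Import structures.
From mathcomp Require Import all_boot all_order all_algebra.
From mathcomp Require Import finmap boolp classical_sets functions cardinality.
From mathcomp Require Import fsbigop.
From mathcomp Require Import xfinmap monalg.

Set Implicit Arguments.
Unset Strict Implicit.
Unset Printing Implicit Defensive.

Import GRing.Theory.
Local Open Scope classical_set_scope.
Local Open Scope fset_scope.
Local Open Scope ring_scope.
Local Open Scope quotient_scope.

(* Throughout, a subspace of W is an inhabitant of submodClosed W, i.e. a     *)
(* (classically) boolean predicate closed under linear combinations.          *)

Section Span.
Variables (F : fieldType) (W : lmodType F).

Definition lspan (P : set W) : {pred W} :=
  [pred w : W | `[< exists s : seq (F * W),
    (forall p, p \in s -> P p.2) /\ w = \sum_(p <- s) p.1 *: p.2 >]].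

Fact lspan_submod (P : set W) : submod_closed (lspan P).
Proof.
split; first by apply/asboolP; exists [::]; split=> //; rewrite big_nil.
move=> k u v /asboolP[s [Ps ->]] /asboolP[t [Pt ->]]; apply/asboolP.
exists ([seq (k * p.1, p.2) | p <- s] ++ t); split.
  move=> p; rewrite mem_cat => /orP[/mapP[p' /Ps ? ->] //|]; exact: Pt.
rewrite big_cat big_map /= scaler_sumr; congr (_ + _).
by apply: eq_bigr => p _; rewrite scalerA.
Qed.

HB.instance Definition _ (P : set W) := GRing.isSubmodClosed.Build F W (lspan P)
  (lspan_submod P).

Lemma mem_lspan (P : set W) w : P w -> w \in lspan P.
Proof.
move=> Pw; apply/asboolP; exists [:: (1, w)]; split.
  by move=> p; rewrite inE => /eqP->.
by rewrite big_seq1 scale1r.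
Qed.

Definition zero_space : {pred W} := pred1 0.

Fact zero_space_submod : submod_closed zero_space.
Proof.
split; first by rewrite inE.
by move=> k u v /eqP-> /eqP->; rewrite scaler0 addr0 inE.
Qed.

HB.instance Definition _ := GRing.isSubmodClosed.Build F W zero_space
  zero_space_submod.

End Span.
Arguments zero_space {F} W.

Section Subspace.
Variables (F : fieldType) (W : lmodType F) (S : submodClosed W).

Record subspace := Subspace { subspace_val :> W; _ : subspace_val \in S }.

HB.instance Definition _ := [isSub for subspace_val].
HB.instance Definition _ := [Choice of subspace by <:].
HB.instance Definition _ := [SubChoice_isSubLmodule of subspace by <:].

End Subspace.

Section QuotientSpace.
Variables (F : fieldType) (W : lmodType F) (S : submodClosed W).

Fact submod_zmod_closed : zmod_closed S.
Proof. by split=> [|u v Su Sv]; rewrite ?rpred0 // -scaleN1r rpredD ?rpredZ. Qed.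

Definition zmod_of_submod : zmodClosed W :=
  HB.pack_for (zmodClosed W) (GRing.SubmodClosed.sort S)
    (GRing.isZmodClosed.Build W (GRing.SubmodClosed.sort S) submod_zmod_closed).

Definition quotient := Quotient.quot zmod_of_submod.

HB.instance Definition _ := GRing.Zmodule.on quotient.

Definition qclass (w : W) : quotient := \pi w.
Definition qscale (k : F) (x : quotient) : quotient := qclass (k *: repr x).

Lemma qclassP u v : qclass u = qclass v <-> u - v \in S.
Proof.
split=> [/eqP|Suv].
  by rewrite -[_ == _]Quotient.idealrBE.
by apply/eqP; rewrite -[_ == _]Quotient.idealrBE.
Qed.

Lemma qclass_repr x : qclass (repr x) = x.
Proof. exact: reprK. Qed.

Lemma qclassD u v : qclass (u + v) = qclass u + qclass v.
Proof. exact: Quotient.pi_add. Qed.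

Lemma qscaleE k w : qscale k (qclass w) = qclass (k *: w).
Proof.
by apply/qclassP; rewrite -scalerBr rpredZ //; apply/qclassP; rewrite qclass_repr.
Qed.

Fact qscaleA a b x : qscale a (qscale b x) = qscale (a * b) x.
Proof. by rewrite -[x]qclass_repr !qscaleE scalerA. Qed.
Fact qscale1 : left_id 1 qscale.
Proof. by move=> x; rewrite -[x in LHS]qclass_repr qscaleE scale1r qclass_repr. Qed.
Fact qscaleDr : right_distributive qscale +%R.
Proof.
move=> a x y; rewrite -[x]qclass_repr -[y]qclass_repr -qclassD !qscaleE.
by rewrite scalerDr qclassD.
Qed.
Fact qscaleDl x a b : qscale (a + b) x = qscale a x + qscale b x.
Proof. by rewrite -[x]qclass_repr !qscaleE scalerDl qclassD. Qed.

HB.instance Definition _ := GRing.Zmodule_isLmodule.Build F quotient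
  qscaleA qscale1 qscaleDr qscaleDl.

Fact qclass_linear : linear qclass.
Proof. by move=> k u v; rewrite qclassD -qscaleE. Qed.
HB.instance Definition _ := GRing.isLinear.Build F W quotient *:%R qclass
  qclass_linear.

Section Lift.
Variables (X : lmodType F) (m : W -> X).

Definition qlift (x : quotient) : X := m (repr x).

Lemma qliftE : linear m -> (forall w, w \in S -> m w = 0) ->
  forall w, qlift (qclass w) = m w.
Proof.
move=> m_lin m0 w; apply/eqP; rewrite -subr_eq0; apply/eqP.
rewrite /qlift addrC -scaleN1r -m_lin m0 // addrC scaleN1r.
by apply/qclassP; rewrite qclass_repr.
Qed.

End Lift.
End QuotientSpace.


(* {malg F[K]} is the vector space with basis << k >>, k : K.                 *)
Section LinearExtension.
Variables (F : fieldType) (K : choiceType) (X : lmodType F) (h : K -> X).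

Definition linext (g : {malg F[K]}) : X := \sum_(k <- msupp g) g@_k *: h k.

Lemma linextEw (D : {fset K}) g : msupp g `<=` D ->
  linext g = \sum_(k <- D) g@_k *: h k.
Proof.
move=> gD; apply: big_fset_incl => // k _ kg.
by rewrite mcoeff_outdom ?scale0r.
Qed.

Fact linext_linear : linear linext.
Proof.
move=> a u v; set D := msupp (a *: u + v) `|` (msupp u `|` msupp v).
rewrite !(@linextEw D) ?fsubsetUl //; first last.
- exact: fsubset_trans (fsubsetUl _ _) (fsubsetUr _ _).
- exact: fsubset_trans (fsubsetUr _ _) (fsubsetUr _ _).
rewrite scaler_sumr -big_split; apply: eq_bigr => k _ /=.
by rewrite mcoeffD mcoeffZ scalerDl scalerA.
Qed.

HB.instance Definition _ := GRing.isLinear.Build F {malg F[K]} X *:%R linext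
  linext_linear.

Lemma linextU k : linext << k >> = h k.
Proof. by rewrite (linextEw msuppU_le) big_seq_fset1 mcoeffUU scale1r. Qed.

End LinearExtension.

Section Tensor.
Variables (F : fieldType) (U W : lmodType F).

Variant tensor_relation : {malg F[(U * W)%type]} -> Prop :=
| TensorRelL k u u' w : tensor_relation
    (<< (k *: u + u', w) >> - (k *: << (u, w) >> + << (u', w) >>))
| TensorRelR k u w w' : tensor_relation
    (<< (u, k *: w + w') >> - (k *: << (u, w) >> + << (u, w') >>)).

Definition tensor := quotient (lspan (tensor_relation : set _)).

HB.instance Definition _ := GRing.Lmodule.on tensor.

Definition tens (u : U) (w : W) : tensor := qclass _ << (u, w) >>.

Lemma tens_linearl w : linear (tens^~ w).
Proof.
move=> k u u'; rewrite /tens -qclass_linear; apply/qclassP.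
exact/mem_lspan/TensorRelL.
Qed.

Lemma tens_linearr u : linear (tens u).
Proof.
move=> k w w'; rewrite /tens -qclass_linear; apply/qclassP.
exact/mem_lspan/TensorRelR.
Qed.

(* The map on the tensor product induced by m, meaningful for bilinear m.     *)
Definition tlift (X : lmodType F) (m : U -> W -> X) (t : tensor) : X :=
  qlift (linext (fun p => m p.1 p.2)) t.

Section Lift.
Variables (X : lmodType F) (m : U -> W -> X).
Hypothesis m_linearl : forall w, linear (m^~ w).
Hypothesis m_linearr : forall u, linear (m u).

Let linext_rel g : g \in lspan (tensor_relation : set _) ->
  linext (fun p => m p.1 p.2) g = 0.
Proof.
move=> /asboolP[s [rel_s ->]]; rewrite linear_sum big1_seq // => p /rel_s rel_p.
rewrite linearZ /=; case: rel_p => *.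
  by rewrite linearB linearP /= !linextU /= m_linearl subrr scaler0.
by rewrite linearB linearP /= !linextU /= m_linearr subrr scaler0.
Qed.

Lemma tlift_tens u w : tlift m (tens u w) = m u w.
Proof. by rewrite /tlift qliftE ?linextU //; exact: linext_linear. Qed.

Lemma tlift_linear : linear (tlift m).
Proof.
move=> k t t'; rewrite -[t]qclass_repr -[t']qclass_repr -qclass_linear /tlift.
by rewrite !qliftE ?linext_linear //; exact: linext_linear.
Qed.

End Lift.
End Tensor.

(* Matrices over J = I + I, where inl i stands for i and inr i for \bar i.    *)

Section Matrices.
Variables (F : fieldType) (I : choiceType).

Definition Vsp : lmodType F := {malg F[(I + I)%type]}.

(* e_{j,k} *)
Definition elem (j k : I + I) (w : Vsp) : Vsp := w@_k *: << j >>.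

Definition glJ : {pred Vsp -> Vsp} :=
  lspan [set phi | exists j k, phi = elem j k].

Definition trace (phi : Vsp -> Vsp) : F :=
  \sum_(j \in [set: I + I]) (phi << j >>)@_j.

Definition basis_form (j k : I + I) : F^o :=
  match j, k with
  | inl i, inr i' => if i == i' then 2 else 0
  | inr i, inl i' => if i == i' then - 2 else 0
  | _, _ => 0
  end.

Definition form (v w : Vsp) : F := linext (fun j => linext (basis_form j) w) v.

Definition spI : {pred Vsp -> Vsp} := [pred phi | (phi \in glJ) &&
  `[< forall v w, form (phi v) w = - form v (phi w) >]].

Definition symI : {pred Vsp -> Vsp} := [pred phi |
  [&& phi \in glJ, trace phi == 0 & `[< forall v w, form (phi v) w = form v (phi w) >]]].

Lemma form_linearl w : linear (form^~ w : Vsp -> F^o).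
Proof. exact: linext_linear. Qed.

Lemma form_linearr v : linear (form v : Vsp -> F^o).
Proof.
move=> k w w'; rewrite /form /linext scaler_sumr -big_split /=.
apply: eq_bigr => j _; rewrite -!/(linext _ _) linearP /=.
by rewrite scalerDr !scalerA mulrC.
Qed.

Lemma form0l w : form 0 w = 0.
Proof. by rewrite /form linear0. Qed.

Lemma form0r v : form v 0 = 0.
Proof. by rewrite /form [LHS]big1 // => j _; rewrite linear0 scaler0. Qed.

Lemma glJ_finite phi : phi \in glJ -> finite_set [set j | phi << j >> != 0].
Proof.
move=> /asboolP[s [s_elem ->]]; elim: s => [|p s IHs] in s_elem *.
  by rewrite big_nil; apply: sub_finite_set (finite_set0 _) => j /=; rewrite eqxx.
rewrite big_cons; have [j [k p_jk]] := s_elem p (mem_head _ _).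
have /IHs fin_s: forall p', p' \in s ->
    [set phi | exists j k, phi = elem j k] p'.2.
  by move=> p' p's; apply: s_elem; rewrite inE p's orbT.
apply: sub_finite_set (_ : finite_set ([set k] `|` _)); last first.
  by rewrite finite_setU; split; [exact: finite_set1 | exact: fin_s].
move=> i /= nz; have [->|ik] := eqVneq i k; [by left | right].
apply: contraNneq nz => sum0; rewrite /GRing.add /= sum0 addr0 p_jk.
by rewrite /GRing.scale /= /elem mcoeffU (negPf ik) scale0r scaler0.
Qed.

Lemma trace_linear k phi psi : phi \in glJ -> psi \in glJ ->
  trace (k *: phi + psi) = k * trace phi + trace psi.
Proof.
move=> /glJ_finite fin1 /glJ_finite fin2.
pose D := fset_set [set j | phi << j >> != 0] `|`
          fset_set [set j | psi << j >> != 0].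
have D0 j : j \notin D -> phi << j >> = 0 /\ psi << j >> = 0.
  rewrite inE !in_fset_set // negb_or => /andP[n1 n2]; split; apply/eqP;
  [move: n1 | move: n2]; apply: contraNT => nz; exact/mem_set.
have D_zero j : j \notin D -> ((k *: phi + psi) << j >>)@_j = 0.
  move=> /D0[e1 e2].
  by rewrite /GRing.add /GRing.scale /= e1 e2 scaler0 addr0 mcoeff0.
have phi_zero j : j \notin D -> (phi << j >>)@_j = 0.
  by move=> /D0[-> _]; rewrite mcoeff0.
have psi_zero j : j \notin D -> (psi << j >>)@_j = 0.
  by move=> /D0[_ ->]; rewrite mcoeff0.
rewrite /trace (fsbigTE _ _ D_zero) (fsbigTE _ _ phi_zero) (fsbigTE _ _ psi_zero).
rewrite mulr_sumr -big_split; apply: eq_bigr => j _ /=.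
by rewrite mcoeffD mcoeffZ.
Qed.

Fact spI_submod : submod_closed spI.
Proof.
split=> [|k phi psi].
  rewrite inE rpred0; apply/asboolP => v w.
  by rewrite -[LHS]/(form 0 w) -[RHS]/(- form v 0) form0l form0r oppr0.
move=> /andP[phi_gl /asboolP phi_sp] /andP[psi_gl /asboolP psi_sp].
rewrite inE rpredD ?rpredZ //; apply/asboolP => v w.
by rewrite form_linearl form_linearr phi_sp psi_sp scalerN opprD.
Qed.
HB.instance Definition _ := GRing.isSubmodClosed.Build F (Vsp -> Vsp) spI spI_submod.

Fact symI_submod : submod_closed symI.
Proof.
split=> [|k phi psi].
  rewrite inE rpred0 /=; apply/andP; split.
    by rewrite /trace fsbig1 // => j _; rewrite mcoeff0.
  apply/asboolP => v w.
  by rewrite -[LHS]/(form 0 w) -[RHS]/(form v 0) form0l form0r.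
move=> /and3P[phi_gl /eqP phi0 /asboolP phi_sym].
move=> /and3P[psi_gl /eqP psi0 /asboolP psi_sym].
rewrite inE rpredD ?rpredZ //=; apply/andP; split.
  by rewrite trace_linear // phi0 psi0 mulr0 addr0.
by apply/asboolP => v w; rewrite form_linearl form_linearr phi_sym psi_sym.
Qed.
HB.instance Definition _ := GRing.isSubmodClosed.Build F (Vsp -> Vsp) symI symI_submod.

Definition mcomm (x y : Vsp -> Vsp) : Vsp -> Vsp := (x \o y) - (y \o x).

Definition vcirc (u v : Vsp) : Vsp -> Vsp :=
  fun w => 2^-1 *: (form v w *: u + form u w *: v).

Variables (l : nat) (I0 : {fset I}).

Definition base (j : I + I) : I := match j with inl i => i | inr i => i end.

(* \mathfrak I_0 *)
Definition idI0 : Vsp -> Vsp :=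
  linext (fun j => if base j \in I0 then << j >> else 0).

Definition mcirc (x y : Vsp -> Vsp) : Vsp -> Vsp :=
  (x \o y) + (y \o x) - (trace (x \o y) / l%:R) *: idI0.

Definition vcomm (u v : Vsp) : Vsp -> Vsp :=
  fun w => 2^-1 *: (form v w *: u - form u w *: v)
           + (form u v / (2 * l)%N%:R) *: idI0 w.

End Matrices.
Arguments glJ : clear implicits.
Arguments spI : clear implicits.
Arguments symI : clear implicits.

Record quadrupleBC (F : fieldType) := QuadrupleBC {
  qa : algType F;
  qstar : {linear qa -> qa};
  qC : lmodType F;
  qact : qa -> qC -> qC;
  qf : qC -> qC -> qa;
  qstarM : forall x y, qstar (x * y) = qstar y * qstar x;
  qstarK : involutive qstar;
  qact_linearl : forall c, linear (qact^~ c);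
  qact_linearr : forall x, linear (qact x);
  qactM : forall x y c, qact (x * y) c = qact x (qact y c);
  qact1 : forall c, qact 1 c = c;
  qf_linearl : forall c, linear (qf^~ c);
  qf_linearr : forall c, linear (qf c);
  qf_act : forall x c c', qf (qact x c) c' = x * qf c c';
  qf_star : forall c c', qstar (qf c c') = - qf c' c
}.

Section Coordinates.
Variables (F : fieldType) (q : quadrupleBC F).
Local Notation a := (qa q).
Local Notation C := (qC q).
Local Notation star := (qstar q).
Local Notation act := (qact (q := q)).
Local Notation f := (qf (q := q)).

Definition fixed : {pred a} := [pred x | star x == x].
Definition skew : {pred a} := [pred x | star x == - x].

Fact fixed_submod : submod_closed fixed.
Proof.
split=> [|k x y]; first by rewrite inE linear0.
by rewrite !inE => /eqP x_fixed /eqP y_fixed; rewrite linearP x_fixed y_fixed.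
Qed.
HB.instance Definition _ := GRing.isSubmodClosed.Build F a fixed fixed_submod.

Fact skew_submod : submod_closed skew.
Proof.
split=> [|k x y]; first by rewrite inE linear0 oppr0.
rewrite !inE => /eqP x_skew /eqP y_skew.
by rewrite linearP x_skew y_skew scalerN opprD.
Qed.
HB.instance Definition _ := GRing.isSubmodClosed.Build F a skew skew_submod.

Definition fixed_part (x : a) : a := 2^-1 *: (x + star x).
Definition skew_part (x : a) : a := 2^-1 *: (x - star x).

Definition acomm (x y : a) : a := x * y - y * x.
Definition acirc (x y : a) : a := x * y + y * x.
Definition diamond (c c' : C) : a := 2^-1 *: (f c c' - f c' c).
Definition heart (c c' : C) : a := 2^-1 *: (f c c' + f c' c).

Definition coord : lmodType F := (a * C)%type.
Definition of_a (x : a) : coord := (x, 0).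
Definition of_C (c : C) : coord := (0, c).

Local Notation "b1 # b2" := (tens (b1 : coord) (b2 : coord))
  (at level 35).

Variant bracket_relation : tensor coord coord -> Prop :=
| BracketAC x c : bracket_relation (of_a x # of_C c)
| BracketCA c x : bracket_relation (of_C c # of_a x)
| BracketFixedSkew x y : x \in fixed -> y \in skew ->
    bracket_relation (of_a x # of_a y)
| BracketAA x y : bracket_relation (of_a x # of_a y + of_a y # of_a x)
| BracketCC c c' : bracket_relation (of_C c # of_C c' - of_C c' # of_C c)
| BracketCycle x y z : bracket_relation
    (of_a (x * y) # of_a z + of_a (z * x) # of_a y + of_a (y * z) # of_a x)
| BracketForm x c c' : bracket_relation
    (of_a (f c c') # of_a x + of_C (act (star x) c') # of_C c
     - of_C (act x c) # of_C c').

(* {b, b} *)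
Definition bbracket := quotient (lspan (bracket_relation : set _)).
HB.instance Definition _ := GRing.Lmodule.on bbracket.

Definition bpair (b1 b2 : coord) : bbracket := qclass _ (b1 # b2).

(* The element \beta^*_{\beta_1, \beta_2}. *)
Definition bstar (b1 b2 : coord) : a :=
  acomm (fixed_part b1.1) (fixed_part b2.1)
  + acomm (skew_part b1.1) (skew_part b2.1) - heart b1.2 b2.2.

Variable l : nat.

Definition der_a (x y : a) (b : coord) : coord :=
  let z := (4 * l)%N%:R^-1 *: (acomm x y + acomm (star x) (star y)) in
  (acomm z b.1, act z b.2).

Definition der_C (c c' : C) (b : coord) : coord :=
  let z := - ((2 * l)%N%:R^-1 *: heart c c') in
  (acomm z b.1,
   act z b.2 - 2^-1 *: (act (f b.2 c') c + act (f b.2 c) c')).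

(* d_{\beta_1, \beta_2} *)
Definition der (b1 b2 : coord) : coord -> coord :=
  der_a b1.1 b2.1 + der_C b1.2 b2.2.

Definition HF : set bbracket := [set z | exists s : seq (coord * coord),
  z = \sum_(p <- s) bpair p.1 p.2 /\ \sum_(p <- s) der p.1 p.2 = 0].

Definition uniform_property (K : submodClosed bbracket) : Prop :=
  (forall z, z \in K -> HF z) /\
  forall s : seq (coord * coord), \sum_(p <- s) bpair p.1 p.2 \in K ->
    \sum_(p <- s) bstar p.1 p.2 = 0.

End Coordinates.
Arguments fixed {F} q _.
Arguments skew {F} q _.

Section LieAlgebraLqK.
Variables (F : fieldType) (I : choiceType) (l : nat) (I0 : {fset I}).
Variables (q : quadrupleBC F) (K : submodClosed (bbracket q)).
Local Notation a := (qa q).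
Local Notation C := (qC q).
Local Notation act := (qact (q := q)).
Local Notation f := (qf (q := q)).
Local Notation V := (Vsp F I).
Local Notation E := (V -> V).

Local Notation GA := (tensor (subspace (spI F I)) (subspace (fixed q))).
Local Notation SB := (tensor (subspace (symI F I)) (subspace (skew q))).
Local Notation VC := (tensor V C).

Definition LqK : lmodType F := (GA * SB * VC * quotient K)%type.

(* inGA x al is the pure tensor of x and al when x is in spI and al is fixed, *)
(* and inSB s be that of s and be when s is in symI and be is skew. The       *)
(* brackets below only apply inGA and inSB to such arguments, so the default  *)
(* value 0 of insubd plays no role.                                           *)
Definition inGA (x : E) (al : a) : LqK :=
  (tens (insubd (0 : subspace (spI F I)) x)
        (insubd (0 : subspace (fixed q)) al), 0, 0, 0).
Definition inSB (s : E) (be : a) : LqK :=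
  (0, tens (insubd (0 : subspace (symI F I)) s)
           (insubd (0 : subspace (skew q)) be), 0, 0).
Definition inVC (v : V) (c : C) : LqK := (0, 0, tens v c, 0).
Definition inBB (b1 b2 : coord q) : LqK := (0, 0, 0, qclass K (bpair b1 b2)).

Variant generator :=
| GenGA of E & a
| GenSB of E & a
| GenVC of V & C
| GenBB of coord q & coord q.

Definition bracket_GA_GA (x : E) (al : a) (y : E) (al' : a) : LqK :=
  inGA (mcomm x y) (2^-1 *: acirc al al')
  + inSB (mcirc l I0 x y) (2^-1 *: acomm al al')
  + trace (x \o y) *: inBB (of_a al) (of_a al').

Definition bracket_GA_SB (x : E) (al : a) (s : E) (be : a) : LqK :=
  inGA (mcirc l I0 x s) (2^-1 *: acomm al be)
  + inSB (mcomm x s) (2^-1 *: acirc al be).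

Definition bracket_SB_SB (s : E) (be : a) (t : E) (be' : a) : LqK :=
  inGA (mcomm s t) (2^-1 *: acirc be be')
  + inSB (mcirc l I0 s t) (2^-1 *: acomm be be')
  + trace (s \o t) *: inBB (of_a be) (of_a be').

Definition bracket_GA_VC (x : E) (al : a) (u : V) (c : C) : LqK := inVC (x u) (act al c).

Definition bracket_SB_VC (s : E) (be : a) (u : V) (c : C) : LqK := inVC (s u) (act be c).

Definition bracket_VC_VC (u : V) (c : C) (v : V) (c' : C) : LqK :=
  inGA (vcirc u v) (diamond c c') + inSB (vcomm l I0 u v) (heart c c')
  + form u v *: inBB (of_C c) (of_C c').

Definition bracket_BB_GA (b1 b2 : coord q) (x : E) (al : a) : LqK :=
  - (4 * l)%N%:R^-1 *:
    (inGA (mcirc l I0 x (idI0 I0)) (acomm al (bstar b1 b2))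
     + inSB (mcomm x (idI0 I0)) (acirc al (bstar b1 b2))).

Definition bracket_BB_SB (b1 b2 : coord q) (s : E) (be : a) : LqK :=
  - (4 * l)%N%:R^-1 *:
    (inGA (mcomm s (idI0 I0)) (acirc be (bstar b1 b2))
     + inSB (mcirc l I0 s (idI0 I0)) (acomm be (bstar b1 b2))
     + (2 * trace (s \o idI0 I0)) *: inBB (of_a be) (of_a (bstar b1 b2))).

Definition bracket_BB_VC (b1 b2 : coord q) (v : V) (c : C) : LqK :=
  (2 * l)%N%:R^-1 *: inVC (idI0 I0 v) (act (bstar b1 b2) c)
  - 2^-1 *: inVC v (act (f c b2.2) b1.2 + act (f c b1.2) b2.2).

Definition bracket_BB_BB (b1 b2 b1' b2' : coord q) : LqK :=
  inBB (der l b1 b2 b1') b2' + inBB b1' (der l b1 b2 b2').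

Definition bracket_generator (g h : generator) : LqK :=
  match g, h with
  | GenGA x al, GenGA y al' => bracket_GA_GA x al y al'
  | GenGA x al, GenSB s be => bracket_GA_SB x al s be
  | GenGA x al, GenVC u c => bracket_GA_VC x al u c
  | GenGA x al, GenBB b1 b2 => - bracket_BB_GA b1 b2 x al
  | GenSB s be, GenGA x al => - bracket_GA_SB x al s be
  | GenSB s be, GenSB t be' => bracket_SB_SB s be t be'
  | GenSB s be, GenVC u c => bracket_SB_VC s be u c
  | GenSB s be, GenBB b1 b2 => - bracket_BB_SB b1 b2 s be
  | GenVC u c, GenGA x al => - bracket_GA_VC x al u c
  | GenVC u c, GenSB s be => - bracket_SB_VC s be u c
  | GenVC u c, GenVC v c' => bracket_VC_VC u c v c'
  | GenVC u c, GenBB b1 b2 => - bracket_BB_VC b1 b2 u c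
  | GenBB b1 b2, GenGA x al => bracket_BB_GA b1 b2 x al
  | GenBB b1 b2, GenSB s be => bracket_BB_SB b1 b2 s be
  | GenBB b1 b2, GenVC v c => bracket_BB_VC b1 b2 v c
  | GenBB b1 b2, GenBB b1' b2' => bracket_BB_BB b1 b2 b1' b2'
  end.

(* The linear map LqK -> LqK whose values on the four families of generators  *)
(* are given by m; m is meant to be bilinear on each family and compatible    *)
(* with the relations defining {b, b} and with K.                             *)
Definition generator_lift (m : generator -> LqK) (X : LqK) : LqK :=
  let: (ga, sb, vc, bb) := X in
  tlift (fun x al => m (GenGA (val x) (val al))) ga
  + tlift (fun s be => m (GenSB (val s) (val be))) sb
  + tlift (fun v c => m (GenVC v c)) vc
  + qlift (qlift (tlift (fun b1 b2 => m (GenBB b1 b2)))) bb.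

Definition bracket (X Y : LqK) : LqK :=
  generator_lift
    (fun g => generator_lift (fun h => bracket_generator g h) Y) X.

End LieAlgebraLqK.
Arguments bracket {F I} l I0 {q} K X Y.

Section LieAlgebras.
Variable F : fieldType.

Record is_lie_bracket (L : lmodType F) (br : L -> L -> L) : Prop := {
  lie_linearl : forall y, linear (br^~ y);
  lie_linearr : forall x, linear (br x);
  lie_alternating : forall x, br x x = 0;
  lie_jacobi : forall x y z, br x (br y z) + br y (br z x) + br z (br x y) = 0
}.

Definition lie_morphism (L M : lmodType F) (brL : L -> L -> L)
    (brM : M -> M -> M) (phi : L -> M) : Prop :=
  {morph phi : x y / brL x y >-> brM x y}.

Record is_central_extension (M L : lmodType F) (brM : M -> M -> M)
    (brL : L -> L -> L) (phi : {linear M -> L}) : Prop := {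
  ext_lie_source : is_lie_bracket brM;
  ext_lie_target : is_lie_bracket brL;
  ext_morphism : lie_morphism brM brL phi;
  ext_surjective : forall y, exists x, phi x = y;
  ext_central : forall z, phi z = 0 -> forall x, brM z x = 0
}.

Definition is_universal_central_extension (A L : lmodType F)
    (brA : A -> A -> A) (brL : L -> L -> L) : Prop :=
  exists2 pi : {linear A -> L}, is_central_extension brA brL pi &
  forall (M : lmodType F) (brM : M -> M -> M) (phi : {linear M -> L}),
    is_central_extension brM brL phi ->
    exists psi : {linear A -> M},
      [/\ lie_morphism brA brM psi, phi \o psi =1 pi &
          forall psi' : {linear A -> M}, lie_morphism brA brM psi' ->
            phi \o psi' =1 pi -> psi' =1 psi].

End LieAlgebras.

(* Main.v *)
(* Let U be the space of triples (X, w, z), where X is a finitary matrix over *)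
(* a with rows and columns indexed by J, w is in V (x) C and z is in {b, b},  *)
(* with brackets [X, Y] = XY - YX + sum_jk {X_jk, Y_kj}, [X, w] = Xw, [w, w'] *)
(* given by f and the form of V, and [z, -] by derivations of C alone. The    *)
(* triples such that X is skew for the involution                             *)
(*   e_{j,k} x |-> s_j s_k e_{bar k, bar j} x^*                               *)
(* and tr X = beta^*_z form a Lie algebra U', and L(q, K) is the quotient of  *)
(* U' by the central subspace (0, 0, K): the terms with I_0 in the brackets   *)
(* of L(q, K) only come from splitting X into trace zero and trace parts. So  *)
(* L(q, 0) = U' and L(q, 0) -> L(q, K) is a central extension.                *)
(*   A central extension of L(q, K) pulls back to a 2-cocycle om on U', and   *)
(* universality amounts to om u u' = psi [u, u'] for a linear psi. On nonzero *)
(* weights of h_i = e_{i,i} - e_{bar i,bar i} the value of psi is forced.     *)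
(* Between opposite root spaces one gets, since I is infinite and fresh       *)
(* indices always exist,                                                      *)
(*   om(t_{j,k}(x), t_{k,j}(y)) = eta_j(xy) - eta_k(yx) + 2 kappa(x, y)       *)
(* for the skew elements t_{j,k}(x) attached to e_{j,k} x, with kappa         *)
(* independent of j and k, and similarly gamma(c, c') on short roots; kappa   *)
(* and gamma satisfy the defining relations of {b, b}, hence define psi       *)
(* there. The lift is unique because U' is perfect.                           *)
Require Import Defs.
From HB Require Import structures.
From mathcomp Require Import all_boot all_order all_algebra.
From mathcomp Require Import finmap boolp classical_sets functions cardinality.
From mathcomp Require Import fsbigop xfinmap monalg.
From mathcomp Require Import ring.

Set Implicit Arguments.
Unset Strict Implicit.
Unset Printing Implicit Defensive.

Import GRing.Theory.
Local Open Scope classical_set_scope.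
Local Open Scope fset_scope.
Local Open Scope ring_scope.

(** * Identities between linear combinations *)

(** The bracket formulas of L(q, K) are intricate only because matrices are split into a trace zero
    part and a multiple of I_0. In the matrix model the splitting disappears: [mbr] satisfies the
    Jacobi identity on the [model_ok] elements ([mbr_jacobi], [model_ok_mbr]), and [bracketE] shows
    that the given bracket is the image under [realize] of the model bracket of preimages. The
    uniform property and the definition of HF say that beta^* and the derivation vanish on K, so K
    is central in the model ([K_central]). Hence L(q, 0) is the algebra of [model_ok] elements
    ([theta0_rho0]), L(q, K) is a quotient of it by a central subspace, and [pi0] is a central
    extension.

    For a central extension of L(q, K) by M, the bracket in M of two preimages depends only on what
    they cover; this gives an alternating bilinear cocycle on the model. The core is
    [cocycle_coboundary]: the cocycle is psi [u, u'] for a linear psi. The elements h_p act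
    diagonally, so [om_weight] settles pairs whose weights do not cancel. For opposite roots the
    cocycle identity on three indices ([HH_cycle]) is a functional equation; as fresh indices always
    exist, its solutions have the shape [HHE], and short roots are similar ([gam_act], [gam_eq]).
    The remaining invariants [kappa] and [gamma] satisfy the relations of {b, b}
    ([kappa_gamma_compat]), which defines psi there. [model_ok_ind] reduces everything to root
    elements. Since brackets span ([model_ok_perfect]), psi lifts [pi0], is a homomorphism and is
    unique ([lifting_exists]). *)

Section LinearCombinations.
Variables (F : fieldType) (W : lmodType F).

(** Reflection for module identities: terms are compared through their coefficients on a list of
    atoms, which leaves scalar identities for [ring] or [field]. *)
Inductive lcomb :=
| LVar of nat
| LZero
| LAdd of lcomb & lcomb
| LOpp of lcomb
| LScale of F & lcomb
| LMuln of nat & lcomb.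

Fixpoint leval (env : seq W) (e : lcomb) : W :=
  match e with
  | LVar n => nth 0 env n
  | LZero => 0
  | LAdd e1 e2 => leval env e1 + leval env e2
  | LOpp e1 => - leval env e1
  | LScale k e1 => k *: leval env e1
  | LMuln n e1 => leval env e1 *+ n
  end.

Fixpoint lcoef (i : nat) (e : lcomb) : F :=
  match e with
  | LVar n => if PeanoNat.Nat.eqb n i then 1 else 0
  | LZero => 0
  | LAdd e1 e2 => lcoef i e1 + lcoef i e2
  | LOpp e1 => - lcoef i e1
  | LScale k e1 => k * lcoef i e1
  | LMuln n e1 => lcoef i e1 *+ n
  end.

Fixpoint lvars (n : nat) (e : lcomb) : bool :=
  match e with
  | LVar k => PeanoNat.Nat.ltb k n
  | LZero => true
  | LAdd e1 e2 => lvars n e1 && lvars n e2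
  | LOpp e1 | LScale _ e1 | LMuln _ e1 => lvars n e1
  end.

Lemma leval_sum env e : lvars (size env) e ->
  leval env e = \sum_(i < size env) lcoef i e *: env`_i.
Proof.
elim: e => /= [n /PeanoNat.Nat.ltb_lt/ltP nlt||e1 IH1 e2 IH2 /andP[/IH1-> /IH2->]|
    e IH /IH->|k e IH /IH->|n e IH /IH->].
- rewrite (bigD1 (Ordinal nlt)) //= PeanoNat.Nat.eqb_refl scale1r big1 ?addr0 //.
  move=> i ne; case: PeanoNat.Nat.eqb_spec => [eq_ni|_]; last by rewrite scale0r.
  by case/eqP: ne; apply: val_inj.
- by rewrite big1 // => i _; rewrite scale0r.
- by rewrite -big_split; apply: eq_bigr => i _; rewrite scalerDl.
- by rewrite -sumrN; apply: eq_bigr => i _; rewrite scaleNr.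
- by rewrite scaler_sumr; apply: eq_bigr => i _; rewrite scalerA.
- by rewrite -sumrMnl; apply: eq_bigr => i _; rewrite scalerMnl.
Qed.

(** A nested conjunction rather than a quantifier, so that [split] leaves one scalar goal per
    atom. *)
Fixpoint lcoefs_eq (n : nat) (e1 e2 : lcomb) : Prop :=
  if n is n'.+1 then lcoef n' e1 = lcoef n' e2 /\ lcoefs_eq n' e1 e2 else True.

Lemma lcoefs_eqP env e1 e2 : lvars (size env) e1 && lvars (size env) e2 ->
  lcoefs_eq (size env) e1 e2 -> leval env e1 = leval env e2.
Proof.
move=> /andP[v1 v2] eq12; rewrite !leval_sum //.
suff coefE i : (i < size env)%N -> lcoef i e1 = lcoef i e2.
  by apply: eq_bigr => i _; rewrite coefE.
elim: (size env) eq12 => //= n IHn [eqn eq12].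
by rewrite ltnS leq_eqVlt => /predU1P[->//|]; exact: IHn.
Qed.

End LinearCombinations.

Ltac lindex_syn x env :=
  lazymatch env with
  | ?y :: ?env' =>
    match goal with
    | _ => let _ := match goal with _ => constr_eq x y end in constr:(O)
    | _ => let n := lindex_syn x env' in constr:(S n)
    end
  end.

Ltac lindex_conv x env :=
  lazymatch env with
  | ?y :: ?env' =>
    match goal with
    | _ => let _ := match goal with _ => unify x y end in constr:(O)
    | _ => let n := lindex_conv x env' in constr:(S n)
    end
  end.

(* Canonical structures may be inferred along different paths, so atoms are   *)
(* compared syntactically first and then up to conversion.                    *)
Ltac lindex x env :=
  match goal with
  | _ => lindex_syn x env
  | _ => lindex_conv x env
  end.

Ltac latoms t env :=
  lazymatch t with
  | 0 => env
  | ?x + ?y => let env1 := latoms x env in latoms y env1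
  | - ?x => latoms x env
  | ?k *: ?x => latoms x env
  | ?x *+ ?n => latoms x env
  | _ => match goal with
         | _ => let _ := lindex t env in env
         | _ => constr:(t :: env)
         end
  end.

Ltac lreify F t env :=
  lazymatch t with
  | 0 => constr:(@LZero F)
  | ?x + ?y =>
    let e1 := lreify F x env in let e2 := lreify F y env in
    constr:(@LAdd F e1 e2)
  | - ?x => let e := lreify F x env in constr:(@LOpp F e)
  | ?k *: ?x => let e := lreify F x env in constr:(@LScale F k e)
  | ?x *+ ?n => let e := lreify F x env in constr:(@LMuln F n e)
  | _ => let n := lindex t env in constr:(@LVar F n)
  end.

(* Reifies both sides and compares the coefficients of each atom by tac.      *)
Ltac lmodule_with F tac :=
  lazymatch goal with
  | |- @eq ?W ?x ?y =>
    let env0 := latoms x (@nil W) in let env := latoms y env0 in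
    let e1 := lreify F x env in let e2 := lreify F y env in
    refine (@lcoefs_eqP F _ env e1 e2 _ _);
    [ vm_compute; exact: erefl
    | cbn [lcoefs_eq lcoef size PeanoNat.Nat.eqb]; repeat split; tac ]
  end.
Ltac lmodule F := lmodule_with F ltac:(by [] || ring).
Ltac lmodulef F := lmodule_with F ltac:(by [] || ring || by field).

(** * Linear maps and tensor products *)

Section TensorInduction.
Variable F : fieldType.

Definition closed_lin (W : lmodType F) (P : W -> Prop) : Prop :=
  P 0 /\ forall k u v, P u -> P v -> P (k *: u + v).

Lemma closed_lin_sum (W : lmodType F) (P : W -> Prop) (T : eqType) (s : seq T)
    (c : T -> F) (w : T -> W) : closed_lin P ->
  (forall t, t \in s -> P (w t)) -> P (\sum_(t <- s) c t *: w t).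
Proof.
move=> [P0 PD]; elim: s => [|t s IHs] Pw; first by rewrite big_nil.
rewrite big_cons; apply: PD; first exact/Pw/mem_head.
by apply: IHs => t' ts; apply: Pw; rewrite inE ts orbT.
Qed.

Lemma closed_linD (W : lmodType F) (P : W -> Prop) u v :
  closed_lin P -> P u -> P v -> P (u + v).
Proof. by move=> [_ PD] Pu Pv; rewrite -[u]scale1r; apply: PD. Qed.

Lemma closed_linZ (W : lmodType F) (P : W -> Prop) k u :
  closed_lin P -> P u -> P (k *: u).
Proof. by move=> [P0 PD] Pu; rewrite -[k *: u]addr0; apply: PD. Qed.

Lemma closed_linB (W : lmodType F) (P : W -> Prop) u v :
  closed_lin P -> P u -> P v -> P (u - v).
Proof.
by move=> clP Pu Pv; apply: closed_linD => //; rewrite -scaleN1r; apply: closed_linZ.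
Qed.

Section LinearRules.
Variables (W X : lmodType F) (f : W -> X).
Hypothesis f_lin : linear f.

Lemma linear0P : f 0 = 0.
Proof. by have := f_lin (-1) 0 0; rewrite scaler0 addr0 scaleN1r addNr. Qed.
Lemma linearZP k x : f (k *: x) = k *: f x.
Proof. by rewrite -[k *: x]addr0 f_lin linear0P addr0. Qed.
Lemma linearDP x y : f (x + y) = f x + f y.
Proof. by rewrite -[x in LHS]scale1r f_lin scale1r. Qed.
Lemma linearNP x : f (- x) = - f x.
Proof. by rewrite -scaleN1r linearZP scaleN1r. Qed.

Definition linE := (linear0P, linearDP, linearNP, linearZP).
End LinearRules.

Section BilinearRules.
Variables (W W' X : lmodType F) (m : W -> W' -> X).

Definition bilinear_map : Prop :=
  (forall y, linear (m^~ y)) /\ (forall x, linear (m x)).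

Hypothesis m_bil : bilinear_map.

Let mL y := m_bil.1 y.
Let mR x := m_bil.2 x.

Lemma bil0l y : m 0 y = 0. Proof. exact: (linear0P (mL y)). Qed.
Lemma bil0r x : m x 0 = 0. Proof. exact: (linear0P (mR x)). Qed.
Lemma bilDl x x' y : m (x + x') y = m x y + m x' y.
Proof. exact: (linearDP (mL y)). Qed.
Lemma bilDr x y y' : m x (y + y') = m x y + m x y'.
Proof. exact: (linearDP (mR x)). Qed.
Lemma bilNl x y : m (- x) y = - m x y.
Proof. exact: (linearNP (mL y)). Qed.
Lemma bilNr x y : m x (- y) = - m x y.
Proof. exact: (linearNP (mR x)). Qed.
Lemma bilZl k x y : m (k *: x) y = k *: m x y.
Proof. exact: (linearZP (mL y)). Qed.
Lemma bilZr k x y : m x (k *: y) = k *: m x y.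
Proof. exact: (linearZP (mR x)). Qed.

Definition bilDE := (bilDl, bilDr, bilNl, bilNr).
Definition bilE := (bil0l, bil0r, bilDl, bilDr, bilNl, bilNr, bilZl, bilZr).
End BilinearRules.

Lemma closed_lin_eq (W X : lmodType F) (f g : W -> X) :
  linear f -> linear g -> closed_lin (fun x => f x = g x).
Proof.
move=> f_lin g_lin; split; first by rewrite !linear0P.
by move=> k u v fgu fgv; rewrite f_lin g_lin fgu fgv.
Qed.

Lemma malg_ind (T : choiceType) (P : {malg F[T]} -> Prop) :
  closed_lin P -> (forall t, P << t >>) -> forall g, P g.
Proof.
move=> clP Pt g; rewrite [g]monalgE.
rewrite (eq_bigr (fun k => g@_k *: << k >>)); first exact: closed_lin_sum.
by move=> k _; apply/malgP => j; rewrite mcoeffZ !mcoeffU mulrnAr mulr1.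
Qed.

Lemma tensor_ind (U W : lmodType F) (P : tensor U W -> Prop) :
  closed_lin P -> (forall u w, P (tens u w)) -> forall x, P x.
Proof.
move=> [P0 PD] Pt x; rewrite -[x]qclass_repr; move: (repr x) => g {x}.
pose Q g := P (qclass (lspan (@tensor_relation F U W : set _)) g).
apply: (@malg_ind _ Q) => [|[u w]]; last exact: Pt.
by split=> [|k u v Qu Qv]; rewrite /Q ?linear0 // linearP; apply: PD.
Qed.

(* The tensor product of {malg F[T]} and W, sealed so that conversion never    *)
(* unfolds the quotient constructions behind it.                              *)
Record based_tensor (T : choiceType) (W : lmodType F) := BasedTensor {
  based_sort : lmodType F;
  based_tens : T -> W -> based_sort;
  based_linear : forall t, linear (based_tens t);
  based_ind : forall P : based_sort -> Prop, closed_lin P ->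
    (forall t w, P (based_tens t w)) -> forall x, P x;
  based_lift : forall X : lmodType F, (T -> W -> X) -> based_sort -> X;
  based_lift_linear : forall (X : lmodType F) (h : T -> W -> X),
    (forall t, linear (h t)) -> linear (based_lift h);
  based_liftE : forall (X : lmodType F) (h : T -> W -> X), (forall t, linear (h t)) ->
    forall t w, based_lift h (based_tens t w) = h t w;
  based_to : based_sort -> tensor {malg F[T]} W;
  based_to_linear : linear based_to;
  based_of : tensor {malg F[T]} W -> based_sort;
  based_of_linear : linear based_of;
  based_ofE : forall t w, based_of (tens << t >> w) = based_tens t w;
  based_toK : cancel based_to based_of;
  based_ofK : cancel based_of based_to
}.

Section BasisLift.
Variables (T : choiceType) (W : lmodType F).

Lemma basis_tensor_ind (P : tensor {malg F[T]} W -> Prop) :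
  closed_lin P -> (forall t w, P (tens << t >> w)) -> forall x, P x.
Proof.
move=> [P0 PD] Pt; apply: tensor_ind => // u w.
apply: (@malg_ind _ (fun u => P (tens u w))) => [|t]; last exact: Pt.
split=> [|k u1 u2 Pu1 Pu2]; first by rewrite (linear0P (tens_linearl w)).
have := PD k _ _ Pu1 Pu2; congr P; exact: (esym (tens_linearl w k u1 u2)).
Qed.

Definition tensor_lift (X : lmodType F) (h : T -> W -> X) :
    tensor {malg F[T]} W -> X :=
  tlift (fun (g : {malg F[T]}) w => linext (fun t => h t w) g).

Lemma linext_linearr (X : lmodType F) (h : T -> W -> X) g :
  (forall t, linear (h t)) -> linear (fun w => linext (fun t => h t w) g).
Proof.
move=> h_linear k u v; rewrite /linext scaler_sumr -big_split.
by apply: eq_bigr => t _ /=; rewrite h_linear scalerDr !scalerA mulrC.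
Qed.

Lemma tensor_liftE (X : lmodType F) (h : T -> W -> X) :
  (forall t, linear (h t)) ->
  forall t w, tensor_lift h (tens << t >> w) = h t w.
Proof.
move=> hL t w; rewrite /tensor_lift tlift_tens ?linextU // => {}w.
  exact: linext_linear.
exact: linext_linearr.
Qed.

Lemma tensor_lift_linear (X : lmodType F) (h : T -> W -> X) :
  (forall t, linear (h t)) -> linear (tensor_lift h).
Proof.
move=> hL; apply: tlift_linear => w; first exact: linext_linear.
exact: linext_linearr.
Qed.

(** Ending this with [Qed] performs the sealing: later proofs see the tensor product only through
    the fields of the record. *)
Lemma based_tensor_exists : based_tensor T W.
Proof.
exact: (@BasedTensor T W (tensor {malg F[T]} W)
  (fun t w => tens (<< t >> : {malg F[T]}) w)
  (fun t => tens_linearr _) basis_tensor_ind tensor_lift tensor_lift_linear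
  tensor_liftE id (fun _ _ _ => erefl)
  id (fun _ _ _ => erefl) (fun _ _ => erefl)
  (fun _ => erefl) (fun _ => erefl)).
Qed.

Definition btensor : lmodType F := based_sort based_tensor_exists.
Definition btens : T -> W -> btensor := based_tens _.
Definition btens_linear : forall t, linear (btens t) :=
  @based_linear _ _ _.
Definition btensor_ind := @based_ind T W based_tensor_exists.
Definition blift : forall X : lmodType F, (T -> W -> X) -> btensor -> X :=
  @based_lift T W based_tensor_exists.
Definition blift_linear : forall (X : lmodType F) (h : T -> W -> X),
  (forall t, linear (h t)) -> linear (blift h) :=
  @based_lift_linear _ _ _.
Definition bliftE : forall (X : lmodType F) (h : T -> W -> X), (forall t, linear (h t)) ->
  forall t w, blift h (btens t w) = h t w :=
  @based_liftE _ _ _.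

Definition btensor_to : btensor -> tensor {malg F[T]} W := @based_to _ _ _.
Definition btensor_to_linear : linear btensor_to := @based_to_linear _ _ _.
Definition btensor_of : tensor {malg F[T]} W -> btensor := @based_of _ _ _.
Definition btensor_of_linear : linear btensor_of := @based_of_linear _ _ _.
Definition btensor_ofE : forall t w, btensor_of (tens << t >> w) = btens t w :=
  @based_ofE _ _ _.
Definition btensor_toK : cancel btensor_to btensor_of := @based_toK _ _ _.
Definition btensor_ofK : cancel btensor_of btensor_to := @based_ofK _ _ _.

Lemma btensor_ext (X : lmodType F) (f g : btensor -> X) :
  linear f -> linear g -> (forall t w, f (btens t w) = g (btens t w)) -> f =1 g.
Proof. by move=> fL gL; apply: btensor_ind (closed_lin_eq fL gL). Qed.

(** A linear map is determined on pure tensors, where linearity in the parameter is assumed; this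
    serves the first variable of double lifts. *)
Lemma blift_linear_dep (X Y : lmodType F)
    (h : Y -> T -> W -> X) :
  (forall y t, linear (h y t)) -> (forall t w, linear (fun y => h y t w)) ->
  forall x, linear (fun y => blift (h y) x).
Proof.
move=> h_lin h_liny x k y y'; move: x.
apply: btensor_ext => [||t w].
- exact: blift_linear.
- move=> a u v; rewrite !(blift_linear (h_lin _)) !scalerDr !scalerA.
  by rewrite [a * k]mulrC addrACA.
- by rewrite !bliftE; [exact: h_liny | exact: h_lin..].
Qed.

End BasisLift.

(** The products and pairings of the matrix model all come from this pattern of two nested lifts. *)
Lemma blift2P (T T' : choiceType) (W W' X : lmodType F)
    (h : T -> W -> T' -> W' -> X) :
  (forall t w t', linear (h t w t')) ->
  (forall t t' w', linear (fun w => h t w t' w')) ->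
  bilinear_map (fun x y => blift (fun t w => blift (h t w) y) x) /\
  forall t w t' w', blift (fun t w => blift (h t w) (btens t' w')) (btens t w)
    = h t w t' w'.
Proof.
move=> hL hL'.
have depL t y : linear (fun w => blift (h t w) y).
  by apply: (blift_linear_dep (h := h t)) => // w t'; exact: hL.
split=> [|t w t' w']; last by rewrite !bliftE.
split=> [y|x]; first exact: blift_linear.
by apply: blift_linear_dep => // t w; apply: blift_linear.
Qed.

End TensorInduction.
Arguments btensor {F} T W.
Arguments btens {F T W} t w.

Opaque tens tlift.

(** * The space {b, b} *)

Section QuadrupleTheory.
Variables (F : fieldType) (q : quadrupleBC F).
Local Notation a := (qa q).
Local Notation C := (qC q).
Local Notation star := (qstar q).
Local Notation act := (qact (q := q)).
Local Notation f := (qf (q := q)).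

Lemma act_bil : bilinear_map act.
Proof. by split; [exact: qact_linearl | exact: qact_linearr]. Qed.
Lemma f_bil : bilinear_map f.
Proof. by split; [exact: qf_linearl | exact: qf_linearr]. Qed.

Lemma qf_actr x c c' : f c (act x c') = f c c' * star x.
Proof.
rewrite -[LHS]qstarK qf_star qf_act linearN qstarM qf_star.
by rewrite mulNr opprK.
Qed.

Lemma qstar1 : star 1 = 1.
Proof. by rewrite -[LHS]mul1r -{1}[1 : a]qstarK -qstarM mul1r qstarK. Qed.

Lemma of_a_linear : linear (@of_a F q).
Proof. by move=> k x y; rewrite /of_a; congr pair; rewrite /= scaler0 addr0. Qed.

Lemma of_C_linear : linear (@of_C F q).
Proof. by move=> k x y; rewrite /of_C; congr pair; rewrite /= scaler0 addr0. Qed.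

Local Notation BB0 := (bbracket q : lmodType F).
Local Notation CC := (tensor (Defs.coord q) (Defs.coord q)).

Definition bclass (w : CC) : BB0 := qclass (lspan (@bracket_relation F q : set _)) w.

Lemma bclass_linear : linear bclass.
Proof. exact: qclass_linear. Qed.

HB.instance Definition _ := GRing.isLinear.Build F CC BB0 *:%R bclass bclass_linear.

Lemma bclass_eq0 (w : CC) : bracket_relation w -> bclass w = 0.
Proof.
move=> rel_w; rewrite -(linear0 bclass); apply/qclassP.
by rewrite subr0; apply: mem_lspan.
Qed.

Lemma bclass_repr (z : BB0) : bclass (repr z) = z.
Proof. exact: qclass_repr. Qed.

Definition bp (b1 b2 : Defs.coord q) : BB0 := bclass (tens b1 b2).

Lemma bp_bil : bilinear_map bp.
Proof.
by split=> [y|x] k u v; rewrite /bp (tens_linearl, tens_linearr) linearP.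
Qed.

Definition pa0 (x y : a) : BB0 := bp (of_a x) (of_a y).
Definition pc0 (c c' : C) : BB0 := bp (of_C c) (of_C c').

Lemma pa0_bil : bilinear_map pa0.
Proof.
by split=> [y|x] k u v; rewrite /pa0 of_a_linear !(bilE bp_bil).
Qed.
Lemma pc0_bil : bilinear_map pc0.
Proof.
by split=> [y|x] k u v; rewrite /pc0 of_C_linear !(bilE bp_bil).
Qed.

(** The relations kill the pairs of an element of a with one of C, so only two kinds of generators
    remain. *)
Lemma bpE b1 b2 : bp b1 b2 = pa0 b1.1 b2.1 + pc0 b1.2 b2.2.
Proof.
have {1}-> : b1 = of_a b1.1 + of_C b1.2.
  by case: b1 => x c; rewrite /of_a /of_C; congr pair; rewrite /= ?addr0 ?add0r.
have {1}-> : b2 = of_a b2.1 + of_C b2.2.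
  by case: b2 => x c; rewrite /of_a /of_C; congr pair; rewrite /= ?addr0 ?add0r.
rewrite !(bilE bp_bil).
have -> : bp (of_a b1.1) (of_C b2.2) = 0.
  by apply: bclass_eq0; exact: BracketAC.
have -> : bp (of_C b1.2) (of_a b2.1) = 0.
  by apply: bclass_eq0; exact: BracketCA.
by rewrite addr0 add0r.
Qed.

Lemma pa0_antisym x y : pa0 x y = - pa0 y x.
Proof.
apply/eqP; rewrite -addr_eq0 /pa0 /bp -(linearDP bclass_linear) bclass_eq0 //; exact: BracketAA.
Qed.

Lemma pa0_fixed_skew x y : star x = x -> star y = - y -> pa0 x y = 0.
Proof.
by move=> xF yS; apply: bclass_eq0; apply: BracketFixedSkew; rewrite inE ?xF ?yS.
Qed.

Lemma pa0_cycle x y z : pa0 (x * y) z + pa0 (z * x) y + pa0 (y * z) x = 0.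
Proof. rewrite /pa0 /bp -!(linearDP bclass_linear) bclass_eq0 //; exact: BracketCycle. Qed.

Lemma pc0C c c' : pc0 c c' = pc0 c' c.
Proof.
apply/eqP; rewrite -subr_eq0 /pc0 /bp -(linearNP bclass_linear).
by rewrite -(linearDP bclass_linear) bclass_eq0 //; exact: BracketCC.
Qed.

Lemma pa0_form c c' x :
  pa0 (f c c') x = pc0 (act x c) c' - pc0 (act (star x) c') c.
Proof.
apply/eqP; rewrite -subr_eq0 opprB addrA /pa0 /pc0 /bp.
rewrite -(linearNP bclass_linear) -!(linearDP bclass_linear).
rewrite bclass_eq0 //; exact: BracketForm.
Qed.

Lemma bbracket_ind (P : BB0 -> Prop) : closed_lin P ->
  (forall x y, P (pa0 x y)) -> (forall c c', P (pc0 c c')) -> forall z, P z.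
Proof.
move=> clP Pa Pc z; rewrite -[z]bclass_repr; move: (repr z) => w {z}.
apply: (@tensor_ind _ _ _ (fun w => P (bclass w))) => [|b1 b2].
  case: clP => P0 PD; split=> [|k u v Qu Qv]; rewrite ?linear0 // linearP.
  exact: PD.
by rewrite -[bclass _]/(bp b1 b2) bpE; apply: closed_linD.
Qed.

(** The relations defining {b, b}, imposed on a pair of bilinear maps: the data of a linear map out
    of {b, b}. *)
Record bb_compatible (X : lmodType F) (ma : a -> a -> X) (mc : C -> C -> X) :
    Prop := {
  bbc_a : bilinear_map ma;
  bbc_c : bilinear_map mc;
  bbc_fixed_skew : forall x y, star x = x -> star y = - y -> ma x y = 0;
  bbc_antisym : forall x y, ma x y + ma y x = 0;
  bbc_sym : forall c c', mc c c' - mc c' c = 0;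
  bbc_cycle : forall x y z, ma (x * y) z + ma (z * x) y + ma (y * z) x = 0;
  bbc_form : forall x c c', ma (f c c') x + mc (act (star x) c') c
     - mc (act x c) c' = 0
}.

Section BBLift.
Variables (X : lmodType F) (ma : a -> a -> X) (mc : C -> C -> X).

Definition bblift0 (z : BB0) : X :=
  qlift (tlift (fun b1 b2 : Defs.coord q => ma b1.1 b2.1 + mc b1.2 b2.2)) z.

Hypothesis compat : bb_compatible ma mc.

Let m (b1 b2 : Defs.coord q) := ma b1.1 b2.1 + mc b1.2 b2.2.

Let m_bil : bilinear_map m.
Proof.
split=> [y|x] k u v; rewrite /m !(bilE (bbc_a compat)) !(bilE (bbc_c compat));
by rewrite scalerDr addrACA.
Qed.

Let tm_linear : linear (tlift m).
Proof. by apply: tlift_linear; case: m_bil. Qed.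

Let tlift_m b1 b2 : tlift m (tens b1 b2) = m b1 b2.
Proof. by apply: tlift_tens; case: m_bil. Qed.

Let m_rel w : w \in lspan (@bracket_relation F q : set _) -> tlift m w = 0.
Proof.
move=> /asboolP[s [rel_s ->]].
have clP : closed_lin (fun w => tlift m w = 0).
  by split=> [|k u v u0 v0]; rewrite ?(linE tm_linear) // u0 v0 scaler0 addr0.
apply: (@closed_lin_sum _ _ _ _ s fst snd clP) => p /rel_s rel_p.
have D w1 w2 x1 x2 : tlift m w1 = x1 -> tlift m w2 = x2 ->
    tlift m (w1 + w2) = x1 + x2.
  by move=> <- <-; exact: linearDP.
have N w1 x1 : tlift m w1 = x1 -> tlift m (- w1) = - x1.
  by move=> <-; exact: linearNP.
have M := tlift_m.
have aE x y : m (of_a x) (of_a y) = ma x y.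
  by rewrite /m /= (bil0r (bbc_c compat)) addr0.
have cE c c' : m (of_C c) (of_C c') = mc c c'.
  by rewrite /m /= (bil0r (bbc_a compat)) add0r.
case: rel_p.
- move=> x c; refine (etrans (M _ _) _); rewrite /m /=.
  by rewrite (bil0r (bbc_a compat)) (bil0l (bbc_c compat)) addr0.
- move=> x c; refine (etrans (M _ _) _); rewrite /m /=.
  by rewrite (bil0l (bbc_a compat)) (bil0r (bbc_c compat)) addr0.
- move=> x y xF yS; refine (etrans (M _ _) _); rewrite aE.
  by apply: (bbc_fixed_skew compat); exact/eqP.
- move=> x y; refine (etrans (D _ _ _ _ (M _ _) (M _ _)) _).
  by rewrite !aE (bbc_antisym compat).
- move=> c c'; refine (etrans (D _ _ _ _ (M _ _) (N _ _ (M _ _))) _).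
  by rewrite !cE (bbc_sym compat).
- move=> x y z.
  refine (etrans (D _ _ _ _ (D _ _ _ _ (M _ _) (M _ _)) (M _ _)) _).
  by rewrite !aE (bbc_cycle compat).
- move=> x c c'.
  refine (etrans (D _ _ _ _ (D _ _ _ _ (M _ _) (M _ _)) (N _ _ (M _ _))) _).
  by rewrite aE !cE (bbc_form compat).
Qed.

Let bblift0_class w : bblift0 (bclass w) = tlift m w.
Proof. by rewrite /bblift0 /bclass qliftE. Qed.

Lemma bblift0_linear : linear bblift0.
Proof.
move=> k u v; rewrite -[u]bclass_repr -[v]bclass_repr -linearP !bblift0_class.
exact: tm_linear.
Qed.

Let bblift0E b1 b2 : bblift0 (bp b1 b2) = m b1 b2.
Proof. by rewrite bblift0_class tlift_m. Qed.

Lemma bblift0_pa x y : bblift0 (pa0 x y) = ma x y.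
Proof. by rewrite bblift0E /m /= (bil0l (bbc_c compat)) addr0. Qed.

Lemma bblift0_pc c c' : bblift0 (pc0 c c') = mc c c'.
Proof. by rewrite bblift0E /m /= (bil0l (bbc_a compat)) add0r. Qed.

End BBLift.

(** The space {b, b} given by generators and relations, sealed against unfolding like
    [based_tensor]. *)
Record sealed_bb := SealedBB {
  sbb_sort : lmodType F;
  sbb_a : a -> a -> sbb_sort;
  sbb_c : C -> C -> sbb_sort;
  sbb_a_bil : bilinear_map sbb_a;
  sbb_c_bil : bilinear_map sbb_c;
  sbb_antisym : forall x y, sbb_a x y = - sbb_a y x;
  sbb_fixed_skew : forall x y, star x = x -> star y = - y -> sbb_a x y = 0;
  sbb_cycle : forall x y z,
    sbb_a (x * y) z + sbb_a (z * x) y + sbb_a (y * z) x = 0;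
  sbb_sym : forall c c', sbb_c c c' = sbb_c c' c;
  sbb_form : forall c c' x,
    sbb_a (f c c') x = sbb_c (act x c) c' - sbb_c (act (star x) c') c;
  sbb_ind : forall P : sbb_sort -> Prop, closed_lin P ->
    (forall x y, P (sbb_a x y)) -> (forall c c', P (sbb_c c c')) ->
    forall z, P z;
  sbb_lift : forall X : lmodType F,
    (a -> a -> X) -> (C -> C -> X) -> sbb_sort -> X;
  sbb_lift_linear : forall X ma mc, @bb_compatible X ma mc ->
    linear (sbb_lift ma mc);
  sbb_lift_a : forall X ma mc, @bb_compatible X ma mc ->
    forall x y, sbb_lift ma mc (sbb_a x y) = ma x y;
  sbb_lift_c : forall X ma mc, @bb_compatible X ma mc ->
    forall c c', sbb_lift ma mc (sbb_c c c') = mc c c';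
  sbb_to : sbb_sort -> bbracket q;
  sbb_to_linear : linear sbb_to;
  sbb_of : bbracket q -> sbb_sort;
  sbb_of_linear : linear sbb_of;
  sbb_ofK : cancel sbb_of sbb_to;
  sbb_toK : cancel sbb_to sbb_of;
  sbb_of_bpair : forall b1 b2,
    sbb_of (bpair b1 b2) = sbb_a b1.1 b2.1 + sbb_c b1.2 b2.2
}.

Lemma sealed_bb_exists : sealed_bb.
Proof.
exact: (@SealedBB (bbracket q) pa0 pc0 pa0_bil pc0_bil pa0_antisym
  pa0_fixed_skew pa0_cycle pc0C pa0_form bbracket_ind bblift0 bblift0_linear
  bblift0_pa bblift0_pc id (fun _ _ _ => erefl) id (fun _ _ _ => erefl)
  (fun _ => erefl) (fun _ => erefl) bpE).
Qed.

Definition BB : lmodType F := sbb_sort sealed_bb_exists.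
Definition pa : a -> a -> BB := @sbb_a _.
Definition pc : C -> C -> BB := @sbb_c _.
Definition pa_bil : bilinear_map pa := @sbb_a_bil _.
Definition pc_bil : bilinear_map pc := @sbb_c_bil _.
Definition pa_antisym : forall x y, pa x y = - pa y x := @sbb_antisym _.
Definition pa_fixed_skew :
  forall x y, star x = x -> star y = - y -> pa x y = 0 := @sbb_fixed_skew _.
Definition pa_cycle : forall x y z,
  pa (x * y) z + pa (z * x) y + pa (y * z) x = 0 := @sbb_cycle _.
Definition pcC : forall c c', pc c c' = pc c' c := @sbb_sym _.
Definition pa_form : forall c c' x,
  pa (f c c') x = pc (act x c) c' - pc (act (star x) c') c := @sbb_form _.
Definition BB_ind := @sbb_ind sealed_bb_exists.
Definition bblift : forall X : lmodType F,
  (a -> a -> X) -> (C -> C -> X) -> BB -> X := @sbb_lift sealed_bb_exists.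
Definition bblift_linear : forall X ma mc, @bb_compatible X ma mc ->
  linear (bblift ma mc) := @sbb_lift_linear _.
Definition bblift_a : forall X ma mc, @bb_compatible X ma mc ->
  forall x y, bblift ma mc (pa x y) = ma x y := @sbb_lift_a _.
Definition bblift_c : forall X ma mc, @bb_compatible X ma mc ->
  forall c c', bblift ma mc (pc c c') = mc c c' := @sbb_lift_c _.
Definition bb_to : BB -> bbracket q := @sbb_to sealed_bb_exists.
Definition bb_of : bbracket q -> BB := @sbb_of sealed_bb_exists.
Definition bb_to_linear : linear bb_to := @sbb_to_linear _.
Definition bb_of_linear : linear bb_of := @sbb_of_linear _.
Definition bb_ofK : cancel bb_of bb_to := @sbb_ofK _.
Definition bb_toK : cancel bb_to bb_of := @sbb_toK _.
Definition bb_of_bpair : forall b1 b2,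
  bb_of (bpair b1 b2) = pa b1.1 b2.1 + pc b1.2 b2.2 := @sbb_of_bpair _.

End QuadrupleTheory.

(** * The trace beta^*, the derivations and a bracket on {b, b} *)

Section BracketSpace.
Variables (F : fieldType) (q : quadrupleBC F).
Hypothesis nz2 : (2 : F) != 0.
Local Notation a := (qa q).
Local Notation C := (qC q).
Local Notation star := (qstar q).
Local Notation act := (qact (q := q)).
Local Notation f := (qf (q := q)).
Local Notation B := (BB q).

Lemma qstar_lin : linear star. Proof. by move=> k u v; rewrite linearP. Qed.

Lemma scale_mull k (x y : a) : (k *: x) * y = k *: (x * y).
Proof. by rewrite scalerAl. Qed.
Lemma scale_mulr k (x y : a) : x * (k *: y) = k *: (x * y).
Proof. by rewrite scalerAr. Qed.
(* Restated over a so that all products carry the same ring structure.        *)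
Lemma amulDl (x y z : a) : (x + y) * z = x * z + y * z.
Proof. exact: mulrDl. Qed.
Lemma amulDr (x y z : a) : x * (y + z) = x * y + x * z.
Proof. exact: mulrDr. Qed.
Lemma amulNl (x y : a) : - x * y = - (x * y).
Proof. exact: mulNr. Qed.
Lemma amulNr (x y : a) : x * - y = - (x * y).
Proof. exact: mulrN. Qed.
Lemma amulA (x y z : a) : x * (y * z) = x * y * z.
Proof. exact: mulrA. Qed.
Definition algE := (amulDl, amulDr, amulNl, amulNr, scale_mull, scale_mulr).

Lemma skew_part_lin : linear (@skew_part F q).
Proof.
by move=> k u v; rewrite /skew_part !(linE qstar_lin); lmodule F.
Qed.

Lemma fixed_part_lin : linear (@fixed_part F q).
Proof.
by move=> k u v; rewrite /fixed_part !(linE qstar_lin); lmodule F.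
Qed.

Lemma fixed_skewE (x : a) : x = fixed_part x + skew_part x.
Proof. by rewrite /fixed_part /skew_part; lmodulef F. Qed.

Lemma star_fixed (x : a) : star (fixed_part x) = fixed_part x.
Proof. by rewrite /fixed_part !(linE qstar_lin) qstarK addrC. Qed.

Lemma star_skew (x : a) : star (skew_part x) = - skew_part x.
Proof. by rewrite /skew_part !(linE qstar_lin) qstarK; lmodule F. Qed.

Lemma skew_part_fixed (x : a) : star x = x -> skew_part x = 0.
Proof. by rewrite /skew_part => ->; rewrite subrr scaler0. Qed.

Lemma skew_part_skew (x : a) : star x = - x -> skew_part x = x.
Proof. by rewrite /skew_part => ->; lmodulef F. Qed.

Lemma fixed_part_skew (x : a) : star x = - x -> fixed_part x = 0.
Proof. by rewrite /fixed_part => ->; rewrite subrr scaler0. Qed.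

Lemma fixed_part_fixed (x : a) : star x = x -> fixed_part x = x.
Proof. by rewrite /fixed_part => ->; lmodulef F. Qed.

Lemma heart_bil : bilinear_map (@heart F q).
Proof.
by split=> [y|x] k u v; rewrite /heart !(bilE (f_bil q)); lmodule F.
Qed.

Lemma star_heart c c' : star (heart c c' : a) = - heart c c'.
Proof.
by rewrite /heart !(linE qstar_lin) !qf_star; lmodule F.
Qed.

Lemma star_diamond c c' : star (diamond c c' : a) = diamond c c'.
Proof.
by rewrite /diamond !(linE qstar_lin) !qf_star; lmodule F.
Qed.

(** Split both arguments into fixed and skew parts: the mixed pairs vanish and the two signs of the
    skew pair cancel. *)
Lemma pa_star (x y : a) : pa (star x) (star y) = pa x y.
Proof.
have Z (u v : a) : pa (fixed_part u) (skew_part v) = 0.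
  by apply: pa_fixed_skew; [exact: star_fixed | exact: star_skew].
have E (u : a) : star u = fixed_part u - skew_part u.
  by rewrite {1}[u]fixed_skewE (linearDP qstar_lin) star_fixed star_skew.
rewrite [star x]E [star y]E {3}[x]fixed_skewE {3}[y]fixed_skewE.
rewrite !(bilDE (pa_bil q)) !Z !(@pa_antisym _ _ (skew_part _) (fixed_part _)) !Z.
lmodule F.
Qed.

Lemma bst_compat : bb_compatible (fun x y : a => skew_part (x * y - y * x))
  (fun c c' : C => - heart c c').
Proof.
split.
- split=> [y|x] k u v; rewrite -skew_part_lin; congr skew_part;
  rewrite !algE; lmodule F.
- by split=> [y|x] k u v; rewrite !(bilE heart_bil); lmodule F.
- move=> x y xF yS; apply: skew_part_fixed.
  by rewrite !(linE qstar_lin) !qstarM xF yS !algE; lmodule F.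
- by move=> x y; rewrite -(linearDP skew_part_lin) addrA addrNK subrr (linear0P skew_part_lin).
- by move=> c c'; rewrite /heart; lmodule F.
- move=> x y z; rewrite -!(linearDP skew_part_lin) !amulA.
  rewrite -[RHS](linear0P skew_part_lin); congr skew_part; lmodule F.
- move=> x c c'; rewrite /heart /skew_part !(linE qstar_lin) !qstarM.
  by rewrite !qf_act !qf_actr !qstarK !qf_star !algE; lmodule F.
Qed.

(** The commutator of a fixed and a skew element is fixed, so the skew part of xy - yx is the sum of
    the commutators of the fixed parts and of the skew parts: this is beta^* as a linear map on {b,
    b}, see [bst_bstar]. *)
Definition bst : B -> a :=
  bblift (fun x y => skew_part (x * y - y * x)) (fun c c' => - heart c c').

Lemma bst_lin : linear bst. Proof. exact: bblift_linear bst_compat. Qed.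
Lemma bst_a x y : bst (pa x y) = skew_part (x * y - y * x).
Proof. exact: bblift_a bst_compat x y. Qed.
Lemma bst_c c c' : bst (pc c c') = - heart c c'.
Proof. exact: bblift_c bst_compat c c'. Qed.

Lemma star_bst z : star (bst z) = - bst z.
Proof.
move: z; apply: BB_ind => [|x y|c c'].
- apply: closed_lin_eq => k u v; rewrite bst_lin ?(linE qstar_lin) //; lmodule F.
- by rewrite bst_a star_skew.
- by rewrite bst_c (linearNP qstar_lin) star_heart.
Qed.

Lemma bst_bstar b1 b2 : bst (bb_of (bpair b1 b2)) = bstar b1 b2.
Proof.
rewrite bb_of_bpair (linearDP bst_lin) bst_a bst_c /bstar; congr (_ - _).
rewrite /acomm /skew_part /fixed_part !(linE qstar_lin) !qstarM !algE.
by lmodulef F.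
Qed.

Definition d0_c c (c1 c2 : C) : C :=
  - (2^-1 *: (act (f c c2) c1 + act (f c c1) c2)).

Lemma d0_compat c : bb_compatible (fun _ _ : a => 0) (d0_c c).
Proof.
split; rewrite ?/d0_c.
- by split=> [y|x] k u v; rewrite scaler0 addr0.
- by split=> [y|x] k u v; rewrite !(bilE (f_bil q)) !(bilE (act_bil q)); lmodule F.
- by [].
- by move=> *; rewrite addr0.
- by move=> c1 c2; lmodule F.
- by move=> *; rewrite !addr0.
- move=> x c1 c2; rewrite !qf_actr !qactM qstarK; lmodule F.
Qed.

(** The part of the derivation d_z on C that remains after removing left multiplication by beta^*
    over 2l; see [derE]. *)
Definition d0 (z : B) (c : C) : C := bblift (fun _ _ => 0) (d0_c c) z.

Lemma d0_a x y c : d0 (pa x y) c = 0.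
Proof. exact: bblift_a (d0_compat c) x y. Qed.
Lemma d0_pc c1 c2 c : d0 (pc c1 c2) c = d0_c c c1 c2.
Proof. exact: bblift_c (d0_compat c) c1 c2. Qed.

Lemma d0_bil : bilinear_map d0.
Proof.
split=> [c|z] k; first exact: bblift_linear (d0_compat c) k.
move=> u v; move: z; apply: BB_ind => [|x y|c c'].
- apply: closed_lin_eq => [|k' z z']; first exact: bblift_linear (d0_compat _).
  by rewrite /d0 !(bblift_linear (d0_compat _)); lmodule F.
- by rewrite !d0_a scaler0 addr0.
- by rewrite !d0_pc /d0_c !(bilE (f_bil q)) !(bilE (act_bil q)); lmodule F.
Qed.

Lemma d0_act z x c : d0 z (act x c) = act x (d0 z c).
Proof.
move: z; apply: BB_ind => [|x1 y|c1 c2].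
- apply: closed_lin_eq => k u v; rewrite !(bilE d0_bil) //.
  by rewrite !(bilE (act_bil q)).
- by rewrite !d0_a (bilE (act_bil q)).
- by rewrite !d0_pc /d0_c !qf_act !qactM !(bilE (act_bil q)).
Qed.

(** [d0 z] is an infinitesimal isometry of [f]: the four terms match in pairs after [qf_star]. *)
Lemma f_d0 z c c' : f (d0 z c) c' = - f c (d0 z c').
Proof.
move: z; apply: BB_ind => [|x1 y|c1 c2].
- apply: closed_lin_eq => k u v; rewrite !(bilE d0_bil) !(bilE (f_bil q)) //.
  by lmodule F.
- by rewrite !d0_a !(bilE (f_bil q)) oppr0.
- rewrite !d0_pc /d0_c !(bilE (f_bil q)) !qf_act !qf_actr !qf_star !algE.
  by lmodule F.
Qed.

Definition B0_c z (c c' : C) : B := pc (d0 z c) c' + pc c (d0 z c').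

Lemma B0_compat z : bb_compatible (fun _ _ : a => 0) (B0_c z).
Proof.
split; rewrite ?/B0_c.
- by split=> [y|x] k u v; rewrite scaler0 addr0.
- by split=> [y|x] k u v; rewrite !(bilE d0_bil) !(bilE (pc_bil q)); lmodule F.
- by [].
- by move=> *; rewrite addr0.
- by move=> c1 c2; rewrite [pc (d0 z c2) c1]pcC [pc c2 _]pcC; lmodule F.
- by move=> *; rewrite !addr0.
(* The two instances of [pa_form] have opposite left sides by [f_d0], so their right sides add up to
   zero. *)
- move=> x c1 c2; have := pa_form (d0 z c1) c2 x; have := pa_form c1 (d0 z c2) x.
  rewrite f_d0 !d0_act (bilE (pa_bil q)) => -> E.
  rewrite [pc (act (star x) c2) (d0 z c1)](_ : _ =
    pc (act x (d0 z c1)) c2 + (pc (act x c1) (d0 z c2)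
    - pc (act (star x) (d0 z c2)) c1)); first by lmodule F.
  apply/eqP; rewrite -subr_eq0; apply/eqP; rewrite -[RHS](subrr (pc (act x (d0 z c1)) c2
     - pc (act (star x) c2) (d0 z c1))) -{1}E; lmodule F.
Qed.

(** The bracket of the model on {b, b}. It differs from the bracket of {b, b} itself by the first
    term of [bsum_der], which the model obtains from multiples of I_0. *)
Definition B0 (z z' : B) : B := bblift (fun _ _ => 0) (B0_c z) z'.

Lemma B0_a z x y : B0 z (pa x y) = 0.
Proof. exact: bblift_a (B0_compat z) x y. Qed.
Lemma B0_pc z c c' : B0 z (pc c c') = B0_c z c c'.
Proof. exact: bblift_c (B0_compat z) c c'. Qed.

Lemma B0_bil : bilinear_map B0.
Proof.
split=> [z'|z] k; last exact: bblift_linear (B0_compat z) k.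
move=> u v; move: z'; apply: BB_ind => [|x y|c c'].
- apply: closed_lin_eq => [|k' z z']; first exact: bblift_linear (B0_compat _).
  by rewrite /B0 !(bblift_linear (B0_compat _)); lmodule F.
- by rewrite !B0_a scaler0 addr0.
- by rewrite !B0_pc /B0_c !(bilE d0_bil) !(bilE (pc_bil q)); lmodule F.
Qed.

Lemma B0_antisym z z' : B0 z z' = - B0 z' z.
Proof.
move: z'; apply: BB_ind => [|x y|c3 c4].
- by apply: closed_lin_eq => k u v; rewrite !(bilE B0_bil) //; lmodule F.
- rewrite B0_a; move: z; apply: BB_ind => [|x1 y1|c c'].
  + by apply: closed_lin_eq => k u v; rewrite ?(bilE B0_bil); lmodule F.
  + by rewrite B0_a oppr0.
  + by rewrite B0_pc /B0_c !d0_a !(bilE (pc_bil q)) addr0 oppr0.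
- move: z; apply: BB_ind => [|x1 y1|c1 c2].
  + by apply: closed_lin_eq => k u v; rewrite !(bilE B0_bil) //; lmodule F.
  + by rewrite B0_pc /B0_c !d0_a !(bilE (pc_bil q)) B0_a addr0 oppr0.
  + rewrite !B0_pc /B0_c !d0_pc /d0_c !(bilE (pc_bil q)).
    (* The relation of {b, b} moves a coefficient from one argument of [pc] to the other at the cost
       of a [pa] term; the extra terms are matched by [pa_star] and antisymmetry. *)
    have E x c c' : pc (act x c) c' = pa (f c c') x + pc (act (star x) c') c.
      by rewrite pa_form addrNK.
    rewrite !(E (f c3 _) _ c4) !(@pcC _ _ c3 (act _ _)) !(E (f c4 _) _ c3).
    rewrite !(@pcC _ _ c1 (act _ _)) !qf_star !(bilE (act_bil q)) !(bilE (pc_bil q)).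
    rewrite -(pa_star (f c2 c4)) -(pa_star (f c2 c3)) !qf_star.
    rewrite !(bilE (pa_bil q)).
    rewrite (@pa_antisym _ _ (f c4 c2)) (@pa_antisym _ _ (f c3 c2)).
    lmodulef F.
Qed.

(** [d0 z] commutes with a and is skew for [f], so applying it to [d0_c] obeys a Leibniz rule. *)
Lemma d0_B0 z z' c : d0 (B0 z z') c = d0 z (d0 z' c) - d0 z' (d0 z c).
Proof.
move: z'; apply: BB_ind => [|x y|c1 c2].
- by apply: closed_lin_eq => k u v; rewrite !(bilE B0_bil, bilE d0_bil) //; lmodule F.
- by rewrite B0_a !d0_a !(bilE d0_bil) subrr.
- rewrite B0_pc /B0_c (bilDl d0_bil) !d0_pc /d0_c !(bilE d0_bil).
  rewrite !d0_act !f_d0.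
  by rewrite !(bilE (act_bil q)); lmodule F.
Qed.

Lemma B0_jacobi z1 z2 z3 :
  B0 z1 (B0 z2 z3) + B0 z2 (B0 z3 z1) + B0 z3 (B0 z1 z2) = 0.
Proof.
rewrite (B0_antisym z3 z1) (B0_antisym z3) (bilNr B0_bil).
move: z3; apply: BB_ind => [|x y|c1 c2].
- by apply: closed_lin_eq => k u v; rewrite ?(bilE B0_bil); lmodule F.
- by rewrite !B0_a !(bilE B0_bil); lmodule F.
- rewrite !B0_pc /B0_c !(bilDr B0_bil) !B0_pc /B0_c !d0_B0.
  by rewrite !(bilE (pc_bil q)); lmodule F.
Qed.

(** The two terms of [B0_c] have opposite hearts because [d0 z] is skew for [f]. Thus [B0]
    contributes nothing to the trace condition of the model. *)
Lemma bst_B0 z z' : bst (B0 z z') = 0.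
Proof.
move: z'; apply: BB_ind => [|x y|c1 c2].
- by apply: closed_lin_eq => k u v; rewrite ?(bilE B0_bil) ?(linE bst_lin); lmodule F.
- by rewrite B0_a (linE bst_lin).
- rewrite B0_pc /B0_c (linearDP bst_lin) !bst_c /heart !f_d0 scalerDr.
  lmodule F.
Qed.

End BracketSpace.

(** * Matrices over a and their Lie algebra *)

Section SignedIndices.
Variables (F : fieldType) (I : choiceType).
Local Notation J := (I + I)%type.

Definition bar (j : J) : J := match j with inl i => inr i | inr i => inl i end.
(** The signs of the form of V, whose value at v_j, v_{bar j} is 2 [sg j]. *)
Definition sg (j : J) : F := match j with inl _ => 1 | inr _ => -1 end.
Definition kron (j k : J) : F := (j == k)%:R.
Local Notation dl := kron.

Lemma barK : involutive bar. Proof. by case. Qed.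
Lemma sg_bar j : sg (bar j) = - sg j. Proof. by case: j => i /=; rewrite ?opprK. Qed.
Lemma sg2 j : sg j * sg j = 1. Proof. by case: j => i /=; ring. Qed.
Lemma eq_bar j k : (bar j == k) = (j == bar k).
Proof. by rewrite -{1}[k]barK (inj_eq (inv_inj barK)). Qed.
Lemma neq_bar j : (j == bar j) = false. Proof. by case: j. Qed.
Lemma dlC j k : dl j k = dl k j. Proof. by rewrite /dl eq_sym. Qed.
Lemma dl_barl j k : dl (bar j) k = dl j (bar k).
Proof. by rewrite /dl eq_bar. Qed.
Lemma dl_barC j k : dl j (bar k) = dl k (bar j).
Proof. by rewrite dlC dl_barl. Qed.
Lemma dl_self j : dl j j = 1. Proof. by rewrite /dl eqxx. Qed.
Lemma dl_bar j : dl j (bar j) = 0. Proof. by rewrite /dl neq_bar. Qed.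

End SignedIndices.
Arguments sg {F I} j.
Arguments kron {F I} j k.
Local Notation dl := kron.

(** * Operations on matrices over a, on V (x) C and on {b, b} *)

Section MatrixModel.
Variables (F : fieldType) (I : choiceType) (q : quadrupleBC F).
Local Notation J := (I + I)%type.
Local Notation a := (qa q).
Local Notation C := (qC q).
Local Notation star := (qstar q).
Local Notation act := (qact (q := q)).
Local Notation f := (qf (q := q)).
Local Notation B := (BB q).

(* MA = gl(J) (x) a and VC = V (x) C, with e_{j,k} (x) x and v_j (x) c written *)
(* mxe j k x and vce j c.                                                     *)
Definition MA : lmodType F := btensor (J * J)%type (a : lmodType F).
Definition VC : lmodType F := btensor J C.
Definition mxe (j k : J) (x : a) : MA := @btens F (J * J)%type (a : lmodType F) (j, k) x.
Definition vce (j : J) (c : C) : VC := btens j c.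

Local Notation e := mxe.
Local Notation v := vce.

Lemma mxe_lin j k : linear (e j k). Proof. exact: btens_linear. Qed.
Lemma vce_lin j : linear (v j). Proof. exact: btens_linear. Qed.

Lemma MA_ind (P : MA -> Prop) : closed_lin P ->
  (forall j k x, P (e j k x)) -> forall X, P X.
Proof. by move=> clP Pe; apply: btensor_ind => // -[j k] x; exact: Pe. Qed.

Lemma VC_ind (P : VC -> Prop) : closed_lin P ->
  (forall j c, P (v j c)) -> forall w, P w.
Proof. exact: btensor_ind. Qed.

Definition mxm (X Y : MA) : MA := blift (fun p x => blift (fun r y =>
  dl p.2 r.1 *: e p.1 r.2 (x * y)) Y) X.

Let mulP := @blift2P F (J * J)%type (J * J)%type a a MA
  (fun p x r y => dl p.2 r.1 *: e p.1 r.2 (x * y)).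

Lemma mxm_bil : bilinear_map mxm.
Proof.
by apply: (mulP _ _).1 => *; move=> k u w; rewrite !algE mxe_lin; lmodule F.
Qed.

Lemma mxmE j k x m n y : mxm (e j k x) (e m n y) = dl k m *: e j n (x * y).
Proof.
by apply: (mulP _ _).2 (j, k) x (m, n) y => *; move=> l u w;
  rewrite !algE mxe_lin; lmodule F.
Qed.

(** The {b, b}-valued trace form, the sum over j, k of {X_jk, Y_kj}. *)
Definition tpair (X Y : MA) : B := blift (fun p x => blift (fun r y =>
  (dl p.2 r.1 * dl r.2 p.1) *: pa x y) Y) X.

Let tpairP := @blift2P F (J * J)%type (J * J)%type a a B
  (fun p x r y => (dl p.2 r.1 * dl r.2 p.1) *: pa x y).

Lemma tpair_bil : bilinear_map tpair.
Proof.
by apply: (tpairP _ _).1 => *; move=> k u w; rewrite !(bilE (pa_bil q)); lmodule F.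
Qed.

Lemma tpairE j k x m n y :
  tpair (e j k x) (e m n y) = (dl k m * dl n j) *: pa x y.
Proof.
by apply: (tpairP _ _).2 (j, k) x (m, n) y => *; move=> l u w;
  rewrite !(bilE (pa_bil q)); lmodule F.
Qed.

Definition mact (X : MA) (w : VC) : VC := blift (fun p x => blift (fun m c =>
  dl p.2 m *: v p.1 (act x c)) w) X.

Let mactP := @blift2P F (J * J)%type J a C VC
  (fun p x m c => dl p.2 m *: v p.1 (act x c)).

Lemma mact_bil : bilinear_map mact.
Proof.
by apply: (mactP _ _).1 => *; move=> k u w;
  rewrite !(bilE (act_bil q)) !(linE (vce_lin _)); lmodule F.
Qed.

Lemma mactE j k x m c : mact (e j k x) (v m c) = dl k m *: v j (act x c).
Proof.
by apply: (mactP _ _).2 (j, k) x m c => *; move=> l u w;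
  rewrite !(bilE (act_bil q)) !(linE (vce_lin _)); lmodule F.
Qed.

(** Here [sg m] times e_{j, bar m} is half of the rank one operator (v_m, -) v_j, so this is the
    tau-skew matrix attached to [f] and the form of V; [cross_vt0] gives it without a basis. *)
Definition cross (w w' : VC) : MA := blift (fun j c => blift (fun m c' =>
  sg m *: e j (bar m) (f c c') - sg j *: e m (bar j) (f c' c)) w') w.

Let crossP := @blift2P F J J C C MA
  (fun j c m c' => sg m *: e j (bar m) (f c c') - sg j *: e m (bar j) (f c' c)).

Lemma cross_bil : bilinear_map cross.
Proof.
by apply: (crossP _ _).1 => *; move=> k u w;
  rewrite !(bilE (f_bil q)) !(linE (mxe_lin _ _)); lmodule F.
Qed.

Lemma crossE j c m c' : cross (v j c) (v m c') =
  sg m *: e j (bar m) (f c c') - sg j *: e m (bar j) (f c' c).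
Proof.
by apply: (crossP _ _).2 j c m c' => *; move=> k u w;
  rewrite !(bilE (f_bil q)) !(linE (mxe_lin _ _)); lmodule F.
Qed.

Definition wpair (w w' : VC) : B := blift (fun j c => blift (fun m c' =>
  (2 * sg j * dl m (bar j)) *: pc c c') w') w.

Let wpairP := @blift2P F J J C C B
  (fun j c m c' => (2 * sg j * dl m (bar j)) *: pc c c').

Lemma wpair_bil : bilinear_map wpair.
Proof.
by apply: (wpairP _ _).1 => *; move=> k u w; rewrite !(bilE (pc_bil q)); lmodule F.
Qed.

Lemma wpairE j c m c' :
  wpair (v j c) (v m c') = (2 * sg j * dl m (bar j)) *: pc c c'.
Proof.
by apply: (wpairP _ _).2 j c m c' => *; move=> k u w;
  rewrite !(bilE (pc_bil q)); lmodule F.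
Qed.

Definition zact (z : B) (w : VC) : VC := blift (fun j c => v j (d0 z c)) w.

Lemma zact_lin2 z j : linear (fun c => v j (d0 z c)).
Proof. by move=> k u w; rewrite !(bilE (d0_bil q)) !(linE (vce_lin _)). Qed.

Lemma zact_bil : bilinear_map zact.
Proof.
split=> [w|z]; last exact: blift_linear (zact_lin2 z).
apply: blift_linear_dep => [z j|j c]; first exact: zact_lin2.
by move=> k u u'; rewrite !(bilE (d0_bil q)) !(linE (vce_lin _)).
Qed.

Lemma zactE z j c : zact z (v j c) = v j (d0 z c).
Proof. exact: bliftE (zact_lin2 z) j c. Qed.

(* The involution of gl(J) (x) a: the adjoint for the form of V, times star.  *)
Definition tau (X : MA) : MA :=
  blift (fun p x => (sg p.1 * sg p.2) *: e (bar p.2) (bar p.1) (star x)) X.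

Let tau_lin' (p : J * J) : linear (fun x : a =>
  (sg p.1 * sg p.2) *: e (bar p.2) (bar p.1) (star x)).
Proof. by move=> k u w; rewrite !(linE (@qstar_lin F q)) mxe_lin; lmodule F. Qed.

Lemma tau_lin : linear tau. Proof. exact: blift_linear tau_lin'. Qed.
Lemma tauE j k x : tau (e j k x) = (sg j * sg k) *: e (bar k) (bar j) (star x).
Proof. exact: bliftE tau_lin' (j, k) x. Qed.

Definition mtr (X : MA) : a := blift (fun p (x : a) => dl p.1 p.2 *: x) X.

Let mtr_lin' (p : J * J) : linear (fun x : a => dl p.1 p.2 *: x).
Proof. by move=> k u w; lmodule F. Qed.

Lemma mtr_lin : linear mtr. Proof. exact: blift_linear mtr_lin'. Qed.
Lemma mtrE j k x : mtr (e j k x) = dl j k *: x.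
Proof. exact: bliftE mtr_lin' (j, k) x. Qed.

End MatrixModel.

Section ModelRules.
Variables (F : fieldType) (I : choiceType) (q : quadrupleBC F).

Definition opE := (bilE (@mxm_bil F I q), bilE (@tpair_bil F I q),
  bilE (@mact_bil F I q), bilE (@cross_bil F I q), bilE (@wpair_bil F I q),
  bilE (@zact_bil F I q), linE (@tau_lin F I q), linE (@mtr_lin F I q),
  (bilE (B0_bil q), bilE (d0_bil q), linE (@bst_lin F q),
   linE (@qstar_lin F q), linE (@skew_part_lin F q))).

End ModelRules.

Ltac by_lin := apply: closed_lin_eq => ? ? ?; rewrite ?opE ?algE;
  match goal with F : GRing.Field.type |- _ => lmodule F end.
Ltac onMA X := move: X; apply: MA_ind; [by_lin |].
Ltac onVC w := move: w; apply: VC_ind; [by_lin |].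

(** * Identities behind the Jacobi identity of the model *)

Section ModelIdentities.
Variables (F : fieldType) (I : choiceType) (q : quadrupleBC F).
Hypothesis nz2 : (2 : F) != 0.
Local Notation J := (I + I)%type.
Local Notation star := (qstar q).
Local Notation act := (qact (q := q)).
Local Notation f := (qf (q := q)).
Local Notation MA := (MA I q).
Local Notation VC := (VC I q).

Lemma mxmA (X Y Z : MA) : mxm X (mxm Y Z) = mxm (mxm X Y) Z :> MA.
Proof.
onMA X => j k x; onMA Y => m n y; onMA Z => p r z.
by rewrite !(mxmE, opE) amulA; lmodule F.
Qed.

Lemma tpair_antisym (X Y : MA) : tpair X Y = - tpair Y X.
Proof.
onMA X => j k x; onMA Y => m n y.
by rewrite !tpairE pa_antisym; lmodule F.
Qed.

(** Up to a common product of three Kronecker symbols this is [pa_cycle]. *)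
Lemma tpair_cycle (X Y Z : MA) :
  tpair (mxm X Y) Z + tpair (mxm Z X) Y + tpair (mxm Y Z) X = 0.
Proof.
onMA X => j k x; onMA Y => m n y; onMA Z => p r z.
rewrite !(mxmE, opE) !tpairE.
rewrite -(scaler0 _ (dl k m * dl n p * dl r j)) -(pa_cycle x y z).
by lmodule F.
Qed.

Lemma mactM (X Y : MA) (w : VC) : mact (mxm X Y) w = mact X (mact Y w).
Proof.
onMA X => j k x; onMA Y => m n y; onVC w => p c.
by rewrite !(mxmE, mactE, opE) qactM; lmodule F.
Qed.

Lemma cross_antisym (w w' : VC) : cross w w' = - cross w' w.
Proof.
onVC w => j c; onVC w' => m c'.
by rewrite !crossE; lmodule F.
Qed.

Lemma sg_dl_bar (j m : J) : sg j * dl m (bar j) = - (sg m * dl j (bar m)) :> F.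
Proof.
rewrite dl_barC /dl; case: (eqVneq j) => [->|_]; last by rewrite !mulr0 oppr0.
by rewrite sg_bar !mulr1.
Qed.

Lemma sg_dl_eq (j m : J) : sg j * dl j m = sg m * dl j m :> F.
Proof. by rewrite /dl; case: (eqVneq j) => [->|_]; rewrite ?mulr0. Qed.

Lemma sg_dl_bar_eq (j m : J) : sg j * dl j (bar m) = - (sg m * dl j (bar m)) :> F.
Proof.
rewrite /dl; case: (eqVneq j) => [->|_]; last by rewrite !mulr0 oppr0.
by rewrite sg_bar !mulr1.
Qed.

Lemma wpair_antisym (w w' : VC) : wpair w w' = - wpair w' w.
Proof.
onVC w => j c; onVC w' => m c'.
by rewrite !wpairE pcC -!mulrA sg_dl_bar; lmodule F.
Qed.

Lemma tau_cross (w w' : VC) : tau (cross w w') = - cross w w'.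
Proof.
onVC w => j c; onVC w' => m c'.
rewrite !crossE !opE !tauE !barK !sg_bar !qf_star !(linE (mxe_lin _ _)).
by lmodule_with F ltac:(ring: (sg2 F j) (sg2 F m)).
Qed.

Lemma tauK (X : MA) : tau (tau X) = X.
Proof.
onMA X => j k x; rewrite tauE !opE tauE !barK !sg_bar qstarK.
by lmodule_with F ltac:(by [] || ring: (sg2 F j) (sg2 F k)).
Qed.

Lemma tau_mxm (X Y : MA) : tau (mxm X Y) = mxm (tau Y) (tau X).
Proof.
onMA X => j k x; onMA Y => m n y.
rewrite !(mxmE, tauE, opE) qstarM dl_barl barK dlC /dl.
case: (eqVneq m k) => [->|_] /=; last by lmodule F.
by lmodule_with F ltac:(by [] || ring: (sg2 F j) (sg2 F k)).
Qed.

Lemma mtr_tau (X : MA) : mtr (tau X) = star (mtr X).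
Proof.
onMA X => j k x; rewrite tauE !(mtrE, opE) dl_barl barK dlC /dl.
case: (eqVneq j k) => [->|_] /=; last by lmodule F.
by lmodule_with F ltac:(by [] || ring: (sg2 F k)).
Qed.

Lemma tpair_tau (X Y : MA) : tpair (tau X) (tau Y) = tpair X Y.
Proof.
onMA X => j k x; onMA Y => m n y.
rewrite !(tauE, opE) !tpairE pa_star // !dl_barl !barK (@dlC F _ j _) (@dlC F _ m _) /dl.
case: (eqVneq k m) => [->|_] /=; last by lmodule F.
case: (eqVneq n j) => [->|_] /=; last by lmodule F.
by lmodule_with F ltac:(by [] || ring: (sg2 F j) (sg2 F m)).
Qed.

Lemma zact_mact z (X : MA) (w : VC) : zact z (mact X w) = mact X (zact z w).
Proof.
onMA X => j k x; onVC w => m c.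
by rewrite !(mactE, opE) !zactE mactE d0_act.
Qed.

Lemma cross_zact z (w w' : VC) : cross (zact z w) w' = - cross w (zact z w').
Proof.
onVC w => j c; onVC w' => m c'.
rewrite !zactE !crossE !f_d0 !(linE (mxe_lin _ _)).
lmodule F.
Qed.

Lemma B0_wpair z (w w' : VC) :
  B0 z (wpair w w') = wpair (zact z w) w' + wpair w (zact z w').
Proof.
onVC w => j c; onVC w' => m c'.
by rewrite !zactE !wpairE !opE B0_pc /B0_c; lmodule F.
Qed.

Lemma B0_tpair z (X Y : MA) : B0 z (tpair X Y) = 0.
Proof. by onMA X => j k x; onMA Y => m n y; rewrite !tpairE !opE B0_a scaler0. Qed.

Lemma zact_tpair (X Y : MA) w : zact (tpair X Y) w = 0 :> VC.
Proof.
onMA X => j k x; onMA Y => m n y; onVC w => p c.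
by rewrite tpairE opE zactE d0_a (linE (vce_lin _)) scaler0.
Qed.

Lemma zact_B0 z z' (w : VC) :
  zact (B0 z z') w = zact z (zact z' w) - zact z' (zact z w).
Proof.
onVC w => j c; rewrite !zactE d0_B0 !(linE (vce_lin _)) //.
Qed.

(** The Jacobi identity for three elements of V (x) C: each product f(c, c') c'' arises once from
    [cross] and once, with the opposite sign, from [d0_c]. *)
Lemma mact_cross_cycle (w1 w2 w3 : VC) :
  mact (cross w1 w2) w3 + zact (wpair w1 w2) w3 +
  (mact (cross w2 w3) w1 + zact (wpair w2 w3) w1) +
  (mact (cross w3 w1) w2 + zact (wpair w3 w1) w2) = 0.
Proof.
onVC w1 => j c1; onVC w2 => m c2; onVC w3 => n c3.
rewrite !crossE !wpairE !opE !mactE !zactE !d0_pc /d0_c !(linE (vce_lin _)).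
rewrite !dl_barl !(@dl_barC F _ m j) !(@dl_barC F _ n j) !(@dl_barC F _ n m).
have half s d (x y : VC) :
    (2 * s * d) *: - (2^-1 *: (x + y)) = - ((s * d) *: (x + y)).
  by lmodulef F.
rewrite !half.
by lmodule_with F ltac:(
  ring: (sg_dl_bar_eq j m) || ring: (sg_dl_bar_eq j n) || ring: (sg_dl_bar_eq m n)).
Qed.

(** A tau-skew matrix is an infinitesimal isometry for [f] and the form of V. Writing it as X - tau
    X lets X run over the basis of all matrices. *)
Lemma mxm_cross_skew (X : MA) (w w' : VC) :
  mxm (X - tau X) (cross w w') - mxm (cross w w') (X - tau X) =
  cross (mact (X - tau X) w) w' + cross w (mact (X - tau X) w').
Proof.
onMA X => j k x; onVC w => m c; onVC w' => n c'.
rewrite !(tauE, crossE, opE) !(mxmE, mactE, opE) !crossE.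
rewrite !qf_act !qf_actr !qstarK !sg_bar !dl_barl !barK.
rewrite ?(@dlC F _ n k) ?(@dlC F _ m k) ?(@dl_barC F _ m j) ?(@dl_barC F _ n j).
by lmodule_with F ltac:(ring ||
  ring: (sg2 F k) (sg_dl_bar_eq j m) || ring: (sg2 F k) (sg_dl_bar_eq j n) ||
  ring: (sg2 F n) (sg_dl_eq k n) || ring: (sg2 F m) (sg_dl_eq k m)).
Qed.

(** On a basis this compares [pc] terms with [pa] terms in values of [f], which is the last relation
    of {b, b}. *)
Lemma tpair_cross_skew (X : MA) (w w' : VC) :
  tpair (X - tau X) (cross w w') =
  wpair (mact (X - tau X) w) w' + wpair w (mact (X - tau X) w').
Proof.
onMA X => j k x; onVC w => m c; onVC w' => n c'.
rewrite !(tauE, crossE, opE) !(tpairE, mactE, opE) !wpairE.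
rewrite !sg_bar !dl_barl !barK.
rewrite !(@dlC F _ n k) !(@dlC F _ m k) !(@dl_barC F _ n j) !(@dl_barC F _ m j).
have paS c1 c2 : pa (star x) (f c1 c2) = pa (f c2 c1) x.
  by rewrite -[f c1 c2]opprK -qf_star (bilNr (pa_bil q)) pa_star // pa_antisym opprK.
have pcE c1 c2 : pc (act x c1) c2 = pa (f c1 c2) x + pc (act (star x) c2) c1.
  by rewrite pa_form addrNK.
rewrite !paS !(pa_antisym x) (pcE c c') (pcC c (act x c')) (pcE c' c).
rewrite (pcC c (act (star x) c')).
by lmodule_with F ltac:(ring ||
  ring: (sg2 F m) (sg_dl_eq k m) (sg_dl_bar_eq j n) ||
  ring: (sg2 F n) (sg_dl_eq k n) (sg_dl_bar_eq j m)).
Qed.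

End ModelIdentities.

(** * The Lie bracket of the model *)

Section ModelLie.
Variables (F : fieldType) (I : choiceType) (q : quadrupleBC F).
Hypothesis nz2 : (2 : F) != 0.
Local Notation B := (BB q).
Local Notation MA := (MA I q).
Local Notation VC := (VC I q).

Definition model : lmodType F := (MA * VC * B)%type.
Local Notation U := model.

Definition inX (X : MA) : U := (X, 0, 0).
Definition inW (w : VC) : U := (0, w, 0).
Definition inZ (z : B) : U := (0, 0, z).

Lemma model_eq (u u' : U) :
  u.1.1 = u'.1.1 -> u.1.2 = u'.1.2 -> u.2 = u'.2 -> u = u'.
Proof. by case: u u' => [[X w] z] [[X' w'] z'] /= -> -> ->. Qed.

Lemma inX_lin : linear inX.
Proof. by move=> k u u'; apply: model_eq; rewrite //= scaler0 addr0. Qed.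
Lemma inW_lin : linear inW.
Proof. by move=> k u u'; apply: model_eq; rewrite //= scaler0 addr0. Qed.
Lemma inZ_lin : linear inZ.
Proof. by move=> k u u'; apply: model_eq; rewrite //= scaler0 addr0. Qed.

Lemma modelE (u : U) : u = inX u.1.1 + inW u.1.2 + inZ u.2.
Proof. by apply: model_eq; rewrite /= ?addr0 ?add0r. Qed.

Definition mbr (u u' : U) : U :=
  (mxm u.1.1 u'.1.1 - mxm u'.1.1 u.1.1 + cross u.1.2 u'.1.2,
   mact u.1.1 u'.1.2 - mact u'.1.1 u.1.2 + zact u.2 u'.1.2 - zact u'.2 u.1.2,
   tpair u.1.1 u'.1.1 + wpair u.1.2 u'.1.2 + B0 u.2 u'.2).

Definition modelOpE := @opE F I q.

Lemma mbr_bil : bilinear_map mbr.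
Proof.
by split=> [y|x] k u u'; apply: model_eq; rewrite /= !modelOpE; lmodule F.
Qed.

Lemma mbr_antisym u u' : mbr u u' = - mbr u' u.
Proof.
apply: model_eq; rewrite /= 1?cross_antisym 1?tpair_antisym 1?wpair_antisym;
  rewrite 1?B0_antisym //; lmodule F.
Qed.

Lemma eqN_eq0 (W : lmodType F) (x : W) : x = - x -> x = 0.
Proof.
move=> xN; have -> : x = 2^-1 *: (x - (- x)) by lmodulef F.
by rewrite -xN subrr scaler0.
Qed.

Lemma mbr_alt u : mbr u u = 0.
Proof. exact/eqN_eq0/mbr_antisym. Qed.

Lemma mbrXX X Y : mbr (inX X) (inX Y) = inX (mxm X Y - mxm Y X) + inZ (tpair X Y).
Proof. by apply: model_eq; rewrite /= !modelOpE; lmodule F. Qed.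
Lemma mbrXW X w : mbr (inX X) (inW w) = inW (mact X w).
Proof. by apply: model_eq; rewrite /= !modelOpE; lmodule F. Qed.
Lemma mbrWX X w : mbr (inW w) (inX X) = - inW (mact X w).
Proof. by rewrite mbr_antisym mbrXW. Qed.
Lemma mbrXZ X z : mbr (inX X) (inZ z) = 0.
Proof. by apply: model_eq; rewrite /= !modelOpE; lmodule F. Qed.
Lemma mbrZX X z : mbr (inZ z) (inX X) = 0.
Proof. by rewrite mbr_antisym mbrXZ oppr0. Qed.
Lemma mbrWW w w' : mbr (inW w) (inW w') = inX (cross w w') + inZ (wpair w w').
Proof. by apply: model_eq; rewrite /= !modelOpE; lmodule F. Qed.
Lemma mbrZW z w : mbr (inZ z) (inW w) = inW (zact z w).
Proof. by apply: model_eq; rewrite /= !modelOpE; lmodule F. Qed.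
Lemma mbrWZ z w : mbr (inW w) (inZ z) = - inW (zact z w).
Proof. by rewrite mbr_antisym mbrZW. Qed.
Lemma mbrZZ z z' : mbr (inZ z) (inZ z') = inZ (B0 z z').
Proof. by apply: model_eq; rewrite /= !modelOpE; lmodule F. Qed.

Definition mbrE := (bil0l mbr_bil, bil0r mbr_bil, mbrXX, mbrXW, mbrWX, mbrXZ,
  mbrZX, mbrWW, mbrZW, mbrWZ, mbrZZ).
Definition inUE := (linE inX_lin, linE inW_lin, linE inZ_lin, bilE mbr_bil).

Definition jac (u u' u'' : U) : U :=
  mbr u (mbr u' u'') + mbr u' (mbr u'' u) + mbr u'' (mbr u u').

Lemma jacC u u' u'' : jac u u' u'' = jac u' u'' u.
Proof. by rewrite /jac; lmodule F. Qed.

Lemma jacD u u1 u2 u3 : jac (u1 + u2) u u3 = jac u1 u u3 + jac u2 u u3.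
Proof. by rewrite /jac !(bilDE mbr_bil); lmodule F. Qed.

Lemma lin_add (W : zmodType) (l r L R : W) : l = r -> L + r = R + l -> L = R.
Proof. by move=> -> /addIr. Qed.
Lemma lin_sub (W : zmodType) (l r L R : W) : l = r -> L + l = R + r -> L = R.
Proof. by move=> -> /addIr. Qed.

Ltac jac_simp := rewrite /jac ?mbrE ?inUE ?mbrE ?inUE.

Lemma jacXXX X Y Z : jac (inX X) (inX Y) (inX Z) = 0.
Proof.
jac_simp; rewrite !mxmA.
have := congr1 inZ (tpair_cycle X Y Z); have := congr1 inZ (tpair_cycle Y X Z).
rewrite !(tpair_antisym (mxm _ _)) !inUE => E1 E2.
by apply: (lin_add E1); apply: (lin_sub E2); lmodule F.
Qed.

Lemma jacXXW X Y w : jac (inX X) (inX Y) (inW w) = 0.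
Proof. by jac_simp; rewrite !mactM zact_tpair !inUE; lmodule F. Qed.

Lemma jacXXZ X Y z : jac (inX X) (inX Y) (inZ z) = 0.
Proof. by jac_simp; rewrite B0_tpair !inUE; lmodule F. Qed.

Lemma jacXWW X w w' :
  jac (inX (X - tau X)) (inW w) (inW w') = 0.
Proof.
have E1 := congr1 inX (mxm_cross_skew X w w').
have E2 := congr1 inZ (tpair_cross_skew nz2 X w w').
move: (X - tau X) E1 E2 => {X} Y E1 E2.
jac_simp; rewrite (cross_antisym w' (mact Y w)) (wpair_antisym w' (mact Y w)).
move: E1 E2; rewrite !inUE => E1 E2.
by apply: (lin_add E1); apply: (lin_add E2); lmodule F.
Qed.

Lemma jac_skewXWW X w w' : tau X = - X ->
  jac (inX X) (inW w) (inW w') = 0.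
Proof.
move=> sk; have -> : X = 2^-1 *: X - tau (2^-1 *: X).
  by rewrite modelOpE sk; lmodulef F.
exact: jacXWW.
Qed.

Lemma jacXWZ X w z : jac (inX X) (inW w) (inZ z) = 0.
Proof. by jac_simp; rewrite zact_mact; lmodule F. Qed.

Lemma jacXZW X w z : jac (inX X) (inZ z) (inW w) = 0.
Proof. by jac_simp; rewrite zact_mact; lmodule F. Qed.

Lemma jacXZZ X z z' : jac (inX X) (inZ z) (inZ z') = 0.
Proof. by jac_simp; lmodule F. Qed.

Lemma jacWWW w1 w2 w3 : jac (inW w1) (inW w2) (inW w3) = 0.
Proof.
jac_simp; have := congr1 inW (mact_cross_cycle nz2 w1 w2 w3).
by rewrite !inUE => E; apply: (lin_sub E); lmodule F.
Qed.

Lemma jacWWZ w w' z : jac (inW w) (inW w') (inZ z) = 0.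
Proof.
jac_simp; rewrite B0_wpair (cross_antisym w' (zact z w)) cross_zact.
rewrite (wpair_antisym w' (zact _ _)) !inUE.
by lmodule F.
Qed.

Lemma jacWZZ w z z' : jac (inW w) (inZ z) (inZ z') = 0.
Proof. by jac_simp; rewrite zact_B0 !inUE; lmodule F. Qed.

Lemma jacZZZ z1 z2 z3 : jac (inZ z1) (inZ z2) (inZ z3) = 0.
Proof. by rewrite /jac !mbrE -!(linearDP inZ_lin) B0_jacobi. Qed.

(** By trilinearity it is enough to treat matrices, vectors and elements of {b, b}; skewness enters
    for one matrix and two vectors. *)
Lemma mbr_jacobi (u1 u2 u3 : U) : tau u1.1.1 = - u1.1.1 ->
  tau u2.1.1 = - u2.1.1 -> tau u3.1.1 = - u3.1.1 -> jac u1 u2 u3 = 0.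
Proof.
move=> sk1 sk2 sk3.
have dec (u : U) x y : jac (inX u.1.1) x y = 0 -> jac (inW u.1.2) x y = 0 ->
    jac (inZ u.2) x y = 0 -> jac u x y = 0.
  by move=> x0 w0 z0; rewrite [u]modelE !jacD x0 w0 z0 !addr0.
have H := (jacXXX, jacXXW, jacXXZ, jacXWZ, jacXZW, jacXZZ, jacWWW, jacWWZ,
  jacWZZ, jacZZZ).
apply: (dec _ _ _); rewrite jacC; apply: (dec _ _ _); rewrite jacC;
  apply: (dec _ _ _); rewrite jacC;
  first [by rewrite H | by rewrite jacC H | by rewrite jacC jacC H |
    by rewrite jac_skewXWW | by rewrite jacC jac_skewXWW |
    by rewrite jacC jacC jac_skewXWW].
Qed.

(* These elements form the Lie algebra of which L(q, K) is a quotient.        *)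
Definition model_ok (u : U) : Prop :=
  tau u.1.1 = - u.1.1 /\ mtr u.1.1 = bst u.2.

Lemma model_ok_lin : closed_lin model_ok.
Proof.
split=> [|k u u' [sk tr] [sk' tr']]; rewrite /model_ok /= !modelOpE.
  by rewrite oppr0.
by rewrite sk sk' tr tr'; split=> //; lmodule F.
Qed.

Lemma bst_tpair (X Y : MA) :
  bst (tpair X Y) = skew_part (mtr (mxm X Y - mxm Y X)).
Proof.
onMA X => j k x; onMA Y => m n y.
rewrite tpairE !mxmE !modelOpE !mtrE bst_a (@dlC F _ n j) !modelOpE.
by rewrite (@dlC F _ m k); lmodule F.
Qed.

Lemma mtr_cross (w w' : VC) : mtr (cross w w') = bst (wpair w w').
Proof.
onVC w => j c; onVC w' => m c'.
rewrite crossE wpairE !modelOpE !mtrE bst_c /heart (@dl_barC F _ m j) scalerN !scalerA.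
have -> : 2 * sg j * dl j (bar m) / 2 = sg j * dl j (bar m) :> F by field.
by lmodule_with F ltac:(ring: (sg_dl_bar_eq F j m)).
Qed.

(** The trace of a skew matrix is skew for [star], so the skew part in [bst_tpair] is the whole
    trace; [cross] and [wpair] correspond by [mtr_cross], and [bst] kills [B0]. *)
Lemma model_ok_mbr u u' : model_ok u -> model_ok u' -> model_ok (mbr u u').
Proof.
move=> [sk tr] [sk' tr'].
have skM : tau (mxm u.1.1 u'.1.1 - mxm u'.1.1 u.1.1) =
    - (mxm u.1.1 u'.1.1 - mxm u'.1.1 u.1.1).
  by rewrite !modelOpE !tau_mxm sk sk' !modelOpE; lmodule F.
split; first by rewrite /= (linearDP (@tau_lin F I q)) skM tau_cross; lmodule F.
rewrite /= !(linearDP (@mtr_lin F I q)) !(linearDP (@bst_lin F q)).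
rewrite bst_B0 addr0 mtr_cross bst_tpair; congr (_ + _).
rewrite -(linearDP (@mtr_lin F I q)) (skew_part_skew nz2) //.
by rewrite -mtr_tau skM (linearNP (@mtr_lin F I q)).
Qed.

End ModelLie.

(** * Root elements and their weights *)

Section RootElements.
Variables (F : fieldType) (I : choiceType) (q : quadrupleBC F).
Hypothesis nz2 : (2 : F) != 0.
Local Notation J := (I + I)%type.
Local Notation a := (qa q).
Local Notation C := (qC q).
Local Notation star := (qstar q).
Local Notation act := (qact (q := q)).
Local Notation f := (qf (q := q)).
Local Notation MA := (MA I q).
Local Notation U := (model I q).
Local Notation e := (@mxe F I q).
Local Notation v := (@vce F I q).
Local Notation inX := (@inX F I q).
Local Notation inW := (@inW F I q).
Local Notation inZ := (@inZ F I q).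
Local Notation mbr := (@mbr F I q).
Local Notation dl := (@kron F I).
Local Notation sg := (@sg F I).

Definition skx (X : MA) : U := inX (X - tau X).
(** With eps_{bar i} = - eps_i this has weight eps_j - eps_k ([mbr_hh_sk]); the indices bar k, bar j
    describe the same root space by [sk_bar]. *)
Definition root_elem (j k : J) (x : a) : U := skx (e j k x).
Local Notation sk := root_elem.
Definition vv (j : J) (c : C) : U := inW (v j c).

Lemma skx_lin : linear skx.
Proof. by move=> k X Y; rewrite /skx -inX_lin !opE; congr inX; lmodule F. Qed.
Lemma sk_lin j k : linear (sk j k).
Proof. by move=> l x y; rewrite /sk mxe_lin skx_lin. Qed.
Lemma vv_lin j : linear (vv j).
Proof. by move=> l x y; rewrite /vv vce_lin inW_lin. Qed.

Lemma skx_tau X : skx (tau X) = - skx X.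
Proof. by rewrite /skx tauK -(linearNP (@inX_lin F I q)) opprB. Qed.

Lemma sk_bar j k x :
  sk (bar k) (bar j) (star x) = - ((sg j * sg k) *: sk j k x).
Proof.
have := skx_tau (e j k x); rewrite tauE (linearZP skx_lin) => E.
by rewrite -scalerN [sk j k x]/(skx _) -E scalerA mulrACA !sg2 mulr1 scale1r.
Qed.

Lemma ok_skx X : mtr (X - tau X) = 0 -> model_ok (skx X).
Proof.
move=> tr0; split; first by rewrite /= !opE tauK; lmodule F.
by rewrite /= tr0 (linear0P (@bst_lin F q)).
Qed.

Lemma ok_sk j k x : j != k -> model_ok (sk j k x).
Proof.
move=> jk; apply: ok_skx; rewrite tauE !opE !mtrE dl_barl barK dlC.
by rewrite /dl eq_sym (negPf jk) !scale0r scaler0 subr0.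
Qed.

Definition hh (j : J) : U := sk j j 1.

Lemma ok_hh j : model_ok (hh j).
Proof.
apply: ok_skx; rewrite tauE !opE !mtrE !dl_self qstar1.
by rewrite sg2 !scale1r subrr.
Qed.

Lemma ok_vv j c : model_ok (vv j c).
Proof. by split; rewrite /= ?opE // oppr0. Qed.

(** The factor 2 appears because [tpair] is unchanged when tau is applied to both arguments. *)
Lemma mbr_skx X Y : mbr (skx X) (skx Y) =
  skx (mxm X Y) - skx (mxm Y X) - skx (mxm X (tau Y)) + skx (mxm (tau Y) X)
  + inZ (2 *: (tpair X Y - tpair X (tau Y))).
Proof.
rewrite /skx mbrXX !opE.
have E1 := tpair_tau nz2 X Y; have E2 := tpair_tau nz2 X (tau Y).
rewrite tauK in E2; rewrite E1 E2 !tau_mxm tauK.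
rewrite !(linE (@inX_lin F I q), linE (@inZ_lin F I q)).
lmodule F.
Qed.

Lemma mbr_sk j k x m n y : mbr (sk j k x) (sk m n y) =
  dl k m *: sk j n (x * y) - dl n j *: sk m k (y * x)
  - (sg m * sg n * dl k (bar n)) *: sk j (bar m) (x * star y)
  + (sg m * sg n * dl (bar m) j) *: sk (bar n) k (star y * x)
  + inZ (2 *: ((dl k m * dl n j) *: pa x y
       - (sg m * sg n * (dl k (bar n) * dl (bar m) j)) *: pa x (star y))).
Proof.
rewrite mbr_skx tauE !opE !mxmE !tpairE !(linE skx_lin) -!/(sk _ _ _).
congr (_ + inZ (2 *: _)); lmodule F.
Qed.

Lemma mbr_sk_vv j k x m c : mbr (sk j k x) (vv m c) =
  dl k m *: vv j (act x c)
  - (sg j * sg k * dl (bar j) m) *: vv (bar k) (act (star x) c).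
Proof.
rewrite /sk /skx /vv mbrXW tauE !opE !mactE !(linE (@inW_lin F I q)).
by lmodule F.
Qed.

Lemma mbr_vv j c m c' : mbr (vv j c) (vv m c') =
  sg m *: sk j (bar m) (f c c') + (2 * sg j * dl m (bar j)) *: inZ (pc c c').
Proof.
rewrite /vv mbrWW crossE wpairE /sk /skx tauE sg_bar barK qf_star.
rewrite !(linE (@inX_lin F I q), linE (@inZ_lin F I q), linE (mxe_lin _ _)).
by lmodule_with F ltac:(ring || ring: (sg2 F m)).
Qed.

Lemma dl_scale (W : lmodType F) (g : J -> W) j k : dl j k *: g j = dl j k *: g k.
Proof. by rewrite /kron; case: (eqVneq j k) => [->|_]; rewrite ?scale0r. Qed.

(** In the cyclic relation with two arguments equal to 1 all three terms are {1, x} up to sign, and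
    the signs do not cancel. *)
Lemma pa1 (x : a) : pa 1 x = 0.
Proof.
have := pa_cycle 1 1 x; rewrite !mulr1 mul1r (pa_antisym x) => E.
by apply/oppr_inj; rewrite oppr0 -[RHS]E; lmodule F.
Qed.

(** The value of eps_j on h_k. *)
Definition weight (j k : J) : F := dl j k - dl j (bar k).
Local Notation wt := weight.

Lemma mbr_hh_sk p j k x : mbr (hh p) (sk j k x) = (wt j p - wt k p) *: sk j k x.
Proof.
rewrite mbr_sk !pa1 !scaler0 subrr scaler0 (linear0P (@inZ_lin F I q)) addr0.
rewrite !mul1r !mulr1 /wt.
(* A Kronecker symbol allows its two indices to be exchanged, which turns all four terms into
   multiples of [sk j k x]. *)
have E1 := dl_scale (fun j' => sk j' k x) p j.
have E2 := dl_scale (fun k' => sk j k' x) k p.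
have E3 := dl_scale (fun j' => sk j' (bar j) (star x)) p (bar k).
have E4 := dl_scale (fun k' => sk (bar k) k' (star x)) (bar j) p.
rewrite /= sk_bar in E1 E2 E3 E4.
rewrite -!(scalerA (sg j * sg k)) E1 -E2 E3 -E4.
rewrite (@dlC F _ p j) (@dl_barC F _ p k) dl_barl (@dl_barC F _ k p).
by lmodule_with F ltac:(ring: (sg2 F j) (sg2 F k)).
Qed.

Lemma mbr_hh_vv p m c : mbr (hh p) (vv m c) = wt m p *: vv m c.
Proof.
rewrite mbr_sk_vv qstar1 !qact1 sg2 mul1r dl_barl /wt.
have E1 := dl_scale (fun j => vv j c) p m.
have E2 := dl_scale (fun j => vv (bar j) c) p (bar m).
rewrite /= barK in E1 E2.
by rewrite E1 E2 (@dl_barC F _ p m) (@dlC F _ p m); lmodule F.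
Qed.

End RootElements.

(** * Cocycles are coboundaries *)

Section Cocycle.
Variables (F : fieldType) (I : choiceType) (q : quadrupleBC F).
Hypothesis nz2 : (2 : F) != 0.
Local Notation J := (I + I)%type.
Local Notation a := (qa q).
Local Notation C := (qC q).
Local Notation star := (qstar q).
Local Notation act := (qact (q := q)).
Local Notation f := (qf (q := q)).
Local Notation U := (model I q).
Local Notation e := (@mxe F I q).
Local Notation v := (@vce F I q).
Local Notation inX := (@inX F I q).
Local Notation inW := (@inW F I q).
Local Notation inZ := (@inZ F I q).
Local Notation mbr := (@mbr F I q).
Local Notation dl := (@kron F I).
Local Notation sg := (@sg F I).

Local Notation sk := (@root_elem F I q).
Local Notation vv := (@vv F I q).
Local Notation hh := (@hh F I q).
Local Notation wt := (@weight F I).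
Local Notation bar := (@bar I).

Hypothesis nz3 : (3 : F) != 0.
Hypothesis I_infinite : infinite_set [set: I].
Variables (M : lmodType F) (om : U -> U -> M).
Hypothesis om_bil : bilinear_map om.
Hypothesis om_alt : forall u, om u u = 0.
Hypothesis om_cocycle : forall u u' u'',
  model_ok u -> model_ok u' -> model_ok u'' ->
  om (mbr u u') u'' + om (mbr u' u'') u + om (mbr u'' u) u' = 0.

Lemma om_antisym u u' : om u u' = - om u' u.
Proof.
have := om_alt (u + u'); rewrite !(bilE om_bil) !om_alt add0r addr0 => E.
by apply/eqP; rewrite -addr_eq0 E.
Qed.

Lemma om_der u v w : model_ok u -> model_ok v -> model_ok w ->
  om u (mbr v w) = om (mbr u v) w + om v (mbr u w).
Proof.
move=> ou ov ow; apply: (lin_sub (om_cocycle ou ov ow)).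
rewrite (om_antisym (mbr v w)) (mbr_antisym nz2 w u) !(bilE om_bil) (om_antisym (mbr u w)).
by lmodule F.
Qed.

(* j and k come from distinct elements of I.                                  *)
Definition far (j k : J) := (j != k) && (j != bar k).

Lemma far_sym j k : far j k = far k j.
Proof. by rewrite /far eq_sym -(eq_bar k j) (eq_sym (bar k)). Qed.
Lemma far_barl j k : far (bar j) k = far j k.
Proof. by rewrite /far !eq_bar barK andbC. Qed.
Lemma far_barr j k : far j (bar k) = far j k.
Proof. by rewrite far_sym far_barl far_sym. Qed.
Lemma far_neq j k : far j k -> j != k. Proof. by case/andP. Qed.

Lemma far_dl j k : far j k -> (dl j k = 0) * (dl k j = 0) *
  (dl j (bar k) = 0) * (dl k (bar j) = 0) * (dl (bar j) k = 0) *
  (dl (bar k) j = 0).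
Proof.
case/andP=> /negPf jk /negPf jbk; rewrite !dl_barl (dl_barC _ k j) (dlC _ k j).
by rewrite /kron jk jbk.
Qed.

Lemma dl_neq j k : j != k -> dl j k = 0.
Proof. by rewrite /kron => /negPf->. Qed.

Lemma fresh_exists (s : seq J) : exists m, all (far m) s.
Proof.
have [i i_s] : exists i, i \notin [seq base j | j <- s].
  apply: contrapT => all_in; apply: I_infinite.
  apply: sub_finite_set (finite_seq [seq base j | j <- s]) => i _ /=.
  by apply: contrapT => /negP i_s; apply: all_in; exists i.
exists (inl i); apply/allP => j js.
have ne : i != base j by apply: contraNneq i_s => ->; apply: map_f.
apply/andP; split; apply: contra_neq ne; first by move=> <-.
by case: j {js} => j //= [->].
Qed.

Definition fresh (s : seq J) : J := projT1 (cid (fresh_exists s)).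
Lemma freshP s j : j \in s -> far (fresh s) j.
Proof. by move=> js; have /allP/(_ j js) := projT2 (cid (fresh_exists s)). Qed.

(** * The cocycle on opposite root spaces *)

Definition HH j k x y := om (sk j k x) (sk k j y).

Lemma sk_bil_om j k m n : bilinear_map (fun x y => om (sk j k x) (sk m n y)).
Proof.
by split=> [y|x] l u w; rewrite !(linE (sk_lin _ _), bilE om_bil).
Qed.

Lemma HH_bil j k : bilinear_map (HH j k). Proof. exact: sk_bil_om. Qed.

Lemma mbr_sk_far j k m x y : far j k -> far k m -> far j m ->
  mbr (sk j k x) (sk k m y) = sk j m (x * y).
Proof.
move=> jk km jm; rewrite mbr_sk // dl_self !(far_dl jk) !(far_dl km) !(far_dl jm).
rewrite !(mulr0, mul0r, scale0r) subrr scaler0 (linear0P (@inZ_lin F I q)).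
by lmodule F.
Qed.

(** The cocycle identity on t_{j,k}(x), t_{k,m}(y), t_{m,j}(z), whose pairwise brackets are again
    single root elements. *)
Lemma HH_cycle j k m x y z : far j k -> far k m -> far j m ->
  HH j m (x * y) z = HH j k x (y * z) + HH k m y (z * x).
Proof.
move=> jk km jm; have mj : far m j by rewrite far_sym.
have kj : far k j by rewrite far_sym. have mk : far m k by rewrite far_sym.
have := om_cocycle (ok_sk x (far_neq jk)) (ok_sk y (far_neq km)) (ok_sk z (far_neq mj)).
rewrite !mbr_sk_far // => E; apply: (lin_add E).
rewrite /HH (om_antisym (sk k j _)) (om_antisym (sk m k _)); lmodule F.
Qed.

Lemma HH_antisym j k x y : HH k j y x = - HH j k x y.
Proof. exact: om_antisym. Qed.

Lemma HH_bar j k x y : HH (bar k) (bar j) (star x) (star y) = HH j k x y.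
Proof.
rewrite /HH !sk_bar !(bilE om_bil) opprK scalerA (mulrC (sg k)) mulrACA.
by rewrite !sg2 mulr1 scale1r.
Qed.

Definition de j k x := HH j k 1 x.

Lemma de_lin j k : linear (de j k).
Proof. by move=> l x y; rewrite /de !(bilE (HH_bil j k)). Qed.

Lemma de_add j k m x : far j k -> far k m -> far j m ->
  de j m x = de j k x + de k m x.
Proof.
by move=> jk km jm; rewrite /de -{1}[1 : a]mulr1 (HH_cycle _ _ _ jk km) // mul1r mulr1.
Qed.

Lemma de_anti j k x : far j k -> de k j x = - de j k x.
Proof.
move=> jk; pose m := fresh [:: j; k].
have mj : far m j by apply: freshP; rewrite inE eqxx.
have mk : far m k by apply: freshP; rewrite !inE eqxx orbT.
have kj : far k j by rewrite far_sym.
apply: (lin_sub (de_add x mj jk mk)); rewrite (de_add x mk kj mj).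
by lmodule F.
Qed.

(* de j k only satisfies de j m = de j k + de k m for pairwise far indices; De *)
(* extends it so that this holds for all indices.                             *)
Definition De j k x := de j (fresh [:: j; k]) x + de (fresh [:: j; k]) k x.

Lemma De_lin j k : linear (De j k).
Proof. by move=> l x y; rewrite /De !(linE (de_lin _ _)); lmodule F. Qed.

(** The value does not depend on the intermediate index: two admissible choices are both compared
    with a third one, far from both. *)
Lemma DeE m j k x : far m j -> far m k -> De j k x = de j m x + de m k x.
Proof.
move=> mj mk; rewrite /De.
set n := fresh [:: j; k]; set p := fresh [:: j; k; m; n].
have nj : far n j by apply: freshP; rewrite inE eqxx.
have nk : far n k by apply: freshP; rewrite !inE eqxx orbT.
have [pj pk pm pn] : [/\ far p j, far p k, far p m & far p n].
  by split; apply: freshP; rewrite !inE eqxx ?orbT.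
have step r : far r j -> far r k -> far p r -> de j r x + de r k x = de j p x + de p k x.
  move=> rj rk pr; have rp : far r p by rewrite far_sym.
  have jp : far j p by rewrite far_sym. have jr : far j r by rewrite far_sym.
  by rewrite (de_add x jp pr jr) (de_add x rp pk rk) (de_anti x pr); lmodule F.
by rewrite step // (step m).
Qed.

Lemma De_add k j m x : De j m x = De j k x + De k m x.
Proof.
set p := fresh [:: j; k; m].
have [pj pk pm] : [/\ far p j, far p k & far p m].
  by split; apply: freshP; rewrite !inE eqxx ?orbT.
by rewrite !(@DeE p) // (@de_anti p k) //; lmodule F.
Qed.

Lemma De_far j k x : far j k -> De j k x = de j k x.
Proof.
move=> jk; pose p := fresh [:: j; k].
have [pj pk] : far p j /\ far p k by split; apply: freshP; rewrite !inE eqxx ?orbT.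
by rewrite (DeE x pj pk) -de_add // far_sym.
Qed.

Lemma De_bar j k x : De (bar j) (bar k) (star x) = - De j k x.
Proof.
pose p := fresh [:: j; k].
have [pj pk] : far p j /\ far p k by split; apply: freshP; rewrite !inE eqxx ?orbT.
have de_bar r t y : de (bar r) (bar t) (star y) = de t r y.
  by rewrite /de -[X in HH _ _ X _](@qstar1 F q) HH_bar.
rewrite (DeE x pj pk) (@DeE (bar p)) ?far_barl ?far_barr // !de_bar.
by rewrite (de_anti x pk) [de p j x]de_anti ?(far_sym j) //; lmodule F.
Qed.

Definition j0 := fresh [::].

(* Averaging over j0 and bar j0 makes eta odd under bar and star.             *)
Definition eta j x := 2^-1 *: (De j j0 x + De j (bar j0) x).

Lemma eta_lin j : linear (eta j).
Proof. by move=> l x y; rewrite /eta !(linE (De_lin _ _)); lmodule F. Qed.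

Lemma eta_sub j k x : far j k -> de j k x = eta j x - eta k x.
Proof.
move=> jk; by rewrite /eta (De_add k j j0) (De_add k j (bar j0)) (De_far x jk); lmodulef F.
Qed.

(** [De_bar] exchanges the two base points j0 and bar j0 over which [eta] averages. *)
Lemma eta_bar j x : eta (bar j) (star x) = - eta j x.
Proof.
by rewrite /eta -{1}[j0](@barK I) !De_bar; lmodule F.
Qed.

(** What is left of [HH] after removing the part forced by [eta]. The half matches the coefficient 2
    of {x, y} in [mbr_sk_opp]. *)
Definition kap j k x y := 2^-1 *: (HH j k x y - eta j (x * y) + eta k (y * x)).

(** With 1 as the second element in [HH_cycle], the change of index is measured by [de], hence by a
    difference of values of [eta]. *)
Lemma kap_right j k m x y : far j k -> far k m -> far j m -> kap j m x y = kap j k x y.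
Proof.
move=> jk km jm; rewrite /kap -{1}[x]mulr1 (HH_cycle _ _ _ jk km jm) mul1r.
by rewrite -/(de k m _) (eta_sub _ km); lmodule F.
Qed.

Lemma kap_left j k m x y : far j k -> far k m -> far j m -> kap j m x y = kap k m x y.
Proof.
move=> jk km jm; rewrite /kap -{1}[x]mul1r (HH_cycle _ _ _ jk km jm) mulr1.
by rewrite -/(de j k _) (eta_sub _ jk); lmodule F.
Qed.

Definition k0 := fresh [:: j0].
Definition kappa := kap j0 k0.

Lemma kapE j k x y : far j k -> kap j k x y = kappa x y.
Proof.
move=> jk; have jk0 : far j0 k0 by rewrite far_sym; apply: freshP; rewrite inE.
(* The pairs j, k and j0, k0 may overlap; moving one index at a time through two fresh ones keeps
   every step between far indices. *)
pose n := fresh [:: j; k; k0; j0]; pose m := fresh [:: j; k0; j0; n].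
have [nj nk nk0 nj0] : [/\ far n j, far n k, far n k0 & far n j0].
  by split; apply: freshP; rewrite !inE eqxx ?orbT.
have [mj mk0 mj0 mn] : [/\ far m j, far m k0, far m j0 & far m n].
  by split; apply: freshP; rewrite !inE eqxx ?orbT.
rewrite -(@kap_right j k n) //; try by rewrite far_sym.
rewrite (@kap_left j m n) //; try by rewrite far_sym.
rewrite (@kap_right m k0 n) //; try by rewrite far_sym.
by rewrite /kappa (@kap_left j0 m k0) //; rewrite far_sym.
Qed.

Lemma HHE j k x y : far j k ->
  HH j k x y = 2 *: kappa x y + eta j (x * y) - eta k (y * x).
Proof. by move=> jk; rewrite -(kapE x y jk) /kap; lmodulef F. Qed.

Lemma jk0 : far j0 k0.
Proof. by rewrite far_sym; apply: freshP; rewrite inE. Qed.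

Lemma kappa_bil : bilinear_map kappa.
Proof.
by split=> [y|x] l u w; rewrite /kappa /kap !algE !(bilE (HH_bil _ _), linE (eta_lin _));
  lmodule F.
Qed.

Lemma kappa_antisym x y : kappa x y = - kappa y x.
Proof.
have kj0 : far k0 j0 by rewrite far_sym jk0.
rewrite -(kapE x y jk0) -(kapE y x kj0) /kap (HH_antisym j0 k0); lmodule F.
Qed.

Lemma kappa_star x y : kappa (star x) (star y) = kappa x y.
Proof.
have kj0 : far (bar k0) (bar j0) by rewrite far_barl far_barr far_sym jk0.
rewrite -(kapE _ _ kj0) -(kapE x y jk0) /kap HH_bar -!qstarM !eta_bar.
by lmodule F.
Qed.

(** Substitute [HHE] into [HH_cycle]: the [eta] terms cancel and twice the cyclic sum remains. *)
Lemma kappa_cycle x y z : kappa (x * y) z + kappa (z * x) y + kappa (y * z) x = 0.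
Proof.
pose m := fresh [:: j0; k0].
have [mj mk] : far m j0 /\ far m k0 by split; apply: freshP; rewrite !inE eqxx ?orbT.
have jm : far j0 m by rewrite far_sym. have km : far k0 m by rewrite far_sym.
have E := HH_cycle x y z jk0 km jm.
rewrite (HHE _ _ jm) (HHE _ _ jk0) (HHE _ _ km) !amulA in E.
rewrite (kappa_antisym (y * z)) (kappa_antisym (z * x)).
apply: (scalerI nz2); rewrite scaler0; apply: (lin_add E); lmodule F.
Qed.

(** * The cocycle on short roots *)

Lemma om_vv_bil j k : bilinear_map (fun c c' => om (vv j c) (vv k c')).
Proof. by split=> [y|x] l u w; rewrite !(linE (vv_lin _), bilE om_bil). Qed.

(** Obtained by solving for the contribution of {c, c'} in the bracket of opposite short root
    elements, see [mbr_vv_opp]. *)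
Definition gam j c c' :=
  2^-1 *: (sg j *: om (vv j c) (vv (bar j) c') + eta j (f c c')).

Lemma gam_bar j c c' : gam (bar j) c' c = gam j c c'.
Proof.
rewrite /gam barK sg_bar om_antisym -[f c' c]opprK -qf_star (linearNP (eta_lin _)).
by rewrite eta_bar; lmodule F.
Qed.

(** The cocycle identity on t_{j,k}(x), v_k c and v_{bar j} c'; it will become the relation between
    [pa] and [pc]. *)
Lemma gam_act j k x c c' : far j k ->
  gam j (act x c) c' = gam k c (act (star x) c') + kappa (f c c') x.
Proof.
move=> jk; have kj : far k j by rewrite far_sym.
have := om_cocycle (ok_sk x (far_neq jk)) (ok_vv k c) (ok_vv (bar j) c').
rewrite mbr_sk_vv // mbr_vv // (mbr_antisym nz2 (vv (bar j) c')) mbr_sk_vv //.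
have jbk : far (bar j) (bar k) by rewrite far_barl far_barr.
rewrite !dl_self !(far_dl jbk) !(far_dl jk) barK sg_bar !(bilE om_bil) => E.
have {}E := congr1 (fun t => 2^-1 *: (sg j *: t)) E; rewrite /= !scaler0 in E.
rewrite -(kapE _ _ kj) /kap /HH /gam qf_act qf_actr qstarK.
rewrite (om_antisym (vv k c)); apply: (lin_add E).
by lmodule_with F ltac:(ring || ring: (sg2 F j)).
Qed.

Lemma kappa1r x : kappa x 1 = 0.
Proof.
have := kappa_cycle x 1 1; rewrite !mulr1 mul1r (kappa_antisym 1 x) => E.
by rewrite -[RHS]E; lmodule F.
Qed.

(** [gam_act] at x = 1 changes the index, because [kappa] vanishes when its second argument is 1. *)
Lemma gam_eq j k c c' : gam j c c' = gam k c c'.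
Proof.
have far_eq r t : far r t -> gam r c c' = gam t c c'.
  by move=> rt; have := gam_act 1 c c' rt; rewrite kappa1r qstar1 !qact1 addr0.
pose p := fresh [:: j; k].
have [pj pk] : far p j /\ far p k by split; apply: freshP; rewrite !inE eqxx ?orbT.
by rewrite -(far_eq _ _ pj) (far_eq _ _ pk).
Qed.

Definition gamma := gam j0.

Lemma gamma_bil : bilinear_map gamma.
Proof.
split=> [y|x] l u w; rewrite /gamma /gam !(bilE (f_bil q)) !(linE (eta_lin _));
  by rewrite !(bilE (om_vv_bil _ _)); lmodule F.
Qed.

(** For x fixed and y skew, [kappa_star] makes kappa(x, y) its own opposite. Symmetry of [gamma] is
    [gam_bar] and the mixed relation is [gam_act], both up to the independence of the index. *)
Lemma kappa_gamma_compat : bb_compatible kappa gamma.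
Proof.
split.
- exact: kappa_bil.
- exact: gamma_bil.
- move=> x y xF yS; apply: (eqN_eq0 nz2).
  by rewrite -{1}kappa_star xF yS (bilE kappa_bil).
- by move=> x y; rewrite kappa_antisym addNr.
- by move=> c c'; rewrite /gamma -gam_bar (gam_eq (bar j0) j0) subrr.
- exact: kappa_cycle.
- move=> x c c'; rewrite /gamma (gam_act x c c' jk0).
  rewrite (gam_eq k0 (bar j0)) gam_bar (gam_eq j0 (bar j0)); lmodule F.
Qed.

(** The values are forced: om(h_j, t_{j,k}(x)) must be psi of t_{j,k}(x) times 1 + [j = bar k], its
    weight at h_j. Each of the two matrix units in t_{j,k}(x) is given half of the value, on the
    diagonal as well. *)
Definition psiX (p : J * J) (x : a) : M :=
  if p.1 == p.2 then 2^-1 *: eta p.1 x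
  else (2 * (1 + dl p.1 (bar p.2)))^-1 *: om (hh p.1) (sk p.1 p.2 x).

Definition psiW (j : J) (c : C) : M := om (hh j) (vv j c).

Lemma psiX_lin p : linear (psiX p).
Proof.
move=> l x y; rewrite /psiX; case: ifP => _.
  by rewrite !(linE (eta_lin _)); lmodule F.
by rewrite !(linE (sk_lin _ _), bilE om_bil); lmodule F.
Qed.

Lemma psiW_lin j : linear (psiW j).
Proof. by move=> l x y; rewrite /psiW !(linE (vv_lin _), bilE om_bil). Qed.

Definition psi (u : U) : M :=
  blift psiX u.1.1 + blift psiW u.1.2 + bblift kappa gamma u.2.

Lemma psi_lin : linear psi.
Proof.
move=> l u u'; rewrite /psi /= (blift_linear psiX_lin) (blift_linear psiW_lin).
by rewrite (bblift_linear kappa_gamma_compat); lmodule F.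
Qed.

Lemma psi_e j k x : psi (inX (e j k x)) = psiX (j, k) x.
Proof.
rewrite /psi /= (bliftE psiX_lin) (linear0P (blift_linear psiW_lin)).
by rewrite (linear0P (bblift_linear kappa_gamma_compat)) !addr0.
Qed.

Lemma psi_vv j c : psi (vv j c) = psiW j c.
Proof.
rewrite /psi /= (bliftE psiW_lin) (linear0P (blift_linear psiX_lin)).
by rewrite (linear0P (bblift_linear kappa_gamma_compat)) addr0 add0r.
Qed.

Lemma psi_a x y : psi (inZ (pa x y)) = kappa x y.
Proof.
rewrite /psi /= (bblift_a kappa_gamma_compat) (linear0P (blift_linear psiX_lin)).
by rewrite (linear0P (blift_linear psiW_lin)) !add0r.
Qed.

Lemma psi_c c c' : psi (inZ (pc c c')) = gamma c c'.
Proof.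
rewrite /psi /= (bblift_c kappa_gamma_compat) (linear0P (blift_linear psiX_lin)).
by rewrite (linear0P (blift_linear psiW_lin)) !add0r.
Qed.

Lemma psi_sk_diag j x : psi (sk j j x) = eta j x.
Proof.
rewrite /sk /skx tauE !(linE (@inX_lin F I q), linE psi_lin) !psi_e /psiX /= !eqxx.
by rewrite eta_bar sg2; lmodulef F.
Qed.

(** The cocycle identity on h_p, h_r, u, where [h_p, h_r] = 0: as a function of p, om(h_p, u) is
    proportional to the weight of u. *)
Lemma wt_swap u p r s t : model_ok u -> mbr (hh p) u = s *: u ->
  mbr (hh r) u = t *: u -> t *: om (hh p) u = s *: om (hh r) u.
Proof.
move=> ou up ur; have := om_der (ok_hh _ p) (ok_hh _ r) ou.
rewrite ur up !(bilE om_bil) mbr_hh_sk // subrr scale0r (bilE om_bil) add0r //.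
Qed.

Lemma om_hh_vv p j c : om (hh p) (vv j c) = wt j p *: psi (vv j c).
Proof.
have := wt_swap (ok_vv j c) (mbr_hh_vv p j c) (mbr_hh_vv j j c).
by rewrite psi_vv /psiW /weight dl_self dl_bar subr0 scale1r.
Qed.

Let lam (j k : J) : F := 1 + dl j (bar k).

Let lam_neq0 j k : lam j k != 0.
Proof.
rewrite /lam /kron; case: (j == _); last by rewrite addr0 oner_eq0.
by rewrite (_ : 1 + true%:R = 2) //; ring.
Qed.

Let wt_lam j k : j != k -> wt j j - wt k j = lam j k.
Proof.
move=> jk; rewrite /lam /weight dl_self dl_bar (dl_barC _ k) (dlC _ k) (dl_neq jk).
by ring.
Qed.

Let wt_lam_bar j k : j != k -> wt j (bar k) - wt k (bar k) = lam j k.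
Proof.
move=> jk; rewrite /lam /weight barK dl_self dl_bar (dl_neq jk); ring.
Qed.

(** The two halves of t_{j,k}(x) are measured with h_j and h_{bar k}, where it has the same weight,
    so they agree by [wt_swap]. *)
Lemma psi_sk j k x : j != k -> lam j k *: psi (sk j k x) = om (hh j) (sk j k x).
Proof.
move=> jk; have bkj : bar k != bar j by rewrite (inj_eq (inv_inj (@barK I))) eq_sym.
have := wt_swap (ok_sk x jk) (mbr_hh_sk nz2 (bar k) j k x) (mbr_hh_sk nz2 j j k x).
rewrite wt_lam // wt_lam_bar // => /(scalerI (lam_neq0 j k)) E.
rewrite {1}/root_elem /skx tauE !(linE (@inX_lin F I q), linE psi_lin) !psi_e /psiX /=.
rewrite (negPf jk) (negPf bkj) sk_bar !(bilE om_bil) E barK.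
have -> : dl (bar k) j = dl j (bar k) by rewrite dl_barl dl_barC.
rewrite -/(lam j k); have := lam_neq0 j k; move: (lam j k) => L nzL.
have -> : (2 * L)^-1 *: - ((sg j * sg k) *: om (hh j) (sk j k x)) =
  - ((sg j * sg k) *: ((2 * L)^-1 *: om (hh j) (sk j k x))) by lmodule F.
rewrite scalerN scalerA mulrACA !sg2 mulr1 scale1r opprK.
lmodule_with F ltac:(field; by rewrite nz2 nzL).
Qed.

Lemma om_hh_sk p j k x : j != k ->
  om (hh p) (sk j k x) = (wt j p - wt k p) *: psi (sk j k x).
Proof.
move=> jk; apply: (scalerI (lam_neq0 j k)).
have := wt_swap (ok_sk x jk) (mbr_hh_sk nz2 p j k x) (mbr_hh_sk nz2 j j k x).
rewrite wt_lam // => ->; rewrite -psi_sk //; lmodule F.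
Qed.

(** * Spanning the model by root elements and brackets of opposite ones *)

Section OkInduction.
Variable Q : U -> Prop.
Hypothesis clQ : closed_lin Q.
Hypothesis Q_sk : forall j k x, j != k -> Q (sk j k x).
Hypothesis Q_vv : forall j c, Q (vv j c).
Hypothesis Q_sk_sk : forall j k x y, far j k -> Q (mbr (sk j k x) (sk k j y)).
Hypothesis Q_vv_vv : forall j c c', Q (mbr (vv j c) (vv (bar j) c')).

Lemma mbr_sk_opp j k x y : far j k -> mbr (sk j k x) (sk k j y) =
  sk j j (x * y) - sk k k (y * x) + inZ (2 *: pa x y).
Proof.
move=> jk; rewrite mbr_sk // !dl_self !(far_dl jk) !(linE (@inZ_lin F I q)).
by lmodule F.
Qed.

Lemma mbr_vv_opp j c c' : mbr (vv j c) (vv (bar j) c') =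
  - (sg j *: sk j j (f c c')) + (2 * sg j) *: inZ (pc c c').
Proof. by rewrite mbr_vv barK dl_self sg_bar mulr1 scaleNr. Qed.

Let Q_diag_far j k x : far j k -> Q (sk j j x - sk k k x).
Proof.
move=> jk; have := Q_sk_sk 1 x jk.
by rewrite mbr_sk_opp // pa1 scaler0 (linear0P (@inZ_lin F I q)) addr0 mul1r mulr1.
Qed.

Let Q_diag j x : Q (sk j j x - sk j0 j0 x).
Proof.
pose p := fresh [:: j; j0].
have [pj pj0] : far p j /\ far p j0 by split; apply: freshP; rewrite !inE eqxx ?orbT.
have -> : sk j j x - sk j0 j0 x = sk p p x - sk j0 j0 x - (sk p p x - sk j j x).
  by lmodule F.
by apply: closed_linB => //; apply: Q_diag_far.
Qed.

(** Diagonal entries can be moved to the index j0 by [Q_diag], so a skew matrix is reached up to its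
    trace. *)
Let Q_skx Y : Q (skx Y - sk j0 j0 (mtr Y)).
Proof.
case: (clQ) => Q0 QD; move: Y; apply: MA_ind => [|j k x].
  split=> [|l X Y QX QY].
    by rewrite (linear0P (@skx_lin F I q)) opE (linear0P (sk_lin _ _)) subrr.
  rewrite skx_lin mtr_lin sk_lin.
  have -> : l *: skx X + skx Y - (l *: sk j0 j0 (mtr X) + sk j0 j0 (mtr Y)) =
    l *: (skx X - sk j0 j0 (mtr X)) + (skx Y - sk j0 j0 (mtr Y)) by lmodule F.
  exact: QD.
rewrite mtrE /kron; case: (eqVneq j k) => [<-|jk] /=.
  by rewrite scale1r; apply: Q_diag.
by rewrite scale0r (linear0P (sk_lin _ _)) subr0; apply: Q_sk.
Qed.

(** Every z is the {b, b}-component of an element of the span; the witnesses are the matrix parts of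
    brackets of opposite root elements. *)
Let Q_zero z : exists X, Q (skx X + inZ z) /\ model_ok (skx X + inZ z).
Proof.
have ok_lin := @model_ok_lin F I q.
move: z; apply: BB_ind => [|x y|c c'].
- split=> [|l z z' [X [QX oX]] [X' [QX' oX']]].
    exists 0; rewrite (linear0P (@skx_lin F I q)) (linear0P (@inZ_lin F I q)) addr0.
    by split; [exact: clQ.1 | exact: ok_lin.1].
  exists (l *: X + X'); rewrite skx_lin inZ_lin.
  have -> : l *: skx X + skx X' + (l *: inZ z + inZ z') =
    l *: (skx X + inZ z) + (skx X' + inZ z') by lmodule F.
  by split; [exact: clQ.2 | exact: ok_lin.2].
- exists (2^-1 *: (e j0 j0 (x * y) - e k0 k0 (y * x))).
  have -> : skx (2^-1 *: (e j0 j0 (x * y) - e k0 k0 (y * x))) + inZ (pa x y) =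
      2^-1 *: mbr (sk j0 k0 x) (sk k0 j0 y).
    rewrite mbr_sk_opp ?jk0 // !(linE (@skx_lin F I q), linE (@inZ_lin F I q)) -!/(sk _ _ _).
    by lmodulef F.
  have kj : k0 != j0 by rewrite eq_sym far_neq ?jk0.
  split; first by apply: closed_linZ => //; apply: Q_sk_sk jk0.
  apply: closed_linZ => //; apply: (model_ok_mbr nz2); apply: ok_sk => //.
  by rewrite far_neq ?jk0.
- exists (- (2^-1 *: e j0 j0 (f c c'))).
  have -> : skx (- (2^-1 *: e j0 j0 (f c c'))) + inZ (pc c c') =
      (2^-1 * sg j0) *: mbr (vv j0 c) (vv (bar j0) c').
    rewrite mbr_vv_opp !(linE (@skx_lin F I q)) -!/(sk _ _ _) scalerDr scalerN !scalerA.
    by rewrite -(mulrA _ (sg j0)) mulrACA !sg2 mulVf // !mulr1 scale1r.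
  split; first by apply: closed_linZ => //; apply: Q_vv_vv.
  by apply: closed_linZ => //; apply: (model_ok_mbr nz2); apply: ok_vv.
Qed.

Lemma model_ok_ind u : model_ok u -> Q u.
Proof.
move=> ou; have [X [QX oX]] := Q_zero u.2.
have QW w : Q (inW w).
  move: w; apply: VC_ind => [|j c]; last exact: Q_vv.
  split=> [|l w w' Qw Qw']; first by rewrite (linear0P (@inW_lin F I q)); exact: clQ.1.
  by rewrite inW_lin; apply: clQ.2.
(* Removing the element with the same {b, b}-component leaves a skew matrix of trace zero and a
   vector. *)
have [sku _] := ou; pose Z := 2^-1 *: u.1.1 - X.
have uE : u = skx Z + inW u.1.2 + (skx X + inZ u.2).
  rewrite {1}[u]modelE /Z /skx !opE sku !(linE (@inX_lin F I q)); lmodulef F.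
clearbody Z; have oZ : model_ok (skx Z).
  have -> : skx Z = u - inW u.1.2 - (skx X + inZ u.2) by rewrite {1}uE; lmodule F.
  have ok_lin := @model_ok_lin F I q.
  apply: closed_linB => //; apply: closed_linB => //.
  by split; rewrite /= ?opE // oppr0.
have trZ : mtr (Z - tau Z) = 0.
  by have [_] := oZ; rewrite /= (linear0P (@bst_lin F q)).
rewrite uE; apply: closed_linD => //; apply: closed_linD => //.
(* Replacing Z by its skew half does not change [skx Z] and makes the trace correction of [Q_skx]
   vanish. *)
have -> : skx Z = skx (2^-1 *: (Z - tau Z)) - sk j0 j0 (mtr (2^-1 *: (Z - tau Z))).
  rewrite (linearZP (@mtr_lin F I q)) trZ scaler0 (linear0P (sk_lin _ _)) subr0.
  by rewrite !(linE (@skx_lin F I q)) skx_tau; lmodulef F.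
exact: Q_skx.
Qed.
End OkInduction.

(* By the Jacobi identity the elements u for which om u = psi [u, -] form a   *)
(* subalgebra, so it suffices to treat root elements.                         *)
Definition good (u : U) := model_ok u /\
  forall u', model_ok u' -> om u u' = psi (mbr u u').

Lemma good_lin : closed_lin good.
Proof.
have ok_lin := @model_ok_lin F I q.
split; first split=> [|u' _]; first exact: ok_lin.1.
  by rewrite (bil0l om_bil) (bil0l (@mbr_bil F I q)) (linear0P psi_lin).
move=> k u v [ou gu] [ov gv]; split; first exact: ok_lin.2.
move=> u' ou'; rewrite !(bilE om_bil) !(bilE (@mbr_bil F I q)) psi_lin.
by rewrite gu // gv.
Qed.

Lemma good_mbr u v : good u -> good v -> good (mbr u v).
Proof.
move=> [ou gu] [ov gv]; split; first exact: (model_ok_mbr nz2).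
move=> w ow; have ovw := model_ok_mbr nz2 ov ow; have ouw := model_ok_mbr nz2 ou ow.
have -> : om (mbr u v) w = om u (mbr v w) - om v (mbr u w).
  by rewrite om_der // addrK.
rewrite gu // gv // -(linearNP psi_lin) -(linearDP psi_lin); congr psi.
have := mbr_jacobi nz2 ou.1 ov.1 ow.1; rewrite /jac => J.
rewrite (mbr_antisym nz2 w u) (mbr_antisym nz2 w) (bilNr (@mbr_bil F I q)) in J.
by apply: (lin_add J); lmodule F.
Qed.

Lemma mbr_weight p u v s t : model_ok u -> model_ok v ->
  mbr (hh p) u = s *: u -> mbr (hh p) v = t *: v ->
  mbr (hh p) (mbr u v) = (s + t) *: mbr u v.
Proof.
move=> ou ov uE vE; have := mbr_jacobi nz2 (ok_hh q p).1 ou.1 ov.1; rewrite /jac => J.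
rewrite (mbr_antisym nz2 v (hh p)) vE uE (mbr_antisym nz2 v) in J.
rewrite !(bilE (@mbr_bil F I q)) in J.
by apply: (lin_add J); lmodule F.
Qed.

Lemma om_hh_mbr p u v s t : model_ok u -> model_ok v ->
  mbr (hh p) u = s *: u -> mbr (hh p) v = t *: v ->
  om (hh p) (mbr u v) = (s + t) *: om u v.
Proof.
move=> ou ov uE vE; have := om_der (ok_hh q p) ou ov.
by rewrite uE vE !(bilE om_bil) => ->; rewrite scalerDl.
Qed.

(** On root elements this is how psi was chosen; on brackets of opposite root elements both sides
    vanish because the weight is zero. *)
Lemma good_hh p : good (hh p).
Proof.
split; first exact: ok_hh.
apply: model_ok_ind => [|j k x jk|j c|j k x y jk|j c c'].
- apply: closed_lin_eq => l u v; first by rewrite !(bilE om_bil).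
  by rewrite !(bilE (@mbr_bil F I q)) psi_lin.
- by rewrite om_hh_sk // mbr_hh_sk // (linearZP psi_lin).
- by rewrite om_hh_vv mbr_hh_vv (linearZP psi_lin).
- have kj : k != j by rewrite eq_sym far_neq.
  have [E1 E2] := (mbr_hh_sk nz2 p j k x, mbr_hh_sk nz2 p k j y).
  rewrite (om_hh_mbr _ _ E1 E2) ?(mbr_weight _ _ E1 E2); try exact: ok_sk (far_neq jk);
    try exact: ok_sk kj.
  by rewrite (linearZP psi_lin) (_ : _ + _ = 0) ?scale0r //; ring.
- have [E1 E2] := (mbr_hh_vv p j c, mbr_hh_vv p (bar j) c').
  rewrite (om_hh_mbr _ _ E1 E2) ?(mbr_weight _ _ E1 E2); try exact: ok_vv.
  rewrite (linearZP psi_lin) (_ : _ + _ = 0) ?scale0r //.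
  by rewrite /weight !dl_barl barK; ring.
Qed.

(** Compute om(h_p, [u, v]) in two ways: it is (s + t) om(u, v) by the cocycle identity and (s + t)
    psi [u, v] by [good_hh]. *)
Lemma om_weight p u v s t : model_ok u -> model_ok v ->
  mbr (hh p) u = s *: u -> mbr (hh p) v = t *: v -> s + t != 0 ->
  om u v = psi (mbr u v).
Proof.
move=> ou ov uE vE nz; apply: (scalerI nz).
rewrite -(om_hh_mbr ou ov uE vE) (good_hh p).2 ?(mbr_weight ou ov uE vE) ?(linearZP psi_lin) //.
exact: (model_ok_mbr nz2).
Qed.

Lemma om_weight_zero p u v w s : model_ok u -> model_ok v -> model_ok w ->
  s != 0 -> mbr (hh p) u = s *: u ->
  (exists2 t, mbr (hh p) v = t *: v & mbr (hh p) w = - t *: w) ->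
  om u (mbr v w) = psi (mbr u (mbr v w)).
Proof.
move=> ou ov ow nz uE [t vE wE]; apply: (@om_weight p _ _ s 0) => //.
- exact: (model_ok_mbr nz2).
- by rewrite (mbr_weight ov ow vE wE) subrr.
- by rewrite addr0.
Qed.

Lemma wt_self j : wt j j = 1.
Proof. by rewrite /weight dl_self dl_bar subr0. Qed.
Lemma wt_bar j : wt (bar j) j = -1.
Proof. by rewrite /weight !dl_barl barK dl_self dl_bar sub0r. Qed.
Lemma wt_far j k : far j k -> wt j k = 0.
Proof. by move=> jk; rewrite /weight !(far_dl jk) subrr. Qed.

Variant index_spec (j : J) : J -> Prop :=
| IndexSame : index_spec j j
| IndexBar : index_spec j (bar j)
| IndexFar m of far m j : index_spec j m.

Lemma indexP j m : index_spec j m.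
Proof.
have [->|mj] := eqVneq m j; first exact: IndexSame.
have [->|mbj] := eqVneq m (bar j); first exact: IndexBar.
by apply: IndexFar; rewrite /far mj.
Qed.

(** The total weights that occur are 1, 2, 3, -1 and -2; this is where 3 has to be invertible. *)
Ltac weight_tac := match goal with |- is_true (?t != 0) => first
  [ rewrite (_ : t = 1); [exact: oner_neq0 | ring]
  | rewrite (_ : t = 2); [exact: nz2 | ring]
  | rewrite (_ : t = 3); [exact: nz3 | ring]
  | rewrite (_ : t = - 1); [by rewrite oppr_eq0 oner_neq0 | ring]
  | rewrite (_ : t = - 2); [by rewrite oppr_eq0 | ring] ] end.

Lemma om_sk_opp j k x y : far j k ->
  om (sk j k x) (sk k j y) = psi (mbr (sk j k x) (sk k j y)).
Proof.
move=> jk; rewrite mbr_sk_opp // !(linE (@inZ_lin F I q), linE psi_lin) psi_a.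
by rewrite !psi_sk_diag -/(HH j k x y) HHE //; lmodule F.
Qed.

Lemma om_vv_opp j c c' :
  om (vv j c) (vv (bar j) c') = psi (mbr (vv j c) (vv (bar j) c')).
Proof.
rewrite mbr_vv_opp // !(linE (@inZ_lin F I q), linE psi_lin) psi_c psi_sk_diag.
rewrite /gamma -(gam_eq j) /gam.
by lmodule_with F ltac:(field: (sg2 F j)).
Qed.

(** Either h_j or h_k gives a nonzero total weight, and [om_weight] applies, or the second element
    lies in the opposite root space, and [om_sk_opp] applies. *)
Lemma good_sk_far j k x : far j k -> good (sk j k x).
Proof.
move=> jk; have kj : far k j by rewrite far_sym.
have ou := ok_sk x (far_neq jk); split=> //.
have W p v t : model_ok v -> mbr (hh p) v = t *: v -> wt j p - wt k p + t != 0 ->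
    om (sk j k x) v = psi (mbr (sk j k x) v).
  by move=> ov vE; apply: (@om_weight p) => //; exact: mbr_hh_sk.
have Wj v t : model_ok v -> mbr (hh j) v = t *: v -> 1 + t != 0 ->
    om (sk j k x) v = psi (mbr (sk j k x) v).
  by move=> ov vE nz; apply: (W j _ t) => //; rewrite wt_self (wt_far kj) subr0.
have Wk v t : model_ok v -> mbr (hh k) v = t *: v -> - 1 + t != 0 ->
    om (sk j k x) v = psi (mbr (sk j k x) v).
  by move=> ov vE nz; apply: (W k _ t) => //; rewrite wt_self (wt_far jk) sub0r.
apply: model_ok_ind => [|m n y mn|m c|m n z y mn|m c c'].
- apply: closed_lin_eq => l u v; first by rewrite !(bilE om_bil).
  by rewrite !(bilE (@mbr_bil F I q)) psi_lin.
- have oy := ok_sk y mn.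
  have Wmj := Wj _ _ oy (mbr_hh_sk nz2 j m n y).
  have Wmk := Wk _ _ oy (mbr_hh_sk nz2 k m n y).
  have bjk : far (bar j) k by rewrite far_barl.
  case: (indexP j m) mn Wmj Wmk {oy} => [||{}m mj];
    case: (indexP j n) => [||{}n nj] mn Wmj Wmk.
  + by rewrite eqxx in mn.
  + by apply: Wmj; rewrite wt_self wt_bar; weight_tac.
  + by apply: Wmj; rewrite wt_self (wt_far nj); weight_tac.
  + by apply: Wmj; rewrite wt_self wt_bar; weight_tac.
  + by rewrite eqxx in mn.
  + case: (indexP k n) mn Wmj Wmk => [||{nj}n nk] _ _ Wmk.
    * by apply: Wmk; rewrite (wt_far bjk) wt_self; weight_tac.
    (* Up to sign, t_{bar j, bar k}(y) is t_{k,j} of the conjugate of y, hence opposite to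
       t_{j,k}(x). *)
    * rewrite -[y](@qstarK F q) sk_bar !(bilE om_bil) !(bilE (@mbr_bil F I q)).
      by rewrite !(linE psi_lin) om_sk_opp.
    * by apply: Wmk; rewrite (wt_far bjk) (wt_far nk); weight_tac.
  + case: (indexP k m) mn Wmj Wmk => [||{mj}m mk] _ _ Wmk.
    * exact: om_sk_opp.
    * by apply: Wmk; rewrite wt_bar (wt_far jk); weight_tac.
    * by apply: Wmk; rewrite (wt_far mk) (wt_far jk); weight_tac.
  + by apply: Wmj; rewrite wt_bar (wt_far mj); weight_tac.
  + by apply: Wmj; rewrite (wt_far mj) (wt_far nj); weight_tac.
- have Wmj := Wj _ _ (ok_vv m c) (mbr_hh_vv j m c).
  have Wmk := Wk _ _ (ok_vv m c) (mbr_hh_vv k m c).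
  case: (indexP j m) Wmj Wmk => [||{}m mj] Wmj Wmk.
  + by apply: Wmj; rewrite wt_self; weight_tac.
  + by apply: Wmk; rewrite wt_far ?far_barl //; weight_tac.
  + by apply: Wmj; rewrite (wt_far mj); weight_tac.
(* A bracket of opposite root elements has weight zero, while t_{j,k}(x) has weight 1 at h_j. *)
- apply: (@om_weight_zero j _ _ _ (wt j j - wt k j)) => //.
  + by apply: ok_sk; exact: far_neq.
  + by apply: ok_sk; rewrite eq_sym far_neq.
  + by rewrite wt_self (wt_far kj); weight_tac.
  + exact: mbr_hh_sk.
  + exists (wt m j - wt n j); first exact: mbr_hh_sk.
    by rewrite mbr_hh_sk //; lmodule F.
- apply: (@om_weight_zero j _ _ _ (wt j j - wt k j)) => //.
  + exact: ok_vv.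
  + exact: ok_vv.
  + by rewrite wt_self (wt_far kj); weight_tac.
  + exact: mbr_hh_sk.
  + exists (wt m j); first exact: mbr_hh_vv.
    by rewrite mbr_hh_vv /weight !dl_barl barK; lmodule F.
Qed.

Lemma good_vv j c : good (vv j c).
Proof.
have ou := ok_vv j c; split=> //.
have W p v t : model_ok v -> mbr (hh p) v = t *: v -> wt j p + t != 0 ->
    om (vv j c) v = psi (mbr (vv j c) v).
  by move=> ov vE; apply: (@om_weight p) => //; exact: mbr_hh_vv.
have Wj v t : model_ok v -> mbr (hh j) v = t *: v -> 1 + t != 0 ->
    om (vv j c) v = psi (mbr (vv j c) v).
  by move=> ov vE nz; apply: (W j _ t) => //; rewrite wt_self.
apply: model_ok_ind => [|m n y mn|m c'|m n z y mn|m c' c''].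
- apply: closed_lin_eq => l u v; first by rewrite !(bilE om_bil).
  by rewrite !(bilE (@mbr_bil F I q)) psi_lin.
- have oy := ok_sk y mn.
  have Wmj := Wj _ _ oy (mbr_hh_sk nz2 j m n y).
  have Wm := W m _ _ oy (mbr_hh_sk nz2 m m n y).
  have Wn := W n _ _ oy (mbr_hh_sk nz2 n m n y).
  case: (indexP j m) mn Wmj Wm Wn {oy} => [||{}m mj];
    case: (indexP j n) => [||{}n nj] mn Wmj Wm Wn.
  + by rewrite eqxx in mn.
  + by apply: Wmj; rewrite wt_self wt_bar; weight_tac.
  + by apply: Wmj; rewrite wt_self (wt_far nj); weight_tac.
  + by apply: Wmj; rewrite wt_self wt_bar; weight_tac.
  + by rewrite eqxx in mn.
  (* The weights at h_j cancel here, but at h_n only the second element has a nonzero weight. *)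
  + have jn : far j n by rewrite far_sym.
    by apply: Wn; rewrite wt_self !wt_far ?far_barl //; weight_tac.
  + have jm : far j m by rewrite far_sym.
    by apply: Wm; rewrite wt_self !(wt_far jm); weight_tac.
  + by apply: Wmj; rewrite wt_bar (wt_far mj); weight_tac.
  + by apply: Wmj; rewrite (wt_far mj) (wt_far nj); weight_tac.
- have Wmj := Wj _ _ (ok_vv m c') (mbr_hh_vv j m c').
  case: (indexP j m) Wmj => [||{}m mj] Wmj.
  + by apply: Wmj; rewrite wt_self; weight_tac.
  + exact: om_vv_opp.
  + by apply: Wmj; rewrite (wt_far mj); weight_tac.
- apply: (@om_weight_zero j _ _ _ (wt j j)) => //.
  + by apply: ok_sk; exact: far_neq.
  + by apply: ok_sk; rewrite eq_sym far_neq.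
  + by rewrite wt_self oner_neq0.
  + exact: mbr_hh_vv.
  + exists (wt m j - wt n j); first exact: mbr_hh_sk.
    by rewrite mbr_hh_sk //; lmodule F.
- apply: (@om_weight_zero j _ _ _ (wt j j)) => //; try exact: ok_vv.
  + by rewrite wt_self oner_neq0.
  + exact: mbr_hh_vv.
  + exists (wt m j); first exact: mbr_hh_vv.
    by rewrite mbr_hh_vv /weight !dl_barl barK; lmodule F.
Qed.

(** A long root element is the bracket of two far ones through a fresh index. *)
Lemma good_sk j k x : j != k -> good (sk j k x).
Proof.
move=> jk; have [kbj|kbj] := eqVneq k (bar j); last first.
  by apply: good_sk_far; rewrite /far jk -eq_bar eq_sym.
pose m := fresh [:: j].
have mj : far m j by apply: freshP; rewrite inE.
have jm : far j m by rewrite far_sym. have mbj : far m (bar j) by rewrite far_barr.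
have -> : sk j k x = mbr (sk j m x) (sk m (bar j) 1).
  rewrite kbj mbr_sk // barK dl_self (dl_neq (_ : bar j != j)); last first.
    by rewrite eq_sym neq_bar.
  rewrite !(far_dl mj) !(linE (@inZ_lin F I q)) mulr1; lmodule F.
by apply: good_mbr; apply: good_sk_far; rewrite ?far_barr.
Qed.

Theorem cocycle_coboundary u u' : model_ok u -> model_ok u' ->
  om u u' = psi (mbr u u').
Proof.
move=> ou ou'; suff [_ /(_ _ ou')] : good u by [].
apply: model_ok_ind ou => [||||].
- exact: good_lin.
- by move=> *; apply: good_sk.
- by move=> *; apply: good_vv.
- by move=> j k x y jk; apply: good_mbr; apply: good_sk_far; rewrite // far_sym.
- by move=> *; apply: good_mbr; apply: good_vv.
Qed.

End Cocycle.

(** * Operators on V *)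

Section Operators.
Variables (F : fieldType) (I : choiceType).
Local Notation J := (I + I)%type.
Local Notation V := (Vsp F I).
Local Notation E := (V -> V).
Local Notation gl := (glJ F I).
Local Notation elem := (@elem F I).
Local Notation dl := (@kron F I).
Local Notation sg := (@sg F I).
Local Notation bar := (@bar I).
Local Notation form := (@Defs.form F I).

Lemma fun_scaleE (k : F) (phi : E) w : (k *: phi) w = k *: phi w.
Proof. by []. Qed.
Lemma fun_addE (phi psi : E) w : (phi + psi) w = phi w + psi w.
Proof. by []. Qed.
Lemma fun_oppE (phi : E) w : (- phi) w = - phi w.
Proof. by []. Qed.
Definition funE := (fun_scaleE, fun_addE, fun_oppE).

Lemma gl_elem j k : elem j k \in gl.
Proof. by apply: mem_lspan; exists j, k. Qed.

(** Membership is carried along because linearity of [trace] and of [ot] is stated on gl(J). *)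
Lemma gl_ind (P : E -> Prop) : P 0 ->
  (forall k phi psi, phi \in gl -> psi \in gl -> P phi -> P psi ->
     P (k *: phi + psi)) ->
  (forall j k, P (elem j k)) -> forall phi, phi \in gl -> P phi.
Proof.
move=> P0 PD Pe phi /asboolP[s [s_el ->]].
suff [] : P (\sum_(p <- s) p.1 *: p.2) /\ \sum_(p <- s) p.1 *: p.2 \in gl by [].
elim: s s_el => [|p s IHs] s_el; first by rewrite big_nil; split; rewrite ?rpred0.
have [j [k pE]] := s_el p (mem_head _ _).
have [Ps sgl] : P (\sum_(p <- s) p.1 *: p.2) /\ \sum_(p <- s) p.1 *: p.2 \in gl.
  by apply: IHs => p' p's; apply: s_el; rewrite inE p's orbT.
rewrite big_cons pE; split; first by apply: PD => //; exact: gl_elem.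
by rewrite rpredD // rpredZ // gl_elem.
Qed.

Lemma elem_lin j k : linear (elem j k).
Proof. by move=> l u w; rewrite /Defs.elem mcoeffD mcoeffZ scalerDl scalerA. Qed.

Lemma gl_lin phi : phi \in gl -> linear phi.
Proof.
move: phi; apply: gl_ind => [k u w|l phi psi _ _ lphi lpsi k u w|j k].
- by rewrite scaler0 addr0.
- by rewrite !funE lphi lpsi; lmodule F.
- exact: elem_lin.
Qed.

Lemma elemU j k m : elem j k << m >> = dl k m *: << j >> :> V.
Proof. by rewrite /Defs.elem mcoeffU /kron eq_sym. Qed.

Lemma V_ext (phi psi : E) : linear phi -> linear psi ->
  (forall m, phi << m >> = psi << m >>) -> phi = psi.
Proof.
move=> lphi lpsi eqU; apply/funext; apply: malg_ind => //.
exact: closed_lin_eq.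
Qed.

Lemma comp_elem j k m n : elem j k \o elem m n = dl k m *: elem j n.
Proof.
apply/funext => w; rewrite /= fun_scaleE /Defs.elem mcoeffZ mcoeffU /kron eq_sym.
by rewrite scalerA mulrC.
Qed.

Lemma comp0l (phi : E) : (0 : E) \o phi = 0.
Proof. by []. Qed.
Lemma comp0r (phi : E) : linear phi -> phi \o (0 : E) = 0.
Proof. by move=> phiL; apply/funext => w; exact: linear0P phiL. Qed.
Lemma compPl l (phi phi' psi : E) :
  (l *: phi + phi') \o psi = l *: (phi \o psi) + (phi' \o psi).
Proof. by []. Qed.
Lemma compPr l (phi psi psi' : E) : linear phi ->
  phi \o (l *: psi + psi') = l *: (phi \o psi) + (phi \o psi').
Proof. by move=> phiL; apply/funext => w; exact: phiL. Qed.

Lemma gl_comp phi psi : phi \in gl -> psi \in gl -> phi \o psi \in gl.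
Proof.
move=> gphi gpsi; move: phi gphi; apply: gl_ind => [|l phi phi' _ _ gp gp'|j k].
- by rewrite comp0l rpred0.
- by rewrite compPl rpredD ?rpredZ.
have lel := @elem_lin j k.
move: psi gpsi; apply: gl_ind => [|l psi psi' _ _ gp gp'|m n].
- by rewrite comp0r ?rpred0.
- by rewrite compPr // rpredD ?rpredZ.
- by rewrite comp_elem rpredZ // gl_elem.
Qed.

Lemma trace_elem j k : trace (elem j k) = dl j k.
Proof.
rewrite /trace (fsbigTE [fset k]%fset).
  by rewrite big_seq_fset1 elemU dl_self scale1r mcoeffU.
move=> i; rewrite inE => ik; rewrite elemU /kron eq_sym (negPf ik) scale0r.
by rewrite mcoeff0.
Qed.

Lemma trace0 : trace (0 : E) = 0 :> F.
Proof. by rewrite /trace fsbig1 // => j _; rewrite mcoeff0. Qed.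

Lemma traceC phi psi : phi \in gl -> psi \in gl ->
  trace (phi \o psi) = trace (psi \o phi).
Proof.
move=> gphi gpsi; have lpsi := gl_lin gpsi.
have tP l (x y : E) : x \in gl -> y \in gl ->
  trace (l *: x + y) = l * trace x + trace y by exact: trace_linear.
move: phi gphi; apply: gl_ind => [|l phi phi' gp gp' e e'|j k].
- by rewrite comp0l comp0r.
- by rewrite compPl compPr // (tP l _ _ (gl_comp gp gpsi) (gl_comp gp' gpsi))
    (tP l _ _ (gl_comp gpsi gp) (gl_comp gpsi gp')) e e'.
have lel := @elem_lin j k; have gel := gl_elem j k.
move: psi gpsi {lpsi}; apply: gl_ind => [|l psi psi' gp gp' e e'|m n].
- by rewrite comp0l comp0r.
- by rewrite compPl compPr // (tP l _ _ (gl_comp gp gel) (gl_comp gp' gel))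
    (tP l _ _ (gl_comp gel gp) (gl_comp gel gp')) e e'.
have tE l p r : trace (l *: elem p r) = l * dl p r.
  by rewrite -[l *: _]addr0 tP ?rpred0 ?gl_elem // trace_elem trace0 addr0.
apply: (etrans (congr1 (@trace F I) (comp_elem j k m n))).
apply: (etrans (tE _ _ _)); symmetry.
apply: (etrans (congr1 (@trace F I) (comp_elem m n j k))).
by apply: (etrans (tE _ _ _)); rewrite (dlC F n j) (dlC F m k) mulrC.
Qed.

Lemma formU j m : form << j >> << m >> = 2 * sg j * dl m (bar j).
Proof.
rewrite /Defs.form !linextU /kron.
case: j m => j [] m /=; rewrite ?mulr0 //.
  rewrite (_ : (inr m == inr j :> J) = (m == j)) // (eq_sym m).
  by case: (j == m); rewrite /= ?mulr1 ?mulr0.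
rewrite (_ : (inl m == inl j :> J) = (m == j)) // (eq_sym m).
by case: (j == m); rewrite /= ?mulr1 ?mulr0 // mulrN1.
Qed.

Lemma form_bil : bilinear_map (form : V -> V -> F^o).
Proof. by split; [exact: form_linearl | exact: form_linearr]. Qed.

Definition adjoint (phi psi : E) : Prop :=
  forall u w, form (phi u) w = form u (psi w).

(** Pairing with v_{bar j} reads off the coordinate at j; nondegeneracy follows. *)
Lemma form_barU j w : form << bar j >> w = - (2 * sg j * w@_j).
Proof.
move: w; apply: malg_ind => [|m].
  split=> [|k u w uE wE]; first by rewrite Defs.form0r mcoeff0 mulr0 oppr0.
  by rewrite form_linearr uE wE mcoeffD mcoeffZ /GRing.scale /=; ring.
by rewrite formU barK sg_bar mcoeffU /kron; ring.
Qed.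

Hypothesis nz2 : (2 : F) != 0.

Lemma form_nondeg w w' : (forall u, form u w = form u w') -> w = w'.
Proof.
move=> eqf; apply/malgP => j; have := eqf << bar j >>; rewrite !form_barU.
move/oppr_inj/mulfI; apply; rewrite mulf_neq0 //.
by case: j => j /=; rewrite ?oppr_eq0 oner_neq0.
Qed.

Lemma adjoint_uniq phi psi psi' : adjoint phi psi -> adjoint phi psi' -> psi = psi'.
Proof.
by move=> ad ad'; apply/funext => w; apply: form_nondeg => u; rewrite -ad ad'.
Qed.

(** The signs are those of [tau], which is thus the adjoint combined with [star]; see [ot_tau]. *)
Lemma adjoint_elem j k : adjoint (elem j k) ((sg j * sg k) *: elem (bar k) (bar j)).
Proof.
have L : linear ((sg j * sg k) *: elem (bar k) (bar j)).
  by apply: gl_lin; rewrite rpredZ ?gl_elem.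
move=> u w; move: u; apply: malg_ind => [|m].
  apply: (@closed_lin_eq F V F^o) => l u u'; first by rewrite elem_lin form_linearl.
  by rewrite form_linearl.
move: w; apply: malg_ind => [|n].
  apply: (@closed_lin_eq F V F^o) => l u u'; first by rewrite form_linearr.
  exact: etrans (congr1 _ (L l u u')) (Defs.form_linearr _ _ _ _).
rewrite fun_scaleE !elemU !(bilE form_bil) !formU /GRing.scale /=.
rewrite !dl_barl !barK (dl_barC F n j).
ring: (sg2 F m) (sg_dl_eq F k m).
Qed.

End Operators.

(** * Operators of gl(J) tensored with a *)

Section OperatorMatrices.
Variables (F : fieldType) (I : choiceType) (q : quadrupleBC F).
Local Notation J := (I + I)%type.
Local Notation V := (Vsp F I).
Local Notation E := (V -> V).
Local Notation gl := (glJ F I).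
Local Notation elem := (@elem F I).
Local Notation a := (qa q).
Local Notation MA := (MA I q).
Local Notation e := (@mxe F I q).

Local Notation Mat := {malg F[(J * J)%type]}.

Definition mx_op : Mat -> E := linext (fun p => elem p.1 p.2).

Lemma mx_op_lin : linear mx_op. Proof. exact: linext_linear. Qed.

Lemma mx_opE (m : Mat) j k : (mx_op m << k >>)@_j = m@_(j, k).
Proof.
move: m; apply: malg_ind => [|[j' k']].
  apply: (@closed_lin_eq F Mat F^o) => l m m'.
    by rewrite mx_op_lin mcoeffD mcoeffZ.
  by rewrite mcoeffD mcoeffZ.
rewrite /mx_op linextU /= elemU mcoeffZ !mcoeffU /kron -[X in _ = X]/((_ == _)%:R).
by rewrite -[X in _ * X]/((_ == _)%:R) xpair_eqE -natrM mulnb andbC.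
Qed.

Lemma mx_op_inj : injective mx_op.
Proof. by move=> m m' eqm; apply/malgP => -[j k]; rewrite -!mx_opE eqm. Qed.

Lemma mx_op_gl phi : phi \in gl -> exists m, mx_op m = phi.
Proof.
move: phi; apply: gl_ind => [|l phi psi _ _ [m <-] [m' <-]|j k].
- by exists 0; exact: linear0P mx_op_lin.
- by exists (l *: m + m'); rewrite mx_op_lin.
- by exists << (j, k) >>; rewrite /mx_op linextU.
Qed.

(* phi (x) al as a matrix over a, for phi in gl(J).                           *)
Record op_tensor := OpTensor {
  opt :> E -> a -> MA;
  opt_linl : forall l phi psi x, phi \in gl -> psi \in gl ->
    opt (l *: phi + psi) x = l *: opt phi x + opt psi x;
  opt_linr : forall phi, linear (opt phi);
  opt_elem : forall j k x, opt (elem j k) x = e j k x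
}.

Lemma op_tensor_exists : op_tensor.
Proof.
(* The inverse of [mx_op], with the default value 0 outside gl(J). *)
pose mx phi : Mat := if pselect (phi \in gl) is left h then
  projT1 (cid (mx_op_gl h)) else 0.
have mxE phi : phi \in gl -> mx_op (mx phi) = phi.
  by rewrite /mx; case: pselect => // h _; exact: projT2 (cid (mx_op_gl h)).
exists (fun phi x => linext (fun p => e p.1 p.2 x) (mx phi)).
- move=> l phi psi x gphi gpsi; rewrite -linext_linear; congr linext.
  by apply: mx_op_inj; rewrite mx_op_lin !mxE // rpredD ?rpredZ.
- move=> phi l x y; move: (mx phi) => m; rewrite /linext scaler_sumr -big_split /=.
  apply: eq_bigr => p _; rewrite mxe_lin; lmodule F.
- move=> j k x; have -> : mx (elem j k) = << (j, k) >>.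
    by apply: mx_op_inj; rewrite mxE ?gl_elem // /mx_op linextU.
  by rewrite linextU.
Qed.

Definition ot : E -> a -> MA := op_tensor_exists.

Lemma ot_linl l phi psi x : phi \in gl -> psi \in gl ->
  ot (l *: phi + psi) x = l *: ot phi x + ot psi x.
Proof. exact: opt_linl. Qed.
Lemma ot_lin phi : linear (ot phi). Proof. exact: opt_linr. Qed.
Lemma ot_elem j k x : ot (elem j k) x = e j k x. Proof. exact: opt_elem. Qed.

Lemma ot0 x : ot 0 x = 0.
Proof.
have := ot_linl (-1) x (rpred0 (GRing.SubmodClosed.sort gl)) (rpred0 _).
by rewrite scaler0 addr0 scaleN1r addNr.
Qed.
End OperatorMatrices.

(** * The model operations on pure tensors *)

Section OperatorRules.
Variables (F : fieldType) (I : choiceType) (q : quadrupleBC F).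
Hypothesis nz2 : (2 : F) != 0.
Local Notation J := (I + I)%type.
Local Notation V := (Vsp F I).
Local Notation E := (V -> V).
Local Notation gl := (glJ F I).
Local Notation elem := (@elem F I).
Local Notation dl := (@kron F I).
Local Notation sg := (@sg F I).
Local Notation bar := (@bar I).
Local Notation form := (@Defs.form F I).
Local Notation adjoint := (@adjoint F I).
Local Notation a := (qa q).
Local Notation C := (qC q).
Local Notation star := (qstar q).
Local Notation act := (qact (q := q)).
Local Notation f := (qf (q := q)).
Local Notation MA := (MA I q).
Local Notation VC := (VC I q).
Local Notation e := (@mxe F I q).
Local Notation v := (@vce F I q).

Local Notation ot := (@ot F I q).
Local Notation mxm := (@mxm F I q).

(** Links V (x) C in the model with the tensor product in L(q, K), sealed like [based_tensor]. *)
Record vec_tensor := VecTensor {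
  vt :> V -> C -> VC;
  vt_bil : bilinear_map vt;
  vtU : forall j c, vt << j >> c = v j c;
  vt_to : VC -> tensor V C;
  vt_to_linear : linear vt_to;
  vt_toE : forall u c, vt_to (vt u c) = tens u c;
  vt_of : tensor V C -> VC;
  vt_of_linear : linear vt_of;
  vt_ofE : forall u c, vt_of (tens u c) = vt u c;
  vt_toK : cancel vt_to vt_of;
  vt_ofK : cancel vt_of vt_to
}.

Lemma vec_tensor_exists : vec_tensor.
Proof.
pose of_ := @btensor_of F J C; pose to_ := @btensor_to F J C.
have ofL : linear of_ by exact: btensor_of_linear.
have bilV : bilinear_map (fun (u : V) c => of_ (tens u c)).
  by split=> [c|u] k x y; rewrite -ofL; congr of_; [exact: tens_linearl|exact: tens_linearr].
exact: (@VecTensor _ bilV (@btensor_ofE _ _ _) to_ (@btensor_to_linear _ _ _)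
  (fun u c => btensor_ofK (tens u c)) of_ ofL (fun _ _ => erefl)
  (@btensor_toK _ _ _) (@btensor_ofK _ _ _)).
Qed.

Definition vt0 : V -> C -> VC := vec_tensor_exists.
Definition vt0_bil : bilinear_map vt0 := vt_bil _.
Definition vt0U : forall j c, vt0 << j >> c = v j c := vtU _.
Definition vc_to : VC -> tensor V C := vt_to vec_tensor_exists.
Definition vc_to_linear : linear vc_to := @vt_to_linear _.
Definition vc_toE : forall u c, vc_to (vt0 u c) = tens u c := @vt_toE _.
Definition vc_of : tensor V C -> VC := vt_of vec_tensor_exists.
Definition vc_of_linear : linear vc_of := @vt_of_linear _.
Definition vc_ofE : forall u c, vc_of (tens u c) = vt0 u c := @vt_ofE _.
Definition vc_toK : cancel vc_to vc_of := @vt_toK _.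
Definition vc_ofK : cancel vc_of vc_to := @vt_ofK _.

Lemma ot_mul phi psi x y : phi \in gl -> psi \in gl ->
  mxm (ot phi x) (ot psi y) = ot (phi \o psi) (x * y).
Proof.
move=> gphi gpsi; have lpsi := gl_lin gpsi.
move: phi gphi; apply: gl_ind => [|l phi phi' gp gp' e1 e2|j k].
- by rewrite comp0l !ot0 (bil0l (@mxm_bil F I q)).
- rewrite compPl (ot_linl l x gp gp').
  rewrite (ot_linl l (x * y) (gl_comp gp gpsi) (gl_comp gp' gpsi)).
  by rewrite (bilDl (@mxm_bil F I q)) (bilZl (@mxm_bil F I q)) e1 e2.
have lel := @elem_lin F I j k; have gel := gl_elem F j k.
move: psi gpsi {lpsi}; apply: gl_ind => [|l psi psi' gp gp' e1 e2|m n].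
- by rewrite comp0r // !ot0 (bil0r (@mxm_bil F I q)).
- rewrite compPr // (ot_linl l y gp gp').
  rewrite (ot_linl l (x * y) (gl_comp gel gp) (gl_comp gel gp')).
  by rewrite (bilDr (@mxm_bil F I q)) (bilZr (@mxm_bil F I q)) e1 e2.
rewrite comp_elem -[dl k m *: elem j n]addr0 ot_linl ?rpred0 ?gl_elem //.
by rewrite ot0 addr0 !ot_elem mxmE.
Qed.

Lemma trace_lin k (phi psi : E) : phi \in gl -> psi \in gl ->
  trace (k *: phi + psi) = k * trace phi + trace psi.
Proof. exact: trace_linear. Qed.

Lemma ot_mtr phi x : phi \in gl -> mtr (ot phi x) = trace phi *: x.
Proof.
move: phi; apply: gl_ind => [|l phi phi' gp gp' e1 e2|j k].
- by rewrite ot0 (linear0P (@mtr_lin F I q)) trace0 scale0r.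
- rewrite ot_linl // mtr_lin e1 e2 trace_lin //; lmodule F.
- by rewrite ot_elem mtrE trace_elem.
Qed.

Lemma ot_tpair phi psi x y : phi \in gl -> psi \in gl ->
  tpair (ot phi x) (ot psi y) = trace (phi \o psi) *: pa x y.
Proof.
move=> gphi gpsi; have lpsi := gl_lin gpsi; have tB := @tpair_bil F I q.
move: phi gphi; apply: gl_ind => [|l phi phi' gp gp' e1 e2|j k].
- by rewrite comp0l ot0 (bil0l tB) trace0 scale0r.
- rewrite compPl (ot_linl l x gp gp') (bilDl tB) (bilZl tB) e1 e2.
  rewrite (trace_lin l (gl_comp gp gpsi) (gl_comp gp' gpsi)); lmodule F.
have lel := @elem_lin F I j k; have gel := gl_elem F j k.
move: psi gpsi {lpsi}; apply: gl_ind => [|l psi psi' gp gp' e1 e2|m n].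
- by rewrite comp0r // ot0 (bil0r tB) trace0 scale0r.
- rewrite compPr // (ot_linl l y gp gp') (bilDr tB) (bilZr tB) e1 e2.
  rewrite (trace_lin l (gl_comp gel gp) (gl_comp gel gp')); lmodule F.
rewrite comp_elem -[dl k m *: elem j n]addr0 trace_lin ?rpred0 ?gl_elem //.
by rewrite trace_elem trace0 addr0 !ot_elem tpairE (dlC F n j).
Qed.

Lemma ot_tau phi psi x : phi \in gl -> psi \in gl -> adjoint phi psi ->
  tau (ot phi x) = ot psi (star x).
Proof.
move=> gphi gpsi ad.
(* Adjoints are unique, so it suffices to construct one with the property, by induction on phi. *)
suff [psi' gpsi' [ad' tE]] : exists2 psi', psi' \in gl &
    adjoint phi psi' /\ tau (ot phi x) = ot psi' (star x).
  by rewrite tE (adjoint_uniq nz2 ad ad').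
have tL := @tau_lin F I q.
move: phi gphi {gpsi ad psi}; apply: gl_ind => [|l phi phi' gp gp'
    [psi gpsi [ad tE]] [psi' gpsi' [ad' tE']]|j k].
- exists 0; rewrite ?rpred0 // !ot0 (linear0P tL); split=> // u w.
  by rewrite [LHS]Defs.form0l [RHS]Defs.form0r.
- exists (l *: psi + psi'); first by rewrite rpredD ?rpredZ.
  rewrite !ot_linl // tL tE tE'; split=> // u w.
  by rewrite !funE [LHS]Defs.form_linearl [RHS]Defs.form_linearr ad ad'.
- exists ((sg j * sg k) *: elem (bar k) (bar j)); first by rewrite rpredZ ?gl_elem.
  split; first exact: adjoint_elem.
  rewrite ot_elem tauE -[_ *: elem _ _]addr0 ot_linl ?rpred0 ?gl_elem //.
  by rewrite ot0 addr0 ot_elem.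
Qed.

Lemma ot_act phi x u c : phi \in gl ->
  mact (ot phi x) (vt0 u c) = vt0 (phi u) (act x c).
Proof.
have aB := @mact_bil F I q; have vB := vt0_bil.
move: phi; apply: gl_ind => [|l phi phi' gp gp' e1 e2|j k].
- by rewrite ot0 (bil0l aB) [RHS](bil0l vB).
- by rewrite ot_linl // (bilDl aB) (bilZl aB) e1 e2 funE fun_scaleE (bilDl vB) (bilZl vB).
move: u; apply: malg_ind => [|m].
  split=> [|l u w e1 e2].
    by rewrite (bil0l vB) (bil0r aB) (linear0P (@elem_lin F I j k)) (bil0l vB).
  by rewrite elem_lin !(bilDl vB, bilZl vB l) !(bilDr aB, bilZr aB l) e1 e2.
by rewrite elemU (bilZl vB) !vt0U ot_elem mactE.
Qed.

Lemma vt_zact z u c : zact z (vt0 u c) = vt0 u (d0 z c).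
Proof.
have zB := @zact_bil F I q; have vB := vt0_bil.
move: u; apply: malg_ind => [|m]; last by rewrite !vt0U zactE.
split=> [|l u w e1 e2]; first by rewrite !(bil0l vB) (bil0r zB).
by rewrite !(bilDl vB, bilZl vB) !(bilDr zB, bilZr zB) e1 e2.
Qed.

Lemma vt_wpair u c w c' : wpair (vt0 u c) (vt0 w c') = form u w *: pc c c'.
Proof.
have wB := @wpair_bil F I q; have vB := vt0_bil.
move: u; apply: malg_ind => [|j].
  split=> [|l u u' e1 e2].
    by rewrite (bil0l vB) (bil0l wB) Defs.form0l scale0r.
  rewrite !(bilDl vB, bilZl vB) !(bilDl wB, bilZl wB) e1 e2 Defs.form_linearl.
  by rewrite scalerDl scalerA.
move: w; apply: malg_ind => [|m]; last by rewrite !vt0U wpairE formU.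
split=> [|l u u' e1 e2].
  by rewrite (bil0l vB) (bil0r wB) Defs.form0r scale0r.
rewrite !(bilDl vB, bilZl vB) !(bilDr wB, bilZr wB) e1 e2 Defs.form_linearr.
by rewrite scalerDl scalerA.
Qed.

Lemma otD phi psi x : phi \in gl -> psi \in gl ->
  ot (phi + psi) x = ot phi x + ot psi x.
Proof. by move=> gphi gpsi; rewrite -{1}[phi]scale1r ot_linl // scale1r. Qed.

Lemma otZ k phi x : phi \in gl -> ot (k *: phi) x = k *: ot phi x.
Proof. by move=> gphi; rewrite -[k *: phi]addr0 ot_linl ?rpred0 // ot0 addr0. Qed.

Lemma otN phi x : phi \in gl -> ot (- phi) x = - ot phi x.
Proof. by move=> gphi; rewrite -[- phi]scaleN1r otZ // scaleN1r. Qed.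

Lemma adjoint_comp phi phi' psi psi' : adjoint phi phi' -> adjoint psi psi' ->
  adjoint (phi \o psi) (psi' \o phi').
Proof. by move=> ad ad' u w; rewrite /= ad ad'. Qed.

Lemma adjointP2 k phi phi' psi psi' : adjoint phi phi' -> adjoint psi psi' ->
  adjoint (k *: phi + psi) (k *: phi' + psi').
Proof.
move=> ad ad' u w; rewrite !funE [LHS]Defs.form_linearl [RHS]Defs.form_linearr.
by rewrite ad ad'.
Qed.

Lemma form_antisym (u w : V) : form w u = - form u w.
Proof.
move: u; apply: malg_ind => [|j].
  split=> [|l u u' e1 e2]; first by rewrite Defs.form0l Defs.form0r oppr0.
  by rewrite Defs.form_linearr Defs.form_linearl e1 e2 opprD scalerN.
move: w; apply: malg_ind => [|m]; last by rewrite !formU -!mulrA sg_dl_bar mulrN.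
split=> [|l u u' e1 e2]; first by rewrite Defs.form0l Defs.form0r oppr0.
by rewrite Defs.form_linearr Defs.form_linearl e1 e2 opprD scalerN.
Qed.

Definition dyad (u w : V) : E := fun t => form w t *: u.

Lemma dyad_bil : bilinear_map dyad.
Proof.
split=> [w|u] k x y; apply/funext => t; rewrite !funE /dyad.
  by lmodule F.
by rewrite Defs.form_linearl scalerDl scalerA.
Qed.

Lemma dyadU j m : dyad << j >> << m >> = (2 * sg m) *: elem j (bar m).
Proof.
apply/funext => t; rewrite fun_scaleE /dyad /Defs.elem scalerA; congr (_ *: _).
by rewrite -{1}[m]barK form_barU sg_bar mulrN mulNr opprK.
Qed.

Lemma gl_dyad u w : dyad u w \in gl.
Proof.
move: u; apply: malg_ind => [|j].
  split=> [|l u u' g1 g2]; first by rewrite (bil0l dyad_bil) rpred0.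
  by rewrite dyad_bil.1 rpredD ?rpredZ.
move: w; apply: malg_ind => [|m]; last by rewrite dyadU rpredZ ?gl_elem.
split=> [|l u u' g1 g2]; first by rewrite (bil0r dyad_bil) rpred0.
by rewrite dyad_bil.2 rpredD ?rpredZ.
Qed.

Lemma trace_dyad u w : trace (dyad u w) = form w u.
Proof.
move: u; apply: malg_ind => [|j].
  split=> [|l u u' e1 e2]; first by rewrite (bil0l dyad_bil) trace0 Defs.form0r.
  by rewrite dyad_bil.1 trace_lin ?gl_dyad // e1 e2 Defs.form_linearr.
move: w; apply: malg_ind => [|m].
  split=> [|l u u' e1 e2]; first by rewrite (bil0r dyad_bil) trace0 Defs.form0l.
  by rewrite dyad_bil.2 trace_lin ?gl_dyad // e1 e2 Defs.form_linearl.
rewrite dyadU -[_ *: elem _ _]addr0 trace_lin ?rpred0 ?gl_elem // trace0 addr0.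
by rewrite trace_elem formU.
Qed.

Lemma adjoint_dyad u w : adjoint (dyad u w) (- dyad w u).
Proof.
move=> t s; rewrite fun_oppE /dyad (bilZl (@form_bil F I)) (bilNr (@form_bil F I)).
by rewrite (bilZr (@form_bil F I)) (form_antisym t) /GRing.scale /=; ring.
Qed.

(** The operator [vcomm] without its multiple of I_0, which only serves to make the trace zero. *)
Definition wedge (u w : V) : E := 2^-1 *: (dyad u w - dyad w u).

Lemma vcircE u w : vcirc u w = 2^-1 *: (dyad u w + dyad w u).
Proof. by []. Qed.

Lemma gl_wedge u w : wedge u w \in gl.
Proof. by rewrite rpredZ // rpredB ?gl_dyad. Qed.

Lemma gl_vcirc u w : vcirc u w \in gl.
Proof. by rewrite vcircE rpredZ // rpredD ?gl_dyad. Qed.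

Lemma adjoint_vcirc u w : adjoint (vcirc u w) (- vcirc u w).
Proof.
have ad := adjointP2 1 (adjoint_dyad u w) (adjoint_dyad w u).
have := adjointP2 2^-1 ad (_ : adjoint 0 0); rewrite vcircE !scale1r !addr0.
rewrite -scalerN opprD [- _ - _]addrC; apply=> t s.
by rewrite [LHS]Defs.form0l [RHS]Defs.form0r.
Qed.

Lemma adjoint_wedge u w : adjoint (wedge u w) (wedge u w).
Proof.
have ad := adjointP2 (-1) (adjoint_dyad w u) (adjoint_dyad u w).
have := adjointP2 2^-1 ad (_ : adjoint 0 0); rewrite /wedge !scaleN1r !addr0 opprK.
rewrite [- dyad w u + _]addrC; apply=> t s.
by rewrite [LHS]Defs.form0l [RHS]Defs.form0r.
Qed.

Lemma trace_wedge u w : trace (wedge u w) = - form u w.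
Proof.
rewrite /wedge -[_ *: _]addr0 trace_lin ?rpred0 ?rpredB ?gl_dyad // trace0 addr0.
rewrite -scaleN1r addrC trace_lin ?gl_dyad // !trace_dyad (form_antisym u w).
by field.
Qed.

(** Write f(c, c') as diamond plus heart and f(c', c) as heart minus diamond; the symmetric and
    antisymmetric dyads separate. *)
Lemma cross_vt0 u c w c' : cross (vt0 u c) (vt0 w c') =
  ot (vcirc u w) (diamond c c') + ot (wedge u w) (heart c c').
Proof.
transitivity (2^-1 *: (ot (dyad u w) (f c c') - ot (dyad w u) (f c' c))); last first.
  rewrite vcircE /wedge !otZ ?rpredD ?rpredN ?gl_dyad // !otD ?rpredN ?gl_dyad //.
  rewrite !otN ?gl_dyad // /diamond /heart !(linE (ot_lin _)); lmodulef F.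
have cB := @cross_bil F I q; have vB := vt0_bil; have dB := dyad_bil.
move: u; apply: malg_ind => [|j].
  split=> [|l u u' e1 e2].
    by rewrite (bil0l vB) (bil0l cB) (bil0l dB) (bil0r dB) !ot0 subrr scaler0.
  rewrite !(bilDl vB, bilZl vB) !(bilDl cB, bilZl cB) e1 e2 dB.1 dB.2.
  by rewrite !ot_linl ?gl_dyad //; lmodule F.
move: w; apply: malg_ind => [|m].
  split=> [|l u u' e1 e2].
    by rewrite (bil0l vB) (bil0r cB) (bil0l dB) (bil0r dB) !ot0 subrr scaler0.
  rewrite !(bilDl vB, bilZl vB) !(bilDr cB, bilZr cB) e1 e2 dB.1 dB.2.
  by rewrite !ot_linl ?gl_dyad //; lmodule F.
have E k p y : ot (dyad << k >> << p >>) y = (2 * sg p) *: e k (bar p) y.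
  by rewrite dyadU otZ ?gl_elem // ot_elem.
rewrite (vt0U j) (vt0U m) crossE.
apply: (etrans _ (congr2 (fun x y => 2^-1 *: (x - y)) (esym (E j m _))
  (esym (E m j _)))); lmodulef F.
Qed.

Variables (l : nat) (I0 : {fset I}).
Local Notation I0op := (idI0 I0 : E).

Lemma idI0_sum : I0op = \sum_(i <- I0) (elem (inl i) (inl i) + elem (inr i) (inr i)).
Proof.
apply: V_ext => [||m]; first exact: linext_linear.
  by apply: gl_lin; rewrite rpred_sum // => i _; rewrite rpredD ?gl_elem.
rewrite /idI0 linextU fct_sumE.
rewrite (eq_bigr (fun i => if base m == i then << m >> else 0)); last first.
  move=> i _; rewrite funE !elemU /kron; case: m => m.
    rewrite -[inl i == _]/(i == m) -[inr i == _]/false scale0r addr0 eq_sym /=.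
    by case: eqVneq => [->|]; rewrite ?scale1r ?scale0r.
  rewrite -[inl i == _]/false -[inr i == _]/(i == m) scale0r add0r eq_sym /=.
  by case: eqVneq => [->|]; rewrite ?scale1r ?scale0r.
case: ifP => mI; last first.
  rewrite big1_seq // => i /andP[_ iI].
  by case: eqP => // mi; rewrite mi iI in mI.
rewrite (big_rem (base m)) //= eqxx big1_seq ?addr0 // => i /andP[_].
rewrite mem_rem_uniq ?fset_uniq // inE eq_sym => /andP[/negPf ->] //.
Qed.

Lemma gl_idI0 : I0op \in gl.
Proof. by rewrite idI0_sum rpred_sum // => i _; rewrite rpredD ?gl_elem. Qed.

Lemma adjoint_idI0 : adjoint I0op I0op.
Proof.
have lI := gl_lin gl_idI0.
move=> u w; move: u; apply: malg_ind => [|j].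
  apply: (@closed_lin_eq F V F^o) => k u u'; last by rewrite form_linearl.
  by rewrite lI form_linearl.
move: w; apply: malg_ind => [|m].
  apply: (@closed_lin_eq F V F^o) => k u u'; first by rewrite form_linearr.
  by rewrite lI form_linearr.
rewrite /idI0 !linextU.
have [jm|jm] := eqVneq m (bar j).
  by rewrite jm; case: j {jm} => j /=; case: ifP; rewrite ?Defs.form0l ?Defs.form0r.
have f0 : form << j >> << m >> = 0.
  by rewrite formU /kron (negPf jm) mulr0.
by case: ifP; case: ifP; rewrite ?f0 ?Defs.form0l ?Defs.form0r.
Qed.

Lemma idI0_idem : I0op \o I0op = I0op.
Proof.
have lI := gl_lin gl_idI0.
apply: V_ext => // [k u w|m] /=; first by rewrite !lI.
rewrite {2 3}/idI0 linextU; case: ifP => mI; last exact: linear0P lI.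
by rewrite /idI0 linextU mI.
Qed.

Lemma trace_idI0 : trace I0op = (2 * #|` I0|)%:R.
Proof.
have tD (x y : E) : x \in gl -> y \in gl -> trace (x + y) = trace x + trace y.
  by move=> gx gy; rewrite -{1}[x]scale1r trace_lin // mul1r.
rewrite idI0_sum -[#|` I0|]/(size I0); move: (I0 : seq I) => s.
elim: s => [|i s IHs]; first by rewrite big_nil trace0 muln0.
have gE k : elem (inl k) (inl k) + elem (inr k) (inr k) \in gl by rewrite rpredD ?gl_elem.
have gS : \sum_(k <- s) (elem (inl k) (inl k) + elem (inr k) (inr k)) \in gl.
  by rewrite rpred_sum.
rewrite big_cons (tD _ _ (gE i) gS) IHs.
rewrite (tD _ _ (gl_elem F _ _) (gl_elem F _ _)).
rewrite (trace_elem F (inl i) (inl i)) (trace_elem F (inr i) (inr i)) !dl_self.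
by rewrite /= mulnS natrD.
Qed.

End OperatorRules.

(** * Realization of L(q, K) *)

(** A linear map is the lift of its own values on pure tensors; this evaluates the lifts inside
    [generator_lift]. *)
Lemma tlift_id (F : fieldType) (U W X : lmodType F) (h : tensor U W -> X) : linear h ->
  tlift (fun u w => h (tens u w)) =1 h.
Proof.
move=> hL; have hl w : linear (fun u => h (tens u w)).
  by move=> k u u'; rewrite tens_linearl hL.
have hr u : linear (fun w => h (tens u w)).
  by move=> k w w'; rewrite tens_linearr hL.
apply: (@tensor_ind F U W) => [|u w].
  by apply: closed_lin_eq => //; apply: tlift_linear.
exact: tlift_tens.
Qed.

Lemma insubd_lin (F : fieldType) (U : lmodType F) (S : submodClosed U)
(k : F) (x y : U) : x \in S -> y \in S ->
  insubd (0 : subspace S) (k *: x + y) =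
  k *: insubd (0 : subspace S) x + insubd (0 : subspace S) y.
Proof.
move=> Sx Sy; have Sxy : k *: x + y \in S by rewrite rpredD ?rpredZ.
apply: val_inj; rewrite val_insubd Sxy linearP /=.
by rewrite !val_insubd Sx Sy.
Qed.

(** * Pure tensors of subspaces and the summands of L(q, K) *)

Section SubspaceTensors.
Variables (F : fieldType) (U W : lmodType F) (S : submodClosed U) (T : submodClosed W).
Local Notation ST := (tensor (subspace S) (subspace T)).

(* Sealed, so that distinct pure tensors are never compared by conversion.    *)
Record pure_tensors := PureTensors {
  pt :> U -> W -> ST;
  ptE : forall x y, pt x y = tens (insubd (0 : subspace S) x) (insubd (0 : subspace T) y)
}.

Lemma pure_tensors_exist : pure_tensors.
Proof. by eexists. Qed.

Definition ptens : U -> W -> ST := pure_tensors_exist.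
Definition ptensE : forall x y, ptens x y = tens (insubd (0 : subspace S) x)
  (insubd (0 : subspace T) y) := ptE _.

Lemma ptens_linl k x x' y : x \in S -> x' \in S ->
  ptens (k *: x + x') y = k *: ptens x y + ptens x' y.
Proof. by move=> Sx Sx'; rewrite !ptensE insubd_lin // tens_linearl. Qed.

Lemma ptens_linr k x y y' : y \in T -> y' \in T ->
  ptens x (k *: y + y') = k *: ptens x y + ptens x y'.
Proof. by move=> Ty Ty'; rewrite !ptensE (insubd_lin k Ty Ty') tens_linearr. Qed.

Lemma tens_val u w : tens u w = ptens (val u) (val w) :> ST.
Proof. by rewrite ptensE !valKd. Qed.

Lemma ptens_ind (P : ST -> Prop) : closed_lin P ->
  (forall x y, x \in S -> y \in T -> P (ptens x y)) -> forall t, P t.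
Proof.
move=> clP Pt; apply: tensor_ind => // u w; rewrite tens_val.
by apply: Pt; exact: valP.
Qed.

Section PureLift.
Variables (X : lmodType F) (h : U -> W -> X).
Hypothesis hl : forall k x x' y, x \in S -> x' \in S ->
  h (k *: x + x') y = k *: h x y + h x' y.
Hypothesis hr : forall x, linear (h x).

Let hvl (w : subspace T) : linear (fun u : subspace S => h (val u) (val w)).
Proof. by move=> k u u'; rewrite linearP hl //; exact: valP. Qed.
Let hvr (u : subspace S) : linear (fun w : subspace T => h (val u) (val w)).
Proof. by move=> k w w'; rewrite linearP hr. Qed.

Definition plift (t : ST) : X := tlift (fun u w => h (val u) (val w)) t.

Lemma plift_linear : linear plift.
Proof. exact: tlift_linear. Qed.

Lemma pliftE x y : x \in S -> y \in T -> plift (ptens x y) = h x y.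
Proof.
move=> Sx Ty; rewrite ptensE /plift.
apply: (etrans (tlift_tens hvl hvr _ _)).
by rewrite !val_insubd Sx Ty.
Qed.

End PureLift.

Lemma plift_id (X : lmodType F) (m : U -> W -> X) (h : ST -> X) : linear h ->
  (forall x y, x \in S -> y \in T -> m x y = h (ptens x y)) -> plift m =1 h.
Proof.
move=> hL mE t; rewrite -[RHS](tlift_id hL) /plift; congr tlift.
by apply/funext => u; apply/funext => w; rewrite mE ?tens_val //; exact: valP.
Qed.

End SubspaceTensors.
Arguments ptens {F U W S T} x y.

Section Realization.
Variables (F : fieldType) (I : choiceType) (q : quadrupleBC F).
Variable K : submodClosed (bbracket q).
Local Notation V := (Vsp F I).
Local Notation E := (V -> V).
Local Notation a := (qa q).
Local Notation VC := (VC I q).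
Local Notation BB := (BB q).
Local Notation L := (LqK I K).
Local Notation sp := (spI F I).
Local Notation sym := (symI F I).
Local Notation Fx := (fixed q).
Local Notation Sk := (Defs.skew q).

Local Notation GA := (tensor (subspace sp) (subspace Fx)).
Local Notation SB := (tensor (subspace sym) (subspace Sk)).

Definition bbc (z : BB) : quotient K := qclass K (bb_to z).

Lemma bbc_lin : linear bbc.
Proof. by move=> k z z'; rewrite /bbc bb_to_linear linearP. Qed.

(* Sealed copies of inGA, inSB and of the last two summands of L(q, K).      *)
Record embeddings := Embeddings {
  gA : E -> a -> L;
  sB : E -> a -> L;
  vC : VC -> L;
  bB : BB -> L;
  gAE : forall x al, gA x al = inGA K x al;
  sBE : forall s be, sB s be = inSB K s be;
  vCE : forall w, vC w = (0, 0, vc_to w, 0);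
  bBE : forall z, bB z = (0, 0, 0, bbc z)
}.

Lemma embeddings_exist : embeddings.
Proof. by eexists. Qed.

Definition L_ga : E -> a -> L := gA embeddings_exist.
Local Notation Lga := L_ga.
Definition L_sb : E -> a -> L := sB embeddings_exist.
Local Notation Lsb := L_sb.
Definition Lvc : VC -> L := vC embeddings_exist.
Definition Lbb : BB -> L := bB embeddings_exist.

Lemma L_eq (X Y : L) : X.1.1.1 = Y.1.1.1 -> X.1.1.2 = Y.1.1.2 -> X.1.2 = Y.1.2 ->
  X.2 = Y.2 -> X = Y.
Proof. by case: X Y => [[[? ?] ?] ?] [[[? ?] ?] ?] /= -> -> -> ->. Qed.

Lemma LgaE x al : Lga x al = (ptens x al : GA, 0, 0, 0).
Proof. by rewrite /Lga gAE ptensE. Qed.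
Lemma LsbE x al : Lsb x al = ((0, ptens x al : SB, 0, 0) : L).
Proof. by rewrite /Lsb sBE ptensE. Qed.
Lemma LvcE w : Lvc w = (0, 0, vc_to w, 0).
Proof. exact: vCE. Qed.
Lemma LbbE z : Lbb z = (0, 0, 0, bbc z).
Proof. exact: bBE. Qed.

Lemma Lvc_lin : linear Lvc.
Proof.
move=> k w w'; apply: L_eq; rewrite !LvcE /= ?vc_to_linear //;
by rewrite scaler0 addr0.
Qed.
Lemma Lbb_lin : linear Lbb.
Proof.
move=> k w w'; apply: L_eq; rewrite !LbbE /= ?bbc_lin //;
by rewrite scaler0 addr0.
Qed.

Lemma Lga_linl k x y al : x \in sp -> y \in sp ->
  Lga (k *: x + y) al = k *: Lga x al + Lga y al.
Proof.
move=> sx sy; apply: L_eq; rewrite !LgaE /= ?ptens_linl //;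
by rewrite scaler0 addr0.
Qed.
Lemma Lga_linr k x al al' : al \in Fx -> al' \in Fx ->
  Lga x (k *: al + al') = k *: Lga x al + Lga x al'.
Proof.
move=> sx sy; apply: L_eq; rewrite !LgaE /= ?ptens_linr //;
by rewrite scaler0 addr0.
Qed.
Lemma Lsb_linl k x y al : x \in sym -> y \in sym ->
  Lsb (k *: x + y) al = k *: Lsb x al + Lsb y al.
Proof.
move=> sx sy; apply: L_eq; rewrite !LsbE /= ?ptens_linl //;
by rewrite scaler0 addr0.
Qed.
Lemma Lsb_linr k x al al' : al \in Sk -> al' \in Sk ->
  Lsb x (k *: al + al') = k *: Lsb x al + Lsb x al'.
Proof.
move=> sx sy; apply: L_eq; rewrite !LsbE /= ?ptens_linr //;
by rewrite scaler0 addr0.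
Qed.

End Realization.

(** * The bracket of {b, b} in terms of beta^* and [d0] *)

Section Derivations.
Variables (F : fieldType) (q : quadrupleBC F) (l : nat).
Hypothesis nz2 : (2 : F) != 0.
Hypothesis nzl : (l%:R : F) != 0.
Local Notation a := (qa q).
Local Notation star := (qstar q).
Local Notation act := (qact (q := q)).
Local Notation f := (qf (q := q)).

Definition bsum (b1 b2 : Defs.coord q) : BB q := pa b1.1 b2.1 + pc b1.2 b2.2.

Lemma bst_bsum b1 b2 : bst (bsum b1 b2) = bstar b1 b2.
Proof. by rewrite -bst_bstar // bb_of_bpair. Qed.

Lemma d0_bsum b1 b2 c : d0 (bsum b1 b2) c = d0_c c b1.2 b2.2.
Proof. by rewrite (bilDl (d0_bil q)) d0_a d0_pc add0r. Qed.

(** The commutators of x, y and of their conjugates add up to twice the skew part of xy - yx, so all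
    multiplication terms combine into beta^* over 2l. *)
Lemma derE (b1 b2 b : Defs.coord q) : let z := bsum b1 b2 in
  let x : a := (2 * l)%:R^-1 *: bst z in
  der l b1 b2 b = (acomm x b.1, act x b.2 + d0 z b.2).
Proof.
move=> z x; have nz4 : (4 : F) != 0 by rewrite (natrM F 2 2) mulf_neq0.
have xE : x = (4 * l)%:R^-1 *: (acomm b1.1 b2.1 + acomm (star b1.1) (star b2.1))
    - (2 * l)%:R^-1 *: heart b1.2 b2.2.
  rewrite /x /z bst_bsum /bstar /acomm /fixed_part /skew_part !algE !natrM.
  by lmodule_with F ltac:(by [] || ring || by field; rewrite nzl nz2 nz4).
rewrite [LHS]surjective_pairing /der /der_a /der_C; congr pair; rewrite /= xE.
  by rewrite /acomm !algE; lmodule F.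
rewrite /z d0_bsum /d0_c.
by rewrite !(bilDl (act_bil q)) !(bilNl (act_bil q)); lmodule F.
Qed.

Lemma pa_acomm (x y z : a) : pa (acomm x y) z + pa y (acomm x z) = pa x (acomm y z).
Proof.
rewrite /acomm !(bilDl (pa_bil q), bilDr (pa_bil q), bilNl (pa_bil q), bilNr (pa_bil q)).
have := pa_cycle x y z; have := pa_cycle y x z.
rewrite (pa_antisym (z * y)) (pa_antisym (x * z)) (pa_antisym (z * x)) (pa_antisym (y * z)).
by move=> E1 E2; apply: (lin_sub E1); apply: (lin_add E2); lmodule F.
Qed.

Lemma pa_skew_part (x y : a) : star x = - x -> pa x (skew_part y) = pa x y.
Proof.
move=> xS; rewrite {2}(fixed_skewE nz2 y) (bilDr (pa_bil q)) (pa_antisym x (fixed_part y)).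
by rewrite (pa_fixed_skew (star_fixed y) xS) oppr0 add0r.
Qed.

(** By [derE], d_z is multiplication by beta^* over 2l plus [d0 z]. The multiplication part acts on
    pairs over a through [pa_acomm] and on pairs over C through [pa_form], giving the first term;
    [d0 z] gives [B0]. *)
Lemma bsum_der (b1 b2 b1' b2' : Defs.coord q) :
  bsum (der l b1 b2 b1') b2' + bsum b1' (der l b1 b2 b2') =
  (2 * l)%:R^-1 *: pa (bst (bsum b1 b2)) (bst (bsum b1' b2'))
  + B0 (bsum b1 b2) (bsum b1' b2').
Proof.
rewrite (derE b1 b2 b1') (derE b1 b2 b2'); move: (bsum b1 b2) => z.
rewrite /bsum /= (bilDr (B0_bil q)) B0_a B0_pc add0r /B0_c.
rewrite -(bilZl (pa_bil q)); set x : a := _ *: _.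
have xS : star x = - x by rewrite (linearZP (@qstar_lin F q)) star_bst scalerN.
rewrite (linearDP (@bst_lin F q)) bst_a bst_c (bilDr (pa_bil q)) pa_skew_part //.
have -> : - heart b1'.2 b2'.2 = - skew_part (f b1'.2 b2'.2).
  by rewrite /heart /skew_part qf_star opprK.
rewrite (bilNr (pa_bil q)) pa_skew_part // -/(acomm _ _) -(pa_acomm x).
rewrite -(pa_antisym (f _ _)) pa_form xS (bilNl (act_bil q)) (bilNl (pc_bil q)).
rewrite (pcC (act x b2'.2)) !(bilDl (pc_bil q), bilDr (pc_bil q)).
by lmodule F.
Qed.

End Derivations.

Section Adjoints.
Variables (F : fieldType) (I : choiceType).
Hypothesis nz2 : (2 : F) != 0.
Local Notation V := (Vsp F I).
Local Notation E := (V -> V).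
Local Notation gl := (glJ F I).
Local Notation elem := (@elem F I).
Local Notation bar := (@bar I).
Local Notation sg := (@sg F I).
Local Notation adjoint := (@adjoint F I).
Local Notation sp := (spI F I).
Local Notation sym := (symI F I).

Lemma adjointC (phi psi : E) : adjoint phi psi -> adjoint psi phi.
Proof. by move=> ad u w; rewrite form_antisym -ad form_antisym opprK. Qed.

Lemma trace_adjoint (phi psi : E) : phi \in gl -> psi \in gl -> adjoint phi psi ->
  trace psi = trace phi.
Proof.
move=> gphi gpsi ad.
suff [psi' gpsi' [ad' tE]] : exists2 psi', psi' \in gl &
    adjoint phi psi' /\ trace psi' = trace phi.
  by rewrite (adjoint_uniq nz2 ad ad').
move: phi gphi {gpsi ad psi}; apply: gl_ind => [|l phi phi' gp gp'
    [psi gpsi [ad tE]] [psi' gpsi' [ad' tE']]|j k].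
- exists 0; rewrite ?rpred0 //; split=> // u w.
  by rewrite [LHS]Defs.form0l [RHS]Defs.form0r.
- exists (l *: psi + psi'); first by rewrite rpredD ?rpredZ.
  by split; [exact: adjointP2 | rewrite !trace_lin // tE tE'].
- exists ((sg j * sg k) *: elem (bar k) (bar j)); first by rewrite rpredZ ?gl_elem.
  split; first exact: adjoint_elem.
  rewrite -[_ *: elem _ _]addr0 trace_lin ?rpred0 ?gl_elem // trace0 addr0.
  rewrite (trace_elem F (bar k) (bar j)) (trace_elem F j k) dl_barl barK (dlC F k j).
  by ring: (sg2 F k) (sg_dl_eq F j k).
Qed.

Lemma traceN (phi : E) : phi \in gl -> trace (- phi) = - trace phi.
Proof.
move=> gphi; have := trace_lin (-1) gphi (rpred0 (GRing.SubmodClosed.sort gl)).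
by rewrite scaleN1r addr0 trace0 addr0 mulN1r.
Qed.

Lemma spE (x : E) : (x \in sp) <-> (x \in gl) /\ adjoint x (- x).
Proof.
split=> [/andP[gx /asboolP xS]|[gx xS]].
  by split=> // u w; rewrite xS fun_oppE (bilNr (@form_bil F I)).
rewrite inE gx; apply/asboolP => u w.
by rewrite xS fun_oppE (bilNr (@form_bil F I)).
Qed.

Lemma symE (x : E) : (x \in sym) <-> [/\ x \in gl, trace x = 0 & adjoint x x].
Proof.
split=> [/and3P[gx /eqP tx /asboolP xS]|[gx tx xS]]; first by split.
by rewrite inE gx tx eqxx; apply/asboolP => u w; rewrite xS.
Qed.

End Adjoints.

(** * From matrices over a to L(q, K) *)

Section RealizationMap.
Variables (F : fieldType) (I : choiceType) (l : nat) (I0 : {fset I}) (q : quadrupleBC F).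
Variable K : submodClosed (bbracket q).
Hypothesis nz2 : (2 : F) != 0.
Hypothesis nzl : (l%:R : F) != 0.
Hypothesis card_I0 : #|` I0| = l.
Local Notation V := (Vsp F I).
Local Notation E := (V -> V).
Local Notation gl := (glJ F I).
Local Notation elem := (@elem F I).
Local Notation sg := (@sg F I).
Local Notation bar := (@bar I).
Local Notation adjoint := (@adjoint F I).
Local Notation a := (qa q).
Local Notation MA := (MA I q).
Local Notation ot := (@ot F I q).
Local Notation L := (LqK I K).
Local Notation sp := (spI F I).
Local Notation sym := (symI F I).
Local Notation Fx := (fixed q).
Local Notation Sk := (Defs.skew q).
Local Notation I0op := (idI0 I0 : E).

Local Notation Lga := (@L_ga F I q K).
Local Notation Lsb := (@L_sb F I q K).

Lemma fixed_part_Fx (x : a) : fixed_part x \in Fx.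
Proof. by rewrite inE star_fixed. Qed.
Lemma skew_part_Sk (x : a) : skew_part x \in Sk.
Proof. by rewrite inE star_skew. Qed.

Lemma Lga0 x : Lga x 0 = 0.
Proof.
have := @Lga_linr F I q K (-1) x 0 0 (rpred0 _) (rpred0 _).
by rewrite scaler0 addr0 scaleN1r addNr.
Qed.
Lemma Lsb0 x : Lsb x 0 = 0.
Proof.
have := @Lsb_linr F I q K (-1) x 0 0 (rpred0 _) (rpred0 _).
by rewrite scaler0 addr0 scaleN1r addNr.
Qed.
Lemma Lga0l x : Lga 0 x = 0.
Proof.
have := @Lga_linl F I q K (-1) 0 0 x (rpred0 _) (rpred0 _).
by rewrite scaler0 addr0 scaleN1r addNr.
Qed.
Lemma Lsb0l x : Lsb 0 x = 0.
Proof.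
have := @Lsb_linl F I q K (-1) 0 0 x (rpred0 _) (rpred0 _).
by rewrite scaler0 addr0 scaleN1r addNr.
Qed.

Definition spp (phi psi : E) : E := 2^-1 *: (phi - psi).
Definition smp (phi psi : E) : E :=
  2^-1 *: (phi + psi) - (trace phi / (2 * l)%:R) *: I0op.

(* The image of [ot phi x], where psi is the adjoint of phi.                  *)
Definition rho_op (phi psi : E) (x : a) : L :=
  Lga (spp phi psi) (fixed_part x) + Lsb (smp phi psi) (skew_part x).

Lemma rho_op_lin phi psi : linear (rho_op phi psi).
Proof.
move=> k x y; rewrite /rho_op fixed_part_lin skew_part_lin.
rewrite (Lga_linr K _ _ (fixed_part_Fx x) (fixed_part_Fx y)).
by rewrite (Lsb_linr K _ _ (skew_part_Sk x) (skew_part_Sk y)); lmodule F.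
Qed.

Lemma spp_sp phi psi : phi \in gl -> psi \in gl -> adjoint phi psi ->
  spp phi psi \in sp.
Proof.
move=> gphi gpsi ad; apply/spE; split; first by rewrite rpredZ // rpredB.
have := adjointP2 2^-1 (adjointP2 (-1) (adjointC ad) ad) (_ : adjoint 0 0).
rewrite (_ : 2^-1 *: _ + 0 = spp phi psi); last by rewrite /spp; lmodule F.
rewrite (_ : 2^-1 *: _ + 0 = - spp phi psi); last by rewrite /spp; lmodule F.
by apply=> u w; rewrite [LHS]Defs.form0l [RHS]Defs.form0r.
Qed.

Lemma smp_sym phi psi : phi \in gl -> psi \in gl -> adjoint phi psi ->
  smp phi psi \in sym.
Proof.
move=> gphi gpsi ad; have gI := gl_idI0 F I0.
apply/symE; split.
- by rewrite rpredB ?rpredZ // rpredD.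
- rewrite /smp addrC -scaleNr trace_lin ?rpredZ ?rpredD //.
  rewrite -[2^-1 *: _]addr0 trace_lin ?rpred0 ?rpredD // trace0 addr0.
  rewrite -{2}[phi]scale1r trace_lin // (trace_adjoint nz2 gphi gpsi ad).
  by rewrite trace_idI0 card_I0 natrM; field; rewrite nzl nz2.
- have ad2 := adjointP2 1 ad (adjointC ad); rewrite !scale1r in ad2.
  have := adjointP2 (- (trace phi / (2 * l)%:R)) (@adjoint_idI0 F I I0)
    (adjointP2 2^-1 ad2 (_ : adjoint 0 0)).
  rewrite !addr0 [psi + phi]addrC !scaleNr ![- _ + _]addrC; apply=> u w.
  by rewrite [LHS]Defs.form0l [RHS]Defs.form0r.
Qed.

Lemma spp_lin k phi psi phi' psi' :
  spp (k *: phi + phi') (k *: psi + psi') = k *: spp phi psi + spp phi' psi'.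
Proof. by rewrite /spp; lmodule F. Qed.

Lemma smp_lin k phi psi phi' psi' : phi \in gl -> phi' \in gl ->
  smp (k *: phi + phi') (k *: psi + psi') = k *: smp phi psi + smp phi' psi'.
Proof.
by move=> g g'; rewrite /smp trace_lin //; move: (trace _) (trace _) => *; lmodule F.
Qed.

(** Takes the tau-skew half of a matrix and drops its I_0 component; see [th_rhoA]. *)
Definition rhoA (X : MA) : L := blift (fun p x =>
  rho_op (elem p.1 p.2) ((sg p.1 * sg p.2) *: elem (bar p.2) (bar p.1)) x) X.

Lemma rhoA_lin : linear rhoA.
Proof. by apply: blift_linear => p; exact: rho_op_lin. Qed.

Lemma rhoA_ot phi psi x : phi \in gl -> psi \in gl -> adjoint phi psi ->
  rhoA (ot phi x) = rho_op phi psi x.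
Proof.
move=> gphi gpsi ad.
suff [psi' gpsi' [ad' tE]] : exists2 psi', psi' \in gl &
    adjoint phi psi' /\ rhoA (ot phi x) = rho_op phi psi' x.
  by rewrite (adjoint_uniq nz2 ad ad').
move: phi gphi {gpsi ad psi}; apply: gl_ind => [|k phi phi' gp gp'
    [psi gpsi [ad tE]] [psi' gpsi' [ad' tE']]|j k].
- exists 0; rewrite ?rpred0 //; split=> [u w|].
    by rewrite [LHS]Defs.form0l [RHS]Defs.form0r.
  rewrite ot0 (linear0P rhoA_lin) /rho_op.
  have -> : spp 0 0 = 0 by rewrite /spp subrr scaler0.
  have -> : smp 0 0 = 0 by rewrite /smp trace0 addr0 mul0r !scale0r scaler0 subrr.
  by rewrite Lga0l Lsb0l addr0.
- exists (k *: psi + psi'); first by rewrite rpredD ?rpredZ.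
  split; first exact: adjointP2.
  rewrite (ot_linl k x gp gp') rhoA_lin tE tE' /rho_op spp_lin smp_lin //.
  rewrite (Lga_linl K _ _ (spp_sp gp gpsi ad) (spp_sp gp' gpsi' ad')).
  rewrite (Lsb_linl K _ _ (smp_sym gp gpsi ad) (smp_sym gp' gpsi' ad')).
  by rewrite scalerDr addrACA.
- exists ((sg j * sg k) *: elem (bar k) (bar j)); first by rewrite rpredZ ?gl_elem.
  split; first exact: adjoint_elem.
  rewrite ot_elem /rhoA /mxe.
  by apply: (bliftE (fun p => rho_op_lin _ _) (j, k) x).
Qed.

End RealizationMap.

Lemma addr3ACA (W : zmodType) (x x' y y' z z' : W) :
  (x + x') + (y + y') + (z + z') = (x + y + z) + (x' + y' + z').
Proof. by rewrite [x + x' + _]addrACA [LHS]addrACA. Qed.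

(** * Images of matrix commutators in L(q, K) *)

Section RealizationBracket.
Variables (F : fieldType) (I : choiceType) (l : nat) (I0 : {fset I}) (q : quadrupleBC F).
Variable K : submodClosed (bbracket q).
Hypothesis nz2 : (2 : F) != 0.
Hypothesis nzl : (l%:R : F) != 0.
Hypothesis card_I0 : #|` I0| = l.
Local Notation V := (Vsp F I).
Local Notation E := (V -> V).
Local Notation gl := (glJ F I).
Local Notation adjoint := (@adjoint F I).
Local Notation a := (qa q).
Local Notation star := (qstar q).
Local Notation U := (model I q).
Local Notation ot := (@ot F I q).
Local Notation L := (LqK I K).
Local Notation sp := (spI F I).
Local Notation sym := (symI F I).
Local Notation Fx := (fixed q).
Local Notation Sk := (Defs.skew q).
Local Notation I0op := (idI0 I0 : E).
Local Notation inX := (@inX F I q).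
Local Notation inW := (@inW F I q).
Local Notation inZ := (@inZ F I q).

Local Notation Lga := (@L_ga F I q K).
Local Notation Lsb := (@L_sb F I q K).
Local Notation Lvc := (@Lvc F I q K).
Local Notation Lbb := (@Lbb F I q K).

Local Notation rhoA := (@rhoA F I l I0 q K).
Local Notation "2l" := ((2 * l)%:R : F).

Let nz2l : (2 * l)%:R != 0 :> F.
Proof. by rewrite natrM mulf_neq0. Qed.

Let rhoL : linear rhoA. Proof. exact: rhoA_lin. Qed.

Let rhoO phi psi x : phi \in gl -> psi \in gl -> adjoint phi psi ->
  rhoA (ot phi x) = rho_op l I0 K phi psi x.
Proof. exact: rhoA_ot. Qed.

Lemma LgaZ k x al : x \in sp -> Lga (k *: x) al = k *: Lga x al.
Proof. by move=> sx; rewrite -[k *: x]addr0 Lga_linl ?rpred0 // Lga0l addr0. Qed.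
Lemma LsbZ k x be : x \in sym -> Lsb (k *: x) be = k *: Lsb x be.
Proof. by move=> sx; rewrite -[k *: x]addr0 Lsb_linl ?rpred0 // Lsb0l addr0. Qed.
Lemma LgaZr k x al : al \in Fx -> Lga x (k *: al) = k *: Lga x al.
Proof. by move=> sx; rewrite -[k *: al]addr0 Lga_linr ?rpred0 // Lga0 addr0. Qed.
Lemma LsbZr k x be : be \in Sk -> Lsb x (k *: be) = k *: Lsb x be.
Proof. by move=> sx; rewrite -[k *: be]addr0 Lsb_linr ?rpred0 // Lsb0 addr0. Qed.

Definition realize (u : U) : L := rhoA u.1.1 + Lvc u.1.2 + Lbb u.2.
Local Notation rho := realize.

Lemma rho_lin : linear rho.
Proof.
move=> k u u'; rewrite /rho /= rhoL (@Lvc_lin F I q K) (@Lbb_lin F I q K).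
rewrite !scalerDr; exact: addr3ACA.
Qed.

Lemma rho_X X : rho (inX X) = rhoA X.
Proof. by rewrite /rho /= (linear0P (@Lvc_lin F I q K)) (linear0P (@Lbb_lin F I q K)) !addr0. Qed.
Lemma rho_W w : rho (inW w) = Lvc w.
Proof. by rewrite /rho /= (linear0P rhoL) (linear0P (@Lbb_lin F I q K)) addr0 add0r. Qed.
Lemma rho_Z z : rho (inZ z) = Lbb z.
Proof. by rewrite /rho /= (linear0P rhoL) (linear0P (@Lvc_lin F I q K)) !add0r. Qed.

Lemma FxP (x : a) : x \in Fx -> star x = x. Proof. by rewrite inE => /eqP. Qed.
Lemma SkP (x : a) : x \in Sk -> star x = - x. Proof. by rewrite inE => /eqP. Qed.

Lemma rhoA_sp x al : x \in sp -> al \in Fx -> rhoA (ot x al) = Lga x al.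
Proof.
move=> /spE[gx ad] /FxP xF; rewrite (rhoO al gx _ ad) ?rpredN //.
rewrite /rho_op fixed_part_fixed // skew_part_fixed // Lsb0 addr0.
by congr Lga; rewrite /spp; lmodulef F.
Qed.

Lemma rhoA_self x be : x \in gl -> adjoint x x -> be \in Sk ->
  rhoA (ot x be) = Lsb (x - (trace x / 2l) *: I0op) be.
Proof.
move=> gx ad /SkP xS; rewrite (rhoO be gx gx ad).
rewrite /rho_op fixed_part_skew // skew_part_skew // Lga0 add0r.
by congr Lsb; rewrite /smp; congr (_ - _); lmodulef F.
Qed.

Lemma rhoA_sym s be : s \in sym -> be \in Sk -> rhoA (ot s be) = Lsb s be.
Proof. by move=> /symE[gs ts ad] beS; rewrite rhoA_self // ts mul0r scale0r subr0. Qed.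

(** The trace correction of I_0 is I_0 itself; thus the multiple of I_0 in [bb_model] becomes
    invisible. *)
Lemma rhoA_I0 be : be \in Sk -> rhoA (ot I0op be) = 0.
Proof.
move=> beS; rewrite (rhoA_self (gl_idI0 F I0) (@adjoint_idI0 F I I0) beS).
by rewrite trace_idI0 card_I0 divff // scale1r subrr Lsb0l.
Qed.

Lemma rhoA_sub X Y : rhoA (X - Y) = rhoA X - rhoA Y.
Proof. by rewrite (linearDP rhoL) (linearNP rhoL). Qed.

(** Here y is the conjugate of x, so the argument is a matrix minus its tau-image and both
    projections double. *)
Lemma rhoA_even phi psi x y p r : phi \in gl -> psi \in gl -> adjoint phi psi ->
  fixed_part x = p -> fixed_part y = p -> skew_part x = r -> skew_part y = - r ->
  rhoA (ot phi x - ot psi y) =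
  Lga (phi - psi) p + Lsb (phi + psi - (trace phi / l%:R) *: I0op) r.
Proof.
move=> gp gq ad xp yp xr yr.
have pF : p \in Fx by rewrite -xp fixed_part_Fx.
have rS : r \in Sk by rewrite -xr skew_part_Sk.
rewrite rhoA_sub (rhoO _ gp gq ad) (rhoO _ gq gp (adjointC ad)) /rho_op xp yp xr yr.
have -> : phi - psi = 2 *: spp phi psi by rewrite /spp; lmodulef F.
have -> : phi + psi - (trace phi / l%:R) *: I0op = 2 *: smp l I0 phi psi.
  rewrite /smp natrM; move: (trace _) => t.
  by lmodule_with F ltac:(by [] || ring || by field; rewrite nzl nz2).
have -> : spp psi phi = - 1 *: spp phi psi by rewrite scaleN1r /spp -scalerN opprB.
have -> : smp l I0 psi phi = smp l I0 phi psi.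
  by rewrite /smp (trace_adjoint nz2 gp gq ad) [psi + _]addrC.
move: (spp_sp gp gq ad) (smp_sym nz2 nzl card_I0 gp gq ad).
move: (spp _ _) (smp _ _ _ _) => A B sA sB.
rewrite -[- r]scaleN1r (LsbZr _ B rS) !(LgaZ _ p sA) (LsbZ _ r sB).
by move: (Lga _ _) (Lsb _ _) => X Y; lmodule F.
Qed.

(** Here y is minus the conjugate of x and the adjoint of phi is - psi, so the argument is again a
    matrix minus its tau-image, now with no trace to remove. *)
Lemma rhoA_odd phi psi x y p r : phi \in gl -> psi \in gl -> adjoint phi (- psi) ->
  trace phi = 0 -> trace psi = 0 ->
  fixed_part x = p -> fixed_part y = - p -> skew_part x = r -> skew_part y = r ->
  rhoA (ot phi x - ot psi y) = Lga (phi + psi) p + Lsb (phi - psi) r.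
Proof.
move=> gp gq ad tp tq xp yp xr yr.
have pF : p \in Fx by rewrite -xp fixed_part_Fx.
have rS : r \in Sk by rewrite -xr skew_part_Sk.
have gqN : - psi \in gl by rewrite rpredN.
have gpN : - phi \in gl by rewrite rpredN.
have ad' : adjoint psi (- phi).
  have := adjointP2 (-1) (adjointC ad) (_ : adjoint 0 0).
  rewrite !addr0 !scaleN1r opprK; apply=> u w.
  by rewrite [LHS]Defs.form0l [RHS]Defs.form0r.
have tN : trace (- psi) = 0.
  by rewrite traceN // tq oppr0.
rewrite rhoA_sub (rhoO _ gp gqN ad) (rhoO _ gq gpN ad') /rho_op xp yp xr yr.
have -> : phi + psi = 2 *: spp phi (- psi) by rewrite /spp; lmodulef F.
have -> : phi - psi = 2 *: smp l I0 phi (- psi).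
  by rewrite /smp tp mul0r scale0r; lmodulef F.
have -> : spp psi (- phi) = spp phi (- psi) by rewrite /spp !opprK addrC.
have -> : smp l I0 psi (- phi) = - 1 *: smp l I0 phi (- psi).
  by rewrite /smp tp tq !mul0r !scale0r !subr0 scaleN1r -scalerN opprB.
move: (spp_sp gp gqN ad) (smp_sym nz2 nzl card_I0 gp gqN ad).
move: (spp _ _) (smp _ _ _ _) => A B sA sB.
rewrite -[- p]scaleN1r (LgaZr _ A pF) !(LsbZ _ r sB) (LgaZ _ p sA).
by move: (Lga _ _) (Lsb _ _) => X Y; lmodule F.
Qed.

(* [x] and [y] are both skew-adjoint or both self-adjoint.                    *)
Lemma rhoA_comm_even x y al be : x \in gl -> y \in gl ->
  adjoint (x \o y) (y \o x) -> star (al * be) = be * al ->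
  rhoA (ot (x \o y) (al * be) - ot (y \o x) (be * al)) =
  Lga (mcomm x y) (2^-1 *: acirc al be) + Lsb (mcirc l I0 x y) (2^-1 *: acomm al be).
Proof.
move=> gx gy ad st.
have st' : star (be * al) = al * be by rewrite -st qstarK.
apply: (rhoA_even (gl_comp gx gy) (gl_comp gy gx) ad).
- by rewrite /fixed_part st.
- by rewrite /fixed_part st' addrC.
- by rewrite /skew_part st.
- by rewrite /skew_part st' /acomm -scalerN opprB.
Qed.

(* One of [x] and [y] is skew-adjoint and the other one self-adjoint.         *)
Lemma rhoA_comm_odd x y al be : x \in gl -> y \in gl ->
  adjoint (x \o y) (- (y \o x)) -> star (al * be) = - (be * al) ->
  rhoA (ot (x \o y) (al * be) - ot (y \o x) (be * al)) =
  Lga (mcirc l I0 x y) (2^-1 *: acomm al be) + Lsb (mcomm x y) (2^-1 *: acirc al be).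
Proof.
move=> gx gy ad st.
have gxy := gl_comp gx gy; have gyx := gl_comp gy gx; have trC := traceC gx gy.
have tr0 : trace (x \o y) = 0.
  have gyxN : - (y \o x) \in gl by rewrite rpredN.
  (* Exchanging x and y preserves the trace of the product, while here the adjoint identity changes
     its sign. *)
  apply: (eqN_eq0 nz2 (W := F^o)); rewrite {1}trC.
  by rewrite -(trace_adjoint nz2 gxy gyxN ad) (traceN gyx) opprK.
have st' : star (be * al) = - (al * be).
  by rewrite -[al * be]qstarK st (linearNP (@qstar_lin F q)) opprK.
have -> : mcirc l I0 x y = (x \o y) + (y \o x).
  by rewrite /mcirc tr0 mul0r scale0r subr0.
apply: (rhoA_odd gxy gyx ad tr0); first by rewrite -trC.
- by rewrite /fixed_part st.
- by rewrite /fixed_part st' /acomm -scalerN opprB.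
- by rewrite /skew_part st opprK.
- by rewrite /skew_part st' opprK addrC.
Qed.

End RealizationBracket.

(** * The bracket table of L(q, K) computed in the model *)

Section GeneratorBracket.
Variables (F : fieldType) (I : choiceType) (l : nat) (I0 : {fset I}) (q : quadrupleBC F).
Variable K : submodClosed (bbracket q).
Hypothesis nz2 : (2 : F) != 0.
Hypothesis nzl : (l%:R : F) != 0.
Hypothesis card_I0 : #|` I0| = l.
Local Notation V := (Vsp F I).
Local Notation E := (V -> V).
Local Notation gl := (glJ F I).
Local Notation adjoint := (@adjoint F I).
Local Notation a := (qa q).
Local Notation C := (qC q).
Local Notation star := (qstar q).
Local Notation act := (qact (q := q)).
Local Notation BB := (BB q).
Local Notation U := (model I q).
Local Notation ot := (@ot F I q).
Local Notation L := (LqK I K).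
Local Notation sp := (spI F I).
Local Notation sym := (symI F I).
Local Notation Fx := (fixed q).
Local Notation Sk := (Defs.skew q).
Local Notation I0op := (idI0 I0 : E).
Local Notation inX := (@inX F I q).
Local Notation inW := (@inW F I q).
Local Notation inZ := (@inZ F I q).

Local Notation Lga := (@L_ga F I q K).
Local Notation Lsb := (@L_sb F I q K).
Local Notation Lvc := (@Lvc F I q K).
Local Notation Lbb := (@Lbb F I q K).

Local Notation rhoA := (@rhoA F I l I0 q K).
Local Notation mbr := (@mbr F I q).
Local Notation "2l" := ((2 * l)%:R : F).

Local Notation rho := (@realize F I l I0 q K).
Local Notation vt0 := (@vt0 F I q).

Let nz2l : (2 * l)%:R != 0 :> F.
Proof. by rewrite natrM mulf_neq0. Qed.
Let rhoL : linear rho. Proof. exact: rho_lin. Qed.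

Let rAL : linear rhoA. Proof. exact: rhoA_lin. Qed.
Let rX X : rho (inX X) = rhoA X. Proof. exact: rho_X. Qed.
Let rW w : rho (inW w) = Lvc w. Proof. exact: rho_W. Qed.
Let rZ z : rho (inZ z) = Lbb z. Proof. exact: rho_Z. Qed.

(** I_0 has trace 2l, so the matrix part has trace [bst z], as [model_ok] requires. *)
Definition bb_model (z : BB) : U := inX (ot I0op (2l^-1 *: bst z)) + inZ z.
Local Notation hz := bb_model.

Lemma hz_lin : linear hz.
Proof.
move=> k z z'; rewrite /hz bst_lin scalerDr scalerA mulrC -scalerA ot_lin.
by rewrite (@inX_lin F I q) (@inZ_lin F I q) scalerDr addrACA.
Qed.

(* Unlike x (x) a, the element <b1, b2> is not in the last summand of the      *)
(* model: it needs a multiple of I_0 to get the right trace.                  *)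
Definition hat (g : generator I q) : U :=
  match g with
  | GenGA x al => inX (ot x al)
  | GenSB s be => inX (ot s be)
  | GenVC u c => inW (vt0 u c)
  | GenBB b1 b2 => hz (bsum b1 b2)
  end.

Definition valid (g : generator I q) : Prop :=
  match g with
  | GenGA x al => x \in sp /\ al \in Fx
  | GenSB s be => s \in sym /\ be \in Sk
  | _ => True
  end.

Lemma inGAE x al : inGA K x al = Lga x al.
Proof. by rewrite /L_ga gAE. Qed.
Lemma inSBE s be : inSB K s be = Lsb s be.
Proof. by rewrite /L_sb sBE. Qed.
Lemma inVCE u c : inVC K u c = Lvc (vt0 u c).
Proof. by rewrite LvcE vc_toE. Qed.
Lemma inBBE b1 b2 : inBB I K b1 b2 = Lbb (bsum b1 b2).
Proof. by rewrite LbbE /bbc /bsum -bb_of_bpair bb_ofK. Qed.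

Lemma bstI_Sk z : (2l^-1 *: bst z : a) \in Sk.
Proof. by rewrite rpredZ // inE star_bst. Qed.

Lemma rho_hz z : rho (hz z) = Lbb z.
Proof.
by rewrite /hz (linearDP rhoL) rX rZ (rhoA_I0 K nz2 nzl card_I0) ?bstI_Sk // add0r.
Qed.

Lemma rho_mbr_ot phi psi x y : phi \in gl -> psi \in gl ->
  rho (mbr (inX (ot phi x)) (inX (ot psi y))) =
  rhoA (ot (phi \o psi) (x * y) - ot (psi \o phi) (y * x))
  + trace (phi \o psi) *: Lbb (pa x y).
Proof.
move=> gp gq; rewrite mbrXX (linearDP rhoL) rX rZ.
rewrite (ot_mul x y gp gq) (ot_mul y x gq gp) (ot_tpair x y gp gq).
by rewrite (linearZP (@Lbb_lin F I q K)).
Qed.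

Lemma comp_opp (phi psi : E) : linear psi -> - psi \o - phi = psi \o phi.
Proof.
move=> psiL; apply/funext => w; rewrite /= -[LHS]/(- psi (- phi w)).
by rewrite (linearNP psiL) opprK.
Qed.

Lemma adjoint_sp_sp x y : x \in sp -> y \in sp -> adjoint (x \o y) (y \o x).
Proof.
move=> /spE[gx ax] /spE[gy ay]; rewrite -(comp_opp _ (gl_lin gy)).
exact: adjoint_comp.
Qed.

Lemma adjoint_sp_self x s : x \in sp -> s \in gl -> adjoint s s ->
  adjoint (x \o s) (- (s \o x)).
Proof.
move=> /spE[gx ax] gs as_; have -> : - (s \o x) = s \o - x.
  by apply/funext => w; rewrite -[RHS]/(s (- x w)) (linearNP (gl_lin gs)).
exact: adjoint_comp.
Qed.

Lemma Lbb_fixed_skew x y : x \in Fx -> y \in Sk -> Lbb (pa x y) = 0.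
Proof.
move=> /FxP xF /SkP yS; rewrite pa_fixed_skew //.
exact: linear0P (@Lbb_lin F I q K).
Qed.

Lemma bsum_a (x y : a) : bsum (of_a x) (of_a y) = pa x y.
Proof. by rewrite /bsum /= (bil0l (pc_bil q)) addr0. Qed.
Lemma bsum_c (c c' : C) : bsum (of_C c) (of_C c') = pc c c'.
Proof. by rewrite /bsum /= (bil0l (pa_bil q)) add0r. Qed.

Lemma bracket_GA_GA_E x al y al' : x \in sp -> al \in Fx -> y \in sp -> al' \in Fx ->
  bracket_GA_GA l I0 K x al y al' = rho (mbr (inX (ot x al)) (inX (ot y al'))).
Proof.
move=> sx xF sy yF; have [gx _] := (spE x).1 sx; have [gy _] := (spE y).1 sy.
have st : star (al * al') = al' * al by rewrite qstarM (FxP xF) (FxP yF).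
rewrite (rho_mbr_ot al al' gx gy).
rewrite (rhoA_comm_even K nz2 nzl card_I0 gx gy (adjoint_sp_sp sx sy) st).
by rewrite /bracket_GA_GA inGAE inSBE inBBE bsum_a.
Qed.

(** Stated for any self-adjoint s in gl(J), so that it also applies to I_0 and yields the bracket
    with {b, b}. *)
Lemma bracket_GA_SB_E x al s be : x \in sp -> al \in Fx -> s \in gl ->
  adjoint s s -> be \in Sk ->
  Lga (mcirc l I0 x s) (2^-1 *: acomm al be) + Lsb (mcomm x s) (2^-1 *: acirc al be)
    = rho (mbr (inX (ot x al)) (inX (ot s be))).
Proof.
move=> sx xF gs as_ yS; have [gx _] := (spE x).1 sx.
have st : star (al * be) = - (be * al) by rewrite qstarM (FxP xF) (SkP yS) amulNl.
rewrite (rho_mbr_ot al be gx gs) Lbb_fixed_skew // scaler0 addr0.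
by rewrite (rhoA_comm_odd K nz2 nzl card_I0 gx gs (adjoint_sp_self sx gs as_) st).
Qed.

(** Serves for two trace zero operators, for one of them and I_0, and for I_0 twice. *)
Lemma bracket_SB_SB_E s be t be' : s \in gl -> adjoint s s -> be \in Sk ->
  t \in gl -> adjoint t t -> be' \in Sk ->
  Lga (mcomm s t) (2^-1 *: acirc be be') + Lsb (mcirc l I0 s t) (2^-1 *: acomm be be')
  + trace (s \o t) *: Lbb (pa be be')
  = rho (mbr (inX (ot s be)) (inX (ot t be'))).
Proof.
move=> gs as_ sS gt at_ tS.
have st : star (be * be') = be' * be by rewrite qstarM (SkP sS) (SkP tS) amulNl amulNr opprK.
rewrite (rho_mbr_ot be be' gs gt).
by rewrite (rhoA_comm_even K nz2 nzl card_I0 gs gt (adjoint_comp as_ at_) st).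
Qed.

Lemma bracket_act_E x al u c : x \in gl ->
  inVC K (x u) (act al c) = rho (mbr (inX (ot x al)) (inW (vt0 u c))).
Proof. by move=> gx; rewrite mbrXW rW (ot_act al u c gx) inVCE. Qed.

Lemma bracket_VC_VC_E u c w c' :
  bracket_VC_VC l I0 K u c w c' = rho (mbr (inW (vt0 u c)) (inW (vt0 w c'))).
Proof.
rewrite mbrWW (linearDP rhoL) rX rZ (cross_vt0 nz2) vt_wpair (linearZP (@Lbb_lin F I q K)).
rewrite /bracket_VC_VC inGAE inSBE inBBE bsum_c; congr (_ + _).
rewrite (linearDP rAL) (rhoA_sp K nz2 nzl card_I0); first last.
- by rewrite inE star_diamond.
- by apply/spE; split; [exact: gl_vcirc | exact: adjoint_vcirc].
congr (_ + _); rewrite (rhoA_self K nz2 nzl card_I0 (gl_wedge u w) (@adjoint_wedge F I u w)).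
  congr (Lsb _ _); apply/funext => t; rewrite (trace_wedge nz2).
  by rewrite !funE mulNr scaleNr opprK.
by rewrite inE star_heart.
Qed.

(** Matrices commute with {b, b} in the model, so <b1, b2> acts on them only through I_0. *)
Lemma mbr_X_hz X z : mbr (inX X) (hz z) = mbr (inX X) (inX (ot I0op (2l^-1 *: bst z))).
Proof. by rewrite /hz (bilDr (@mbr_bil F I q)) mbrXZ addr0. Qed.

Let inv4 (x y : a) : 2^-1 *: acirc x (2l^-1 *: y) = (4 * l)%:R^-1 *: acirc x y.
Proof.
rewrite /acirc !algE !natrM; have nz4 : (4 : F) != 0 by rewrite (natrM F 2 2) mulf_neq0.
by lmodule_with F ltac:(by [] || ring || by field; rewrite nzl nz2 nz4).
Qed.
Let inv4' (x y : a) : 2^-1 *: acomm x (2l^-1 *: y) = (4 * l)%:R^-1 *: acomm x y.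
Proof.
rewrite /acomm !algE !natrM; have nz4 : (4 : F) != 0 by rewrite (natrM F 2 2) mulf_neq0.
by lmodule_with F ltac:(by [] || ring || by field; rewrite nzl nz2 nz4).
Qed.

Lemma bst_Sk z : bst z \in Sk. Proof. by rewrite inE star_bst. Qed.

Lemma acomm_Fx x y : x \in Fx -> y \in Sk -> acomm x y \in Fx.
Proof.
move=> /FxP xF /SkP yS; rewrite inE /acomm !(linE (@qstar_lin F q)) !qstarM xF yS.
by rewrite !algE; apply/eqP; lmodule F.
Qed.
Lemma acirc_Sk x y : x \in Fx -> y \in Sk -> acirc x y \in Sk.
Proof.
move=> /FxP xF /SkP yS; rewrite inE /acirc !(linE (@qstar_lin F q)) !qstarM xF yS.
by rewrite !algE; apply/eqP; lmodule F.
Qed.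
Lemma acirc_Fx x y : x \in Sk -> y \in Sk -> acirc x y \in Fx.
Proof.
move=> /SkP xF /SkP yS; rewrite inE /acirc !(linE (@qstar_lin F q)) !qstarM xF yS.
by rewrite !algE; apply/eqP; lmodule F.
Qed.
Lemma acomm_Sk x y : x \in Sk -> y \in Sk -> acomm x y \in Sk.
Proof.
move=> /SkP xF /SkP yS; rewrite inE /acomm !(linE (@qstar_lin F q)) !qstarM xF yS.
by rewrite !algE; apply/eqP; lmodule F.
Qed.

Let gI : I0op \in gl. Proof. exact: gl_idI0. Qed.
Let aI : adjoint I0op I0op. Proof. exact: adjoint_idI0. Qed.

Lemma bracket_BB_GA_E b1 b2 x al : x \in sp -> al \in Fx ->
  - bracket_BB_GA l I0 K b1 b2 x al = rho (mbr (inX (ot x al)) (hz (bsum b1 b2))).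
Proof.
move=> sx xF; rewrite mbr_X_hz -(bracket_GA_SB_E sx xF gI aI (bstI_Sk _)) inv4 inv4'.
rewrite /bracket_BB_GA scaleNr opprK inGAE inSBE -(bst_bsum nz2).
rewrite scalerDr; congr (_ + _).
  exact: esym (LgaZr K _ _ (acomm_Fx xF (bst_Sk _))).
exact: esym (LsbZr K _ _ (acirc_Sk xF (bst_Sk _))).
Qed.

Lemma bracket_BB_SB_E b1 b2 s be : s \in sym -> be \in Sk ->
  - bracket_BB_SB l I0 K b1 b2 s be = rho (mbr (inX (ot s be)) (hz (bsum b1 b2))).
Proof.
move=> ss yS; have [gs _ as_] := (symE s).1 ss.
rewrite mbr_X_hz -(bracket_SB_SB_E gs as_ yS gI aI (bstI_Sk _)) inv4 inv4'.
rewrite /bracket_BB_SB scaleNr opprK inGAE inSBE inBBE bsum_a -(bst_bsum nz2).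
have dist k (A B D : L) : k *: (A + B + D) = k *: A + k *: B + k *: D.
  by rewrite 2!scalerDr.
rewrite [LHS]dist.
have E1 := esym (LgaZr K (4 * l)%:R^-1 (mcomm s I0op) (acirc_Fx yS (bst_Sk (bsum b1 b2)))).
have E2 := esym (LsbZr K (4 * l)%:R^-1 (mcirc l I0 s I0op) (acomm_Sk yS (bst_Sk (bsum b1 b2)))).
apply: (congr2 +%R (congr2 +%R E1 E2)).
rewrite (bilZr (pa_bil q)) (linearZP (@Lbb_lin F I q K)).
rewrite [LHS]scalerA [RHS]scalerA; move: (Lbb _) (trace _) => X t.
have nz4 : (4 : F) != 0 by rewrite (natrM F 2 2) mulf_neq0.
apply: (congr1 (fun c => c *: X)); rewrite !natrM; field; by rewrite nzl nz2 nz4.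
Qed.

Lemma bracket_BB_VC_E b1 b2 u c :
  bracket_BB_VC l I0 K b1 b2 u c = rho (mbr (hz (bsum b1 b2)) (inW (vt0 u c))).
Proof.
rewrite /hz (bilDl (@mbr_bil F I q)) mbrXW mbrZW (linearDP rhoL) !rW.
rewrite (ot_act _ _ _ gI) vt_zact d0_bsum /bracket_BB_VC !inVCE -(bst_bsum nz2).
rewrite (bilZl (act_bil q)) (bilZr (@vt0_bil F I q)) (linearZP (@Lvc_lin F I q K)).
rewrite /d0_c (bilNr (@vt0_bil F I q)) (bilZr (@vt0_bil F I q)).
by rewrite (linearNP (@Lvc_lin F I q K)) (linearZP (@Lvc_lin F I q K)).
Qed.

Lemma bracket_BB_BB_E b1 b2 b1' b2' :
  bracket_BB_BB I l K b1 b2 b1' b2' = rho (mbr (hz (bsum b1 b2)) (hz (bsum b1' b2'))).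
Proof.
rewrite /bracket_BB_BB !inBBE -(linearDP (@Lbb_lin F I q K)) bsum_der //.
move: (bsum b1 b2) (bsum b1' b2') => z z'.
rewrite {1}/hz (bilDl (@mbr_bil F I q)) mbr_X_hz /hz (bilDr (@mbr_bil F I q)) (mbrZX nz2) mbrZZ.
rewrite add0r (linearDP rhoL) rZ.
rewrite -(bracket_SB_SB_E gI aI (bstI_Sk _) gI aI (bstI_Sk _)).
(* I_0 commutes with itself and its circle square is 2 I_0 - (2l/l) I_0 = 0, so only the trace term
   survives; it is the first term of [bsum_der]. *)
have -> : mcomm I0op I0op = 0 by rewrite /mcomm subrr.
have -> : mcirc l I0 I0op I0op = 0.
  rewrite /mcirc idI0_idem trace_idI0 card_I0 natrM mulfK //.
  by lmodule F.
rewrite Lga0l Lsb0l idI0_idem trace_idI0 card_I0 !add0r.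
rewrite (bilZl (pa_bil q)) (bilZr (pa_bil q)) -!(linearZP (@Lbb_lin F I q K)).
by rewrite -(linearDP (@Lbb_lin F I q K)) scalerA divff // scale1r.
Qed.

Theorem bracket_generatorE g h : valid g -> valid h ->
  bracket_generator l I0 K g h = rho (mbr (hat g) (hat h)).
Proof.
have N u v : rho (mbr u v) = - rho (mbr v u).
  by rewrite (mbr_antisym nz2) (linearNP rhoL).
have gsym s : s \in sym -> s \in gl by case/symE.
have gsp s : s \in sp -> s \in gl by case/spE.
have asym s : s \in sym -> adjoint s s by case/symE.
case: g => [x al|s be|u c|b1 b2] vg; case: h => [x' al'|s' be'|u' c'|b1' b2'] vh;
  rewrite /valid in vg vh; rewrite /bracket_generator /hat.
- by rewrite bracket_GA_GA_E //; case: vg vh => ? ? [].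
- rewrite /bracket_GA_SB inGAE inSBE.
  by case: vg vh => ? ? [? ?]; apply: bracket_GA_SB_E; auto.
- by case: vg => sx _; exact/bracket_act_E/gsp.
- by case: vg => ? ?; exact: bracket_BB_GA_E.
- rewrite N /bracket_GA_SB inGAE inSBE; congr (- _).
  by case: vg vh => ? ? [? ?]; apply: bracket_GA_SB_E; auto.
- rewrite /bracket_SB_SB inGAE inSBE inBBE bsum_a.
  by case: vg vh => ? ? [? ?]; apply: bracket_SB_SB_E; auto.
- by case: vg => sx _; exact/bracket_act_E/gsym.
- by case: vg => ? ?; exact: bracket_BB_SB_E.
- by rewrite N; case: vh => sx _; congr (- _); exact/bracket_act_E/gsp.
- by rewrite N; case: vh => sx _; congr (- _); exact/bracket_act_E/gsym.
- exact: bracket_VC_VC_E.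
- by rewrite N -bracket_BB_VC_E.
- by case: vh => ? ?; rewrite N -bracket_BB_GA_E // opprK.
- by case: vh => ? ?; rewrite N -bracket_BB_SB_E // opprK.
- exact: bracket_BB_VC_E.
- exact: bracket_BB_BB_E.
Qed.

End GeneratorBracket.

(** * The bracket of L(q, K) as the image of the model bracket *)

Section BracketModel.
Variables (F : fieldType) (I : choiceType) (l : nat) (I0 : {fset I}) (q : quadrupleBC F).
Variable K : submodClosed (bbracket q).
Hypothesis nz2 : (2 : F) != 0.
Hypothesis nzl : (l%:R : F) != 0.
Hypothesis card_I0 : #|` I0| = l.
Local Notation V := (Vsp F I).
Local Notation E := (V -> V).
Local Notation a := (qa q).
Local Notation MA := (MA I q).
Local Notation U := (model I q).
Local Notation ot := (@ot F I q).
Local Notation L := (LqK I K).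
Local Notation sp := (spI F I).
Local Notation sym := (symI F I).
Local Notation Fx := (fixed q).
Local Notation Sk := (Defs.skew q).
Local Notation inX := (@inX F I q).
Local Notation inW := (@inW F I q).
Local Notation inZ := (@inZ F I q).

Local Notation GA := (tensor (subspace sp) (subspace Fx)).
Local Notation SB := (tensor (subspace sym) (subspace Sk)).

Local Notation Lvc := (@Lvc F I q K).
Local Notation Lbb := (@Lbb F I q K).

Local Notation rhoA := (@rhoA F I l I0 q K).
Local Notation mbr := (@mbr F I q).

Local Notation rho := (@realize F I l I0 q K).

Local Notation hz := (@bb_model F I l I0 q).
Local Notation hat := (@hat F I l I0 q).

Let nz2l : (2 * l)%:R != 0 :> F.
Proof. by rewrite natrM mulf_neq0. Qed.
Let rhoL : linear rho. Proof. exact: rho_lin. Qed.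
Let rX X : rho (inX X) = rhoA X. Proof. exact: rho_X. Qed.
Let rW w : rho (inW w) = Lvc w. Proof. exact: rho_W. Qed.
Let rZ z : rho (inZ z) = Lbb z. Proof. exact: rho_Z. Qed.

Definition th_ga : GA -> MA := plift ot.
Definition th_sb : SB -> MA := plift ot.

Lemma ot_sp_lin k x x' y : x \in sp -> x' \in sp ->
  ot (k *: x + x') y = k *: ot x y + ot x' y.
Proof. by move=> /spE[gx _] /spE[gx' _]; exact: ot_linl. Qed.
Lemma ot_sym_lin k x x' y : x \in sym -> x' \in sym ->
  ot (k *: x + x') y = k *: ot x y + ot x' y.
Proof. by move=> /symE[gx _ _] /symE[gx' _ _]; exact: ot_linl. Qed.

Lemma th_ga_lin : linear th_ga.
Proof. exact: plift_linear ot_sp_lin (@ot_lin F I q). Qed.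
Lemma th_sb_lin : linear th_sb.
Proof. exact: plift_linear ot_sym_lin (@ot_lin F I q). Qed.
Lemma th_gaE x al : x \in sp -> al \in Fx -> th_ga (ptens x al) = ot x al.
Proof. exact: pliftE ot_sp_lin (@ot_lin F I q) x al. Qed.
Lemma th_sbE s be : s \in sym -> be \in Sk -> th_sb (ptens s be) = ot s be.
Proof. exact: pliftE ot_sym_lin (@ot_lin F I q) s be. Qed.

Definition model_part (X : L) : U :=
  inX (th_ga X.1.1.1 + th_sb X.1.1.2) + inW (vc_of X.1.2).
Local Notation th := model_part.

Lemma th_lin : linear th.
Proof.
move=> k X Y; rewrite /th /= th_ga_lin th_sb_lin vc_of_linear (@inW_lin F I q).
have -> : forall x x' y y' : MA, k *: x + x' + (k *: y + y') = k *: (x + y) + (x' + y').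
  by move=> x x' y y'; rewrite scalerDr addrACA.
by rewrite (@inX_lin F I q) scalerDr addrACA.
Qed.

(* The representative [repr] makes [theta] non-linear in general.             *)
Definition model_of (X : L) : U := th X + hz (bb_of (repr X.2)).
Local Notation theta := model_of.

Lemma generator_liftE (m : generator I q -> L) (h : U -> L) : linear h ->
  (forall g, valid g -> m g = h (hat g)) ->
  generator_lift m =1 (fun X => h (theta X)).
Proof.
move=> hL mE [[[ga sb] vc] bb]; rewrite /generator_lift /theta /th /=.
have add4 (x1 x2 y1 y2 z1 z2 w1 w2 : L) : x1 = x2 -> y1 = y2 -> z1 = z2 -> w1 = w2 ->
    x1 + y1 + z1 + w1 = x2 + y2 + z2 + w2 by move=> -> -> -> ->.
rewrite !(linearDP hL) (linearDP (@inX_lin F I q)) (linearDP hL).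
apply: add4.
- apply: (@plift_id F E a sp Fx L (fun x al => m (GenGA x al))
    (fun t => h (inX (th_ga t)))) => [|x al sx xF].
    by move=> k x y; rewrite th_ga_lin (@inX_lin F I q) hL.
  by rewrite th_gaE // mE.
- apply: (@plift_id F E a sym Sk L (fun x al => m (GenSB x al))
    (fun t => h (inX (th_sb t)))) => [|x al sx xF].
    by move=> k x y; rewrite th_sb_lin (@inX_lin F I q) hL.
  by rewrite th_sbE // mE.
- have -> : (fun v c => m (GenVC v c)) = fun v c => h (inW (vc_of (tens v c))).
    by apply/funext => u; apply/funext => c; rewrite mE //= vc_ofE.
  apply: (tlift_id (h := fun t => h (inW (vc_of t)))).
  by move=> k x y; rewrite vc_of_linear (@inW_lin F I q) hL.
(* [qlift] evaluates at [repr], and [model_of] uses the same representative of the class modulo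
   K. *)
- rewrite /qlift; set w := repr (repr bb).
  have -> : repr bb = qclass _ w by rewrite qclass_repr.
  have -> : (fun b1 b2 => m (GenBB I b1 b2)) =
      fun b1 b2 => h (hz (bb_of (bclass (tens b1 b2)))).
    apply/funext => b1; apply/funext => b2; rewrite mE //=.
    by rewrite -[bclass _]/(bpair b1 b2) bb_of_bpair.
  rewrite -(linearDP hL) -/(hz _).
  apply: (tlift_id (h := fun t => h (hz (bb_of (bclass t))))).
  by move=> k x y; rewrite bclass_linear bb_of_linear hz_lin hL.
Qed.

Theorem bracketE X Y : bracket l I0 K X Y = rho (mbr (theta X) (theta Y)).
Proof.
have mB := @mbr_bil F I q.
rewrite /bracket (generator_liftE (h := fun u => rho (mbr u (theta Y)))) // => [k u u'|g vg].
  by rewrite mB.1 rhoL.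
rewrite (generator_liftE (h := fun u => rho (mbr (hat g) u))) // => [k u u'|h vh].
  by rewrite mB.2 rhoL.
exact: bracket_generatorE.
Qed.

End BracketModel.

(** * The Lie algebra structure of L(q, K) *)

Section LieStructure.
Variables (F : fieldType) (I : choiceType) (l : nat) (I0 : {fset I}) (q : quadrupleBC F).
Variable K : submodClosed (bbracket q).
Hypothesis nz2 : (2 : F) != 0.
Hypothesis nzl : (l%:R : F) != 0.
Hypothesis card_I0 : #|` I0| = l.
Local Notation V := (Vsp F I).
Local Notation E := (V -> V).
Local Notation gl := (glJ F I).
Local Notation elem := (@elem F I).
Local Notation sg := (@sg F I).
Local Notation bar := (@bar I).
Local Notation star := (qstar q).
Local Notation act := (qact (q := q)).
Local Notation VC := (VC I q).
Local Notation BB := (BB q).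
Local Notation ot := (@ot F I q).
Local Notation L := (LqK I K).
Local Notation sp := (spI F I).
Local Notation sym := (symI F I).
Local Notation Fx := (fixed q).
Local Notation Sk := (Defs.skew q).
Local Notation I0op := (idI0 I0 : E).
Local Notation inX := (@inX F I q).
Local Notation inW := (@inW F I q).
Local Notation inZ := (@inZ F I q).

Local Notation GA := (tensor (subspace sp) (subspace Fx)).
Local Notation SB := (tensor (subspace sym) (subspace Sk)).

Local Notation Lga := (@L_ga F I q K).
Local Notation Lsb := (@L_sb F I q K).
Local Notation Lvc := (@Lvc F I q K).
Local Notation Lbb := (@Lbb F I q K).

Local Notation rhoA := (@rhoA F I l I0 q K).
Local Notation mbr := (@mbr F I q).
Local Notation "2l" := ((2 * l)%:R : F).

Local Notation rho := (@realize F I l I0 q K).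

Local Notation hz := (@bb_model F I l I0 q).
Local Notation model_ok := (@model_ok F I q).

Let nz2l : (2 * l)%:R != 0 :> F.
Proof. by rewrite natrM mulf_neq0. Qed.
Let rhoL : linear rho. Proof. exact: rho_lin. Qed.
Let rX X : rho (inX X) = rhoA X. Proof. exact: rho_X. Qed.
Let rW w : rho (inW w) = Lvc w. Proof. exact: rho_W. Qed.
Let rZ z : rho (inZ z) = Lbb z. Proof. exact: rho_Z. Qed.

Local Notation th := (@model_part F I q K).
Local Notation theta := (@model_of F I l I0 q K).

Lemma ok_ot x al : x \in gl -> trace x = 0 -> tau (ot x al) = - ot x al ->
  model_ok (inX (ot x al)).
Proof.
move=> gx tx sk; split=> //=.
by rewrite ot_mtr // tx scale0r (linear0P (@bst_lin F q)).
Qed.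

Lemma ok_ga x al : x \in sp -> al \in Fx -> model_ok (inX (ot x al)).
Proof.
move=> /spE[gx ax] /FxP xF; have gN : - x \in gl by rewrite rpredN.
apply: ok_ot => //.
  by apply: (eqN_eq0 nz2 (W := F^o)); rewrite -[RHS](traceN gx) (trace_adjoint nz2 gx gN ax).
by rewrite (ot_tau nz2 al gx gN ax) xF otN.
Qed.

Lemma ok_sb s be : s \in sym -> be \in Sk -> model_ok (inX (ot s be)).
Proof.
move=> /symE[gs ts as_] /SkP sS; apply: ok_ot => //.
by rewrite (ot_tau nz2 be gs gs as_) sS (linearNP (ot_lin s)).
Qed.

Lemma ok_W w : model_ok (inW w).
Proof.
split=> /=; first by rewrite (linear0P (@tau_lin F I q)) oppr0.
by rewrite (linear0P (@mtr_lin F I q)) (linear0P (@bst_lin F q)).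
Qed.

Lemma ok_hz z : model_ok (hz z).
Proof.
have gI := gl_idI0 F I0.
split; rewrite /= addr0.
  rewrite (ot_tau nz2 _ gI gI (@adjoint_idI0 F I I0)) (SkP (bstI_Sk l z)).
  by rewrite (linearNP (ot_lin _)).
by rewrite ot_mtr // trace_idI0 card_I0 scalerA divff // scale1r add0r.
Qed.

Let okL : closed_lin model_ok := @model_ok_lin F I q.

Lemma ok_th X : model_ok (th X).
Proof.
apply: closed_linD => //; last exact: ok_W.
rewrite (linearDP (@inX_lin F I q)); apply: closed_linD => //.
  move: (X.1.1.1); apply: ptens_ind => [|x al sx xF].
    split=> [|k u v ok1 ok2].
      by rewrite (linear0P (@th_ga_lin F I q)) (linear0P (@inX_lin F I q)); case: okL.
    by rewrite th_ga_lin (@inX_lin F I q); apply: okL.2.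
  by rewrite th_gaE //; exact: ok_ga.
move: (X.1.1.2); apply: ptens_ind => [|x al sx xF].
  split=> [|k u v ok1 ok2].
    by rewrite (linear0P (@th_sb_lin F I q)) (linear0P (@inX_lin F I q)); case: okL.
  by rewrite th_sb_lin (@inX_lin F I q); apply: okL.2.
by rewrite th_sbE //; exact: ok_sb.
Qed.

Lemma ok_theta X : model_ok (theta X).
Proof. by apply: closed_linD => //; [exact: ok_th | exact: ok_hz]. Qed.

Lemma rho_th_ga g : rho (inX (th_ga g)) = (g, 0, 0, 0).
Proof.
move: g; apply: ptens_ind => [|x al sx xF].
  have l1 : linear (fun g => rho (inX (th_ga g))).
    by move=> k u v; rewrite th_ga_lin (@inX_lin F I q) rhoL.
  have l2 : linear (fun g : GA => (g, 0, 0, 0) : L).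
    by move=> k u v; apply: L_eq; rewrite //= scaler0 addr0.
  exact: (closed_lin_eq l1 l2).
by rewrite th_gaE // rX (rhoA_sp K nz2 nzl card_I0) // LgaE.
Qed.

Lemma rho_th_sb s : rho (inX (th_sb s)) = (0, s, 0, 0).
Proof.
move: s; apply: ptens_ind => [|x al sx xF].
  have l1 : linear (fun s => rho (inX (th_sb s))).
    by move=> k u v; rewrite th_sb_lin (@inX_lin F I q) rhoL.
  have l2 : linear (fun s : SB => (0, s, 0, 0) : L).
    by move=> k u v; apply: L_eq; rewrite //= scaler0 addr0.
  exact: (closed_lin_eq l1 l2).
by rewrite th_sbE // rX (rhoA_sym K nz2 nzl card_I0) // LsbE.
Qed.

Lemma rho_theta X : rho (theta X) = X.
Proof.
have rhz z : rho (hz z) = Lbb z by exact: rho_hz.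
rewrite /model_of /model_part !(linearDP (@inX_lin F I q)).
rewrite (linearDP rhoL) rhz (linearDP rhoL) rW (linearDP rhoL) rho_th_ga rho_th_sb.
rewrite LvcE LbbE /bbc vc_ofK bb_ofK qclass_repr.
by apply: L_eq; rewrite /= ?addr0 ?add0r.
Qed.

Lemma th_Lga x al : x \in sp -> al \in Fx -> th (Lga x al) = inX (ot x al).
Proof.
move=> sx xF; rewrite /model_part LgaE /= th_gaE // (linear0P (@th_sb_lin F I q)) addr0.
by rewrite (linear0P (@vc_of_linear F I q)) (linear0P (@inW_lin F I q)) addr0.
Qed.

Lemma th_Lsb s be : s \in sym -> be \in Sk -> th (Lsb s be) = inX (ot s be).
Proof.
move=> sx xF; rewrite /model_part LsbE /= th_sbE // (linear0P (@th_ga_lin F I q)) add0r.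
by rewrite (linear0P (@vc_of_linear F I q)) (linear0P (@inW_lin F I q)) addr0.
Qed.

Lemma th_Lvc w : th (Lvc w) = inW w.
Proof.
rewrite /model_part LvcE /= vc_toK (linear0P (@th_ga_lin F I q)) (linear0P (@th_sb_lin F I q)).
by rewrite addr0 (linear0P (@inX_lin F I q)) add0r.
Qed.

Lemma th_Lbb z : th (Lbb z) = 0.
Proof.
rewrite /model_part LbbE /= (linear0P (@th_ga_lin F I q)) (linear0P (@th_sb_lin F I q)).
rewrite (linear0P (@vc_of_linear F I q)) (linear0P (@inW_lin F I q)).
by rewrite !addr0 (linear0P (@inX_lin F I q)).
Qed.

(** [realize] keeps the skew half of a matrix but forgets the I_0 component that carries its
    trace. *)
Lemma th_rhoA X : th (rhoA X) = inX (2^-1 *: (X - tau X)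
  - ot I0op (2l^-1 *: skew_part (mtr X))).
Proof.
have rAL : linear rhoA by exact: rhoA_lin.
have sL := @skew_part_lin F q; have oL := @ot_lin F I q.
move: X; apply: MA_ind => [|j k x].
  have l1 : linear (fun X => th (rhoA X)).
    by move=> c u v; rewrite rAL (@th_lin F I q K).
  have l2 : linear (fun X => inX (2^-1 *: (X - tau X) - ot I0op (2l^-1 *: skew_part (mtr X)))).
    move=> c u v; rewrite (@tau_lin F I q) (@mtr_lin F I q) sL.
    rewrite -(@inX_lin F I q); congr inX.
    rewrite !(linearZP (oL I0op) 2l^-1) (oL I0op c); lmodule F.
  exact: (closed_lin_eq l1 l2).
have ge := gl_elem F j k; have ad := @adjoint_elem F I j k.
have ge' : (sg j * sg k) *: elem (bar k) (bar j) \in gl by rewrite rpredZ ?gl_elem.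
rewrite -(@ot_elem F I q j k x) (ot_tau nz2 x ge ge' ad) (ot_mtr x ge).
rewrite (rhoA_ot K nz2 nzl card_I0 x ge ge' ad).
move: (elem j k) (_ *: elem _ _) ge ge' ad => phi psi gp gq ad.
rewrite /rho_op (linearDP (@th_lin F I q K)).
rewrite (th_Lga (spp_sp gp gq ad) (fixed_part_Fx x)).
rewrite (th_Lsb (smp_sym nz2 nzl card_I0 gp gq ad) (skew_part_Sk x)).
rewrite -(linearDP (@inX_lin F I q)); congr inX.
have gI := gl_idI0 F I0.
rewrite /spp /smp -scaleNr.
have gB : phi - psi \in gl by rewrite rpredB.
have gD : phi + psi \in gl by rewrite rpredD.
have gqN : - psi \in gl by rewrite rpredN.
have gZ : 2^-1 *: (phi + psi) \in gl by rewrite rpredZ.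
rewrite (otZ _ _ gB) (otD _ gp gqN) (otN _ gq) (otD _ gZ); last by rewrite rpredZ.
rewrite (otZ _ _ gD) (otD _ gp gq) (otZ _ _ gI) (linearZP (oL I0op) 2l^-1).
have -> : ot psi (star x) = ot psi (fixed_part x) - ot psi (skew_part x).
  rewrite -(linearNP (oL _)) -(linearDP (oL _)); congr (ot _ _).
  by rewrite {1}(fixed_skewE nz2 x) (linearDP (@qstar_lin F q)) star_fixed star_skew.
have -> : ot phi x = ot phi (fixed_part x) + ot phi (skew_part x).
  by rewrite -(linearDP (oL _)) -fixed_skewE.
rewrite (linearZP sL) (linearZP (oL I0op)); move: (trace phi) => t.
by lmodulef F.
Qed.

Lemma th_rho u : model_ok u -> th (rho u) = u - hz u.2.
Proof.
move=> [sk tr]; rewrite /realize !(linearDP (@th_lin F I q K)) th_rhoA th_Lvc th_Lbb.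
rewrite sk tr skew_part_skew ?star_bst //.
have -> : 2^-1 *: (u.1.1 - - u.1.1) = u.1.1 by lmodulef F.
apply: model_eq => /=; first by rewrite !addr0.
  by rewrite !addr0 add0r subr0.
by rewrite !addr0 add0r subrr.
Qed.

Lemma rho2 u : (rho u).2 = bbc K u.2.
Proof.
have rA2 X : (rhoA X).2 = 0.
  have rAL : linear rhoA by exact: rhoA_lin.
  move: X; apply: MA_ind => [|j k x].
    split=> [|c u' v u0 v0]; first by rewrite (linear0P rAL).
    by rewrite rAL /= u0 v0 scaler0 addr0.
  have ge := gl_elem F j k; have ad := @adjoint_elem F I j k.
  have ge' : (sg j * sg k) *: elem (bar k) (bar j) \in gl by rewrite rpredZ ?gl_elem.
  rewrite -(@ot_elem F I q j k x) (rhoA_ot K nz2 nzl card_I0 x ge ge' ad).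
  by rewrite /rho_op LgaE LsbE /= addr0.
by rewrite /realize /= rA2 LvcE LbbE /= !add0r.
Qed.

Section Uniform.
Hypothesis K_uniform : uniform_property l K.

Lemma bb_of_sum (s : seq (Defs.coord q * Defs.coord q)) :
  bb_of (\sum_(p <- s) bpair p.1 p.2) = \sum_(p <- s) bsum p.1 p.2.
Proof.
elim: s => [|p s IHs]; first by rewrite !big_nil (linear0P (@bb_of_linear F q)).
by rewrite !big_cons (linearDP (@bb_of_linear F q)) IHs bb_of_bpair.
Qed.

Lemma sum_lin (X Y : lmodType F) (T : Type) (g : X -> Y) (s : seq T) (x : T -> X) : linear g ->
  g (\sum_(p <- s) x p) = \sum_(p <- s) g (x p).
Proof.
move=> gL; elim: s => [|p s IHs]; first by rewrite !big_nil (linear0P gL).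
by rewrite !big_cons (linearDP gL) IHs.
Qed.

Lemma K_bst z : bb_to z \in K -> bst z = 0.
Proof.
move=> Kz; have [s [zE _]] := K_uniform.1 _ Kz.
have := K_uniform.2 s; rewrite -zE => /(_ Kz) sum0.
rewrite -[z]bb_toK zE bb_of_sum (sum_lin _ _ (@bst_lin F q)) -[RHS]sum0.
by apply: eq_bigr => p _; rewrite bst_bsum.
Qed.

(** Membership in HF gives a vanishing sum of derivations; on C it is multiplication by beta^* over
    2l, which is zero on K by [K_bst], plus [d0 z]. *)
Lemma K_d0 z c : bb_to z \in K -> d0 z c = 0.
Proof.
move=> Kz; have z0 := K_bst Kz; have [s [zE der0]] := K_uniform.1 _ Kz.
pose g (z : BB) := act (2l^-1 *: bst z) c + d0 z c.
have gL : linear g.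
  move=> k x y; rewrite /g bst_lin (d0_bil q).1 scalerDr !(bilDl (act_bil q)) scalerA.
  by rewrite !(bilZl (act_bil q)); lmodule F.
have : g z = 0.
  rewrite -[z]bb_toK zE bb_of_sum (sum_lin _ _ gL).
  have := congr1 (fun h => (h (of_C c)).2) der0.
  rewrite /= fct_sumE (_ : (\sum_(p <- s) der l p.1 p.2 (of_C c)).2 =
    \sum_(p <- s) (der l p.1 p.2 (of_C c)).2); last by elim/big_rec2: _ => // p x y _ <-.
  move=> E; rewrite -[RHS]E; apply: eq_bigr => p _.
  by rewrite (derE nz2 nzl).
by rewrite /g z0 scaler0 (bil0l (act_bil q)) add0r.
Qed.

(** Matrices commute with {b, b} in the model, and both [zact] and [B0] are built from [d0]. *)
Lemma K_central z u : bb_to z \in K -> mbr (inZ z) u = 0.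
Proof.
move=> Kz; have z0 c := K_d0 c Kz.
have B00 z' : B0 z z' = 0.
  move: z'; apply: BB_ind => [|x y|c c'].
  - by split=> [|k x y x0 y0]; rewrite ?(bil0r (B0_bil q)) // (B0_bil q).2 x0 y0 scaler0 addr0.
  - by rewrite B0_a.
  - by rewrite B0_pc /B0_c !z0 (bil0l (pc_bil q)) (bil0r (pc_bil q)) addr0.
have za w : zact z w = 0 :> VC.
  move: w; apply: VC_ind => [|j c]; last by rewrite zactE z0 (linear0P (@vce_lin F I q j)).
  have zB := @zact_bil F I q.
  by split=> [|k x y x0 y0]; rewrite ?(bil0r zB) // zB.2 x0 y0 scaler0 addr0.
rewrite [u]modelE !(bilDr (@mbr_bil F I q)) (mbrZX nz2) mbrZW mbrZZ za B00.
by rewrite (linear0P (@inW_lin F I q)) (linear0P (@inZ_lin F I q)) !addr0.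
Qed.

Lemma hz_K z : bb_to z \in K -> hz z = inZ z.
Proof.
move=> Kz; rewrite /bb_model K_bst // scaler0.
by rewrite (linear0P (ot_lin _)) (linear0P (@inX_lin F I q)) add0r.
Qed.

(** The only ambiguity is the representative of the {b, b}-component modulo K. *)
Lemma theta_rho u : model_ok u ->
  exists2 z, bb_to z \in K & theta (rho u) = u + inZ z.
Proof.
move=> ok; have Kz : bb_to (bb_of (repr (bbc K u.2)) - u.2) \in K.
  rewrite (linearDP (@bb_to_linear F q)) (linearNP (@bb_to_linear F q)) bb_ofK.
  by apply/qclassP; rewrite qclass_repr.
exists (bb_of (repr (bbc K u.2)) - u.2) => //.
rewrite -(hz_K Kz) /model_of th_rho // rho2 (linearDP (@hz_lin F I l I0 q)).
by rewrite (linearNP (@hz_lin F I l I0 q)) [RHS]addrA addrAC.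
Qed.

Local Notation br := (bracket l I0 K).

(** By [K_central] the model bracket in [bracketE] does not see the ambiguity of [theta_rho]. *)
Lemma bracket_rho u u' : model_ok u -> model_ok u' -> br (rho u) (rho u') = rho (mbr u u').
Proof.
have mB := @mbr_bil F I q.
move=> ok ok'; rewrite (bracketE nz2 nzl card_I0).
have [z Kz ->] := theta_rho ok; have [z' Kz' ->] := theta_rho ok'.
rewrite (bilDl mB) (K_central _ Kz) addr0 (bilDr mB) (mbr_antisym nz2 u (inZ z')).
by rewrite (K_central _ Kz') oppr0 addr0.
Qed.

Lemma rho_onto X : exists2 u, model_ok u & rho u = X.
Proof. by exists (theta X); [exact: ok_theta | exact: rho_theta]. Qed.

(** All identities, linearity included, are pulled back to [model_ok] elements, which [realize] maps
    onto L(q, K). *)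
Lemma bracket_lie : is_lie_bracket br.
Proof.
have mB := @mbr_bil F I q; have okM u u' := @model_ok_mbr F I q nz2 u u'.
have L1 X X' Y k : br (k *: X + X') Y = k *: br X Y + br X' Y.
  have [u ok uE] := rho_onto X; have [u' ok' uE'] := rho_onto X'.
  have [w okw wE] := rho_onto Y; subst X X' Y.
  have okk : model_ok (k *: u + u') by exact: okL.2.
  transitivity (br (rho (k *: u + u')) (rho w)); first by rewrite rhoL.
  rewrite (bracket_rho okk okw) (bracket_rho ok okw) (bracket_rho ok' okw).
  by rewrite mB.1 rhoL.
have A X : br X X = 0.
  have [u ok uE] := rho_onto X; subst X.
  by rewrite bracket_rho // (mbr_alt nz2) (linear0P rhoL).
split=> // [Y k X X'|X k Y Y'|X Y Z].
- exact: L1.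
- have N W W' : br W W' = - br W' W.
    have [u ok uE] := rho_onto W; have [u' ok' uE'] := rho_onto W'; subst W W'.
    rewrite (bracket_rho ok ok') (bracket_rho ok' ok).
    by rewrite -(linearNP rhoL) -(mbr_antisym nz2).
  by rewrite (N X (k *: Y + Y')) L1 (N X Y) (N X Y') opprD scalerN.
- have [u ok uE] := rho_onto X; have [v okv vE] := rho_onto Y.
  have [w okw wE] := rho_onto Z; subst X Y Z.
  rewrite (bracket_rho okv okw) (bracket_rho okw ok) (bracket_rho ok okv).
  rewrite (bracket_rho ok (okM _ _ okv okw)) (bracket_rho okv (okM _ _ okw ok)).
  rewrite (bracket_rho okw (okM _ _ ok okv)).
  rewrite -!(linearDP rhoL) -[RHS](linear0P rhoL); congr (rho _).
  by apply: (mbr_jacobi nz2); case: ok okv okw => ? ? [? ?] [].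
Qed.

End Uniform.

End LieStructure.

(** * The universal central extension *)

Section Perfect.
Variables (F : fieldType) (I : choiceType) (q : quadrupleBC F).
Hypothesis nz2 : (2 : F) != 0.
Hypothesis I_infinite : infinite_set [set: I].
Local Notation U := (model I q).
Local Notation mbr := (@mbr F I q).
Local Notation model_ok := (@model_ok F I q).

(** Root elements are eigenvectors of some h_j with nonzero weight, hence multiples of brackets;
    [model_ok_ind] does the rest. *)
Lemma model_ok_perfect (Q : U -> Prop) : closed_lin Q ->
  (forall u v, model_ok u -> model_ok v -> Q (mbr u v)) ->
  forall u, model_ok u -> Q u.
Proof.
move=> clQ Qmbr u ok.
have okhh j := @ok_hh F I q j; have okvv j c := @ok_vv F I q j c.
have oksk j k x jk := @ok_sk F I q j k x jk.
have scaleQ k v : k != 0 -> Q (k *: v) -> Q v.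
  move=> nzk Qkv; have -> : v = k^-1 *: (k *: v) by rewrite scalerA mulVf // scale1r.
  exact: closed_linZ.
apply: (model_ok_ind nz2 I_infinite) ok => //.
(* The weight of t_{j,k}(x) at h_j is 1, or 2 when k = bar j. *)
- move=> j k x jk; have nzw : @weight F I j j - @weight F I k j != 0.
    rewrite wt_self /weight /kron (eq_sym k) (negPf jk) sub0r opprK.
    by case: (k == _) => /=; [exact: nz2 | rewrite addr0 oner_neq0].
  apply: (scaleQ _ _ nzw); rewrite -(mbr_hh_sk nz2); apply: Qmbr => //; exact: oksk.
- move=> j c; have nzw : @weight F I j j != 0 by rewrite wt_self oner_neq0.
  by apply: (scaleQ _ _ nzw); rewrite -mbr_hh_vv; apply: Qmbr.
- move=> j k x y jk; apply: Qmbr; apply: oksk; first exact: far_neq.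
  by rewrite eq_sym; exact: far_neq.
- by move=> *; apply: Qmbr.
Qed.

End Perfect.

Lemma linear_pack (F : fieldType) (A B : lmodType F) (f : A -> B) : linear f ->
  exists g : {linear A -> B}, g =1 f.
Proof.
move=> fL; pose fb := GRing.isLinear.Build F A B *:%R f fL.
by exists (HB.pack_for {linear A -> B} f fb).
Qed.

Section UniversalExtension.
Variables (F : fieldType) (I : choiceType) (l : nat) (I0 : {fset I}) (q : quadrupleBC F).
Variable K : submodClosed (bbracket q).
Hypothesis nz2 : (2 : F) != 0.
Hypothesis nz3 : (3 : F) != 0.
Hypothesis nzl : (l%:R : F) != 0.
Hypothesis card_I0 : #|` I0| = l.
Hypothesis I_infinite : infinite_set [set: I].
Hypothesis K_uniform : uniform_property l K.
Local Notation U := (model I q).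
Local Notation inZ := (@inZ F I q).
Local Notation mbr := (@mbr F I q).
Local Notation model_ok := (@model_ok F I q).
Local Notation Z0 := (zero_space (bbracket q)).
Local Notation L := (LqK I K).
Local Notation A := (LqK I Z0).
Local Notation rhoK := (@realize F I l I0 q K).
Local Notation rho0 := (@realize F I l I0 q Z0).
Local Notation theta0 := (@model_of F I l I0 q Z0).
Local Notation brK := (bracket l I0 K).
Local Notation br0 := (bracket l I0 Z0).

(** Since beta^* is well defined on {b, b}, it vanishes on every sum of pairs that is zero. *)
Lemma uniform_zero_space : uniform_property l Z0.
Proof.
have bsL := @bst_lin F q; split=> [z|s]; rewrite inE => /eqP s0.
  by exists [::]; rewrite !big_nil.
have := congr1 (fun z => bst (bb_of z)) s0.
rewrite (linear0P (@bb_of_linear F q)) (linear0P bsL) bb_of_sum (sum_lin _ _ bsL) => E.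
by rewrite -[RHS]E; apply: eq_bigr => p _; rewrite bst_bsum.
Qed.

Let okL : closed_lin model_ok := @model_ok_lin F I q.
Let okM u u' : model_ok u -> model_ok u' -> model_ok (mbr u u').
Proof. exact: model_ok_mbr. Qed.

Let rho0L : linear rho0. Proof. exact: rho_lin. Qed.
Let rhoKL : linear rhoK. Proof. exact: rho_lin. Qed.
Let bracket0 u u' : model_ok u -> model_ok u' ->
  br0 (rho0 u) (rho0 u') = rho0 (mbr u u').
Proof. exact/bracket_rho/uniform_zero_space. Qed.
Let bracketK u u' : model_ok u -> model_ok u' ->
  brK (rhoK u) (rhoK u') = rhoK (mbr u u').
Proof. exact: bracket_rho. Qed.

Lemma theta0_rho0 u : model_ok u -> theta0 (rho0 u) = u.
Proof.
move=> ok; have [z] := theta_rho nz2 nzl card_I0 uniform_zero_space ok.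
rewrite inE => /eqP z0 ->; rewrite -[z]bb_toK z0 (linear0P (@bb_of_linear F q)).
by rewrite (linear0P (@inZ_lin F I q)) addr0.
Qed.

Lemma rho0_onto X : exists2 u, model_ok u & rho0 u = X.
Proof. exact: rho_onto. Qed.
Lemma rhoK_onto X : exists2 u, model_ok u & rhoK u = X.
Proof. exact: rho_onto. Qed.

Lemma theta0_lin : linear theta0.
Proof.
move=> k X X'; have [u ok uE] := rho0_onto X; have [u' ok' uE'] := rho0_onto X'.
subst X X'; have okk : model_ok (k *: u + u') by exact: okL.2.
transitivity (theta0 (rho0 (k *: u + u'))); first by rewrite rho0L.
by rewrite (theta0_rho0 okk) (theta0_rho0 ok) (theta0_rho0 ok').
Qed.

Definition pi0 (X : A) : L := rhoK (theta0 X).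

Lemma pi0_lin : linear pi0.
Proof. by move=> k X X'; rewrite /pi0 theta0_lin rhoKL. Qed.

Lemma pi0_rho0 u : model_ok u -> pi0 (rho0 u) = rhoK u.
Proof. by move=> ok; rewrite /pi0 theta0_rho0. Qed.

(** Compare [theta_rho] with the value of [model_of] at 0, which lies in the copy of K. *)
Lemma rhoK_ker u : model_ok u -> rhoK u = 0 ->
  exists2 z, bb_to z \in K & u = inZ z.
Proof.
move=> ok u0.
have K0 : bb_to (bb_of (repr (0 : quotient K))) \in K.
  rewrite bb_ofK -[repr _]subr0; apply/qclassP.
  by rewrite qclass_repr (linear0P (@qclass_linear F _ K)).
have [z Kz] := theta_rho nz2 nzl card_I0 K_uniform ok.
rewrite u0 /model_of (linear0P (@th_lin F I q K)) add0r.
rewrite (hz_K I0 nz2 K_uniform K0) => E.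
exists (bb_of (repr (0 : quotient K)) - z).
  by rewrite (linearDP (@bb_to_linear F q)) (linearNP (@bb_to_linear F q)) -scaleN1r rpredD ?rpredZ.
rewrite (linearDP (@inZ_lin F I q)) (linearNP (@inZ_lin F I q)).
by rewrite E addrK.
Qed.

Lemma pi0_central X Y : pi0 X = 0 -> br0 X Y = 0.
Proof.
have [u ok uE] := rho0_onto X; have [v okv vE] := rho0_onto Y; subst X Y.
rewrite (pi0_rho0 ok) => /(rhoK_ker ok)[z Kz uE]; rewrite (bracket0 ok okv) uE.
by rewrite (K_central nz2 nzl K_uniform) // (linear0P rho0L).
Qed.

Lemma pi0_extension (pi : {linear A -> L}) : pi =1 pi0 ->
  is_central_extension br0 brK pi.
Proof.
move=> piE; split.
- exact/bracket_lie/uniform_zero_space.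
- exact: bracket_lie.
- move=> X Y; have [u ok uE] := rho0_onto X; have [v okv vE] := rho0_onto Y.
  subst X Y; rewrite !piE (pi0_rho0 ok) (pi0_rho0 okv) (bracket0 ok okv).
  by rewrite (bracketK ok okv) pi0_rho0 //; exact: okM.
- move=> Y; have [v okv vE] := rhoK_onto Y; exists (rho0 v).
  by rewrite piE pi0_rho0.
- by move=> X; rewrite piE => X0 Y; exact: pi0_central.
Qed.

(** * Lifting along an arbitrary central extension *)

Section Lifting.
Variables (M : lmodType F) (brM : M -> M -> M) (phi : {linear M -> L}).
Hypothesis ext : is_central_extension brM brK phi.

Let lieM := ext_lie_source ext.
Let brB : bilinear_map brM.
Proof. by split; [exact: lie_linearl lieM | exact: lie_linearr lieM]. Qed.
Let brN m n : brM m n = - brM n m.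
Proof.
have := lie_alternating lieM (m + n).
rewrite !(bilDl brB, bilDr brB) !(lie_alternating lieM) add0r addr0 => E.
by apply/eqP; rewrite -addr_eq0 E.
Qed.
(** The kernel of phi is central, so brackets in M depend only on images in L(q, K). *)
Let brl m m' n : phi m = phi m' -> brM m n = brM m' n.
Proof.
move=> mm; apply/eqP; rewrite -subr_eq0 -(bilNl brB) -(bilDl brB); apply/eqP.
by apply: (ext_central ext); rewrite linearB mm subrr.
Qed.
Let brlr m m' n n' : phi m = phi m' -> phi n = phi n' -> brM m n = brM m' n'.
Proof. by move=> mm nn; rewrite (brl _ mm) brN (brl _ nn) -brN. Qed.

(** A set-theoretic section, not linear in general; [om] is bilinear nevertheless, thanks to
    [brl]. *)
Let sec (X : L) : M := projT1 (cid (ext_surjective ext X)).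
Let secK X : phi (sec X) = X.
Proof. exact: projT2 (cid (ext_surjective ext X)). Qed.

Let om (u u' : U) : M := brM (sec (rhoK u)) (sec (rhoK u')).

Let om_bil : bilinear_map om.
Proof.
have E k u v : phi (sec (rhoK (k *: u + v))) = phi (k *: sec (rhoK u) + sec (rhoK v)).
  by rewrite linearP !secK rhoKL.
split=> [w|w] k u v.
  by rewrite /om (brl _ (E k u v)) brB.1.
by rewrite /om (brlr (erefl _) (E k u v)) brB.2.
Qed.

Let om_alt u : om u u = 0. Proof. exact: lie_alternating lieM _. Qed.

Let sec_mbr u v : model_ok u -> model_ok v -> phi (sec (rhoK (mbr u v))) = phi (om u v).
Proof. by move=> ok okv; rewrite secK (ext_morphism ext) !secK bracketK. Qed.

Let om_cocycle u u' u'' : model_ok u -> model_ok u' -> model_ok u'' ->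
  om (mbr u u') u'' + om (mbr u' u'') u + om (mbr u'' u) u' = 0.
Proof.
move=> ok ok' ok''; rewrite /om (brl _ (sec_mbr ok ok')).
rewrite (brl _ (sec_mbr ok' ok'')) (brl _ (sec_mbr ok'' ok)).
rewrite /om; move: (sec (rhoK u)) (sec (rhoK u')) (sec (rhoK u'')) => x y z.
rewrite (brN (brM x y)) (brN (brM y z)) (brN (brM z x)) -!opprD.
apply/eqP; rewrite oppr_eq0; apply/eqP.
by rewrite -[RHS](lie_jacobi lieM x y z) -[LHS]addrA [LHS]addrC.
Qed.

Let psi_hat : U -> M := psi I_infinite om.
Let psi_hatL : linear psi_hat. Proof. exact: psi_lin. Qed.
Let psi_hatE u u' : model_ok u -> model_ok u' -> om u u' = psi_hat (mbr u u').
Proof. exact: cocycle_coboundary. Qed.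

(** On a bracket, psi gives a value of [om], which covers that bracket; and brackets span the
    [model_ok] elements. *)
Let phi_psi u : model_ok u -> phi (psi_hat u) = rhoK u.
Proof.
move: u; apply: (model_ok_perfect nz2 I_infinite).
  by apply: closed_lin_eq => // k u v; rewrite psi_hatL linearP.
by move=> u v ok okv; rewrite -psi_hatE // -sec_mbr // secK.
Qed.

Lemma lifting_exists (pi : {linear A -> L}) : pi =1 pi0 ->
  exists psi : {linear A -> M}, [/\ lie_morphism br0 brM psi, phi \o psi =1 pi &
    forall psi' : {linear A -> M}, lie_morphism br0 brM psi' ->
      phi \o psi' =1 pi -> psi' =1 psi].
Proof.
move=> piE; have psiL : linear (fun X => psi_hat (theta0 X)).
  by move=> k X Y; rewrite theta0_lin psi_hatL.
have [psi psiE] := linear_pack psiL.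
have psi_rho u : model_ok u -> psi (rho0 u) = psi_hat u.
  by move=> ok; rewrite psiE theta0_rho0.
have phiE : phi \o psi =1 pi.
  move=> X; have [u ok uE] := rho0_onto X; subst X.
  by rewrite piE pi0_rho0 //= psi_rho // phi_psi.
exists psi; split=> // [X Y|psi' morph' phiE' X].
  have [u ok uE] := rho0_onto X; have [v okv vE] := rho0_onto Y; subst X Y.
  rewrite (bracket0 ok okv) (psi_rho _ (okM ok okv)) -(psi_hatE ok okv).
  (* [psi] and [sec] lift the same elements, so their brackets in M agree. *)
  apply: brlr; rewrite psi_rho //; by rewrite secK phi_psi.
have [u ok uE] := rho0_onto X; subst X.
move: u ok; apply: (model_ok_perfect nz2 I_infinite).
  by apply: closed_lin_eq => k u v; rewrite rho0L linearP.
(* On brackets, a homomorphism that lifts [pi] is determined by images in L(q, K). *)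
move=> u v ok okv; rewrite -(bracket0 ok okv) morph'.
rewrite (bracket0 ok okv) (psi_rho _ (okM ok okv)) -(psi_hatE ok okv).
apply: brlr; rewrite secK; first by rewrite -(pi0_rho0 ok) -piE -phiE'.
by rewrite -(pi0_rho0 okv) -piE -phiE'.
Qed.

End Lifting.

Lemma universal_extension : is_universal_central_extension br0 brK.
Proof.
have [pi piE] := linear_pack pi0_lin.
exists pi; first exact: pi0_extension.
by move=> M brM phi ext; exact: lifting_exists.
Qed.

End UniversalExtension.

Theorem theorem1p52 (F : fieldType) (F_char0 : [pchar F] =i pred0)
    (I : choiceType) (I_infinite : infinite_set [set: I])
    (l : nat) (l_gt3 : (3 < l)%N) (I0 : {fset I}) (card_I0 : #|` I0| = l)
    (q : quadrupleBC F)
    (K : submodClosed (bbracket q)) (K_uniform : uniform_property l K) :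
  uniform_property l (zero_space (bbracket q)) /\
  is_universal_central_extension
    (bracket l I0 (zero_space (bbracket q))) (bracket l I0 K).
Proof.
have nz n : (0 < n)%N -> (n%:R : F) != 0.
  by move=> n0; rewrite (proj1 (pcharf0P F) F_char0) -lt0n.
have nz2 := nz 2 isT; have nz3 := nz 3 isT.
have nzl : (l%:R : F) != 0 by apply: nz; case: (l) l_gt3.
split; first exact: uniform_zero_space.
exact: universal_extension.
Qed.
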